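(* Let $p\in[0,1]$. (i) If $\Omega$ is a solution of the killing-passing-reflecting Hele-Shaw problem with parameter $p$ (described in the context), then $$\int_\Omega \mathrm{Re}(z^{n+\alpha})\,dx\,dy=0,\qquad \int_\Omega\mathrm{Re}(z^{n-\alpha})\,dx\,dy=0,\qquad n\in\mathbb{N}=\{1,2,\dots\},$$ where $\alpha=\frac{\arccos(p)}{2\pi}$. In particular, $0\le\alpha\le\frac14$. (ii) For $p=1$ (so $\alpha=0$), one has $$\int_\Omega\mathrm{Re}(z^n)\,dx\,dy=0,\qquad \int_\Omega\mathrm{Re}(z^n\log(z))\,dx\,dy=0,\qquad n\in\mathbb{N}=\{1,2,\dots\}.$$
   Context: Write $z=x+iy$ for the complex coordinate in the plane and $\mathbb{R}_+$ for the positive half-axis. A continuous branch of $\log(z)$ in $\Omega\setminus\mathbb{R}_+$ is fixed by requiring it to be real on the reflecting boundary, i.e. the limit of $\log(z)$ from above is real at nonzero points of $\mathbb{R}_+$. This also fixes the branches $z^s=e^{s\log(z)}$ for any $s$. The killing-passing-reflecting Hele-Shaw problem with parameter $p$ is the expected scaling limit of a discrete aggregation model with particles injected at the origin, in which particles hitting the positive half-axis from above are reflected, while those coming from below pass through with probability $p$ and are killed with probability $1-p$. It is the following problem. The boundary of the region $\Omega$ consists of a curve $\Gamma$ and an interval $[a,b]$ of the positive half-axis, where $\Gamma$ goes counterclockwise from $b$ to $a$ around the origin. The (harmonic) potential $\Phi$ in $\Omega$, corresponding to injection at the origin, satisfies the boundary conditions $$\Phi=0\ \text{ on }\Gamma;\qquad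 (\Phi_y)_+=0\ \text{ on }[a,b];\qquad \Phi_-=0\ \text{ on }[0,a];\qquad (\Phi_y)_+=p\,(\Phi_y)_-\ \text{ on }[0,a].$$ Here $\Phi_y$ is the derivative of $\Phi$ with respect to $y$, and $+,-$ denote the one-sided limits from above and from below ($\Phi$ and $\Phi_y$ are not assumed continuous on $(0,a)$). The condition on $\Omega$ is that it transforms homothetically under the Hele-Shaw flow, i.e. the infinitesimal deformation of the boundary curve $\Gamma$ given by the normal derivative of $\Phi$ is homothetic. *)

(* Defs.v *)
From mathcomp Require Import all_boot all_order all_algebra.
From mathcomp Require Import all_classical all_reals all_analysis.
From mathcomp Require Import complex.
Import Order.TTheory GRing.Theory Num.Theory numFieldNormedType.Exports.

Set Implicit Arguments.
Unset Strict Implicit.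
Unset Printing Implicit Defensive.

Local Open Scope classical_set_scope.
Local Open Scope ring_scope.
Local Open Scope complex_scope.

Section Plane.
Context {R : realType}.

(* The library norm on R * R is the sup norm, hence the Euclidean modulus. *)
Definition modulus (z : R * R) : R := Num.sqrt (z.1 ^+ 2 + z.2 ^+ 2).

Definition dot (u v : R * R) : R := u.1 * v.1 + u.2 * v.2.

Definition pos_axis : set (R * R) := [set z | 0 <= z.1 /\ z.2 = 0].

(* The branch of the argument with values in [0, 2 pi[: its limit at the
   positive half-axis is 0 from above and 2 pi from below. *)
Definition arg (z : R * R) : R :=
  if 0 <= z.2 then acos (z.1 / modulus z) else 2 * pi - acos (z.1 / modulus z).

Definition plane_log (z : R * R) : R[i] := ln (modulus z) +i* arg z.

Definition cexp (w : R[i]) : R[i] :=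
  (expR (complex.Re w))%:C * (cos (complex.Im w) +i* sin (complex.Im w)).

Definition plane_pow (z : R * R) (s : R) : R[i] := cexp (s%:C * plane_log z).

Definition area_integral (W : set (R * R)) (f : R * R -> R) : \bar R :=
  (\int[(@lebesgue_measure R \x @lebesgue_measure R)%E]_(z in W) (f z)%:E)%E.

Definition dx (f : R * R -> R) (z : R * R) : R := 'D_((1, 0) : R * R) f z.
Definition dy (f : R * R -> R) (z : R * R) : R := 'D_((0, 1) : R * R) f z.
Definition grad (f : R * R -> R) (z : R * R) : R * R := (dx f z, dy f z).

Definition harmonic_on (D : set (R * R)) (f : R * R -> R) : Prop :=
  forall z, D z ->
    [/\ [/\ differentiable f z, differentiable (dx f) z
          & differentiable (dy f) z],
        [/\ {for z, continuous (dx (dx f))}, {for z, continuous (dx (dy f))},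
            {for z, continuous (dy (dx f))} & {for z, continuous (dy (dy f))}]
      & dx (dx f) z + dy (dy f) z = 0].

(* Boundary value [l] of [f] at [z], z being approached from inside [D]
   without any restriction on the direction. *)
Definition trace (V : topologicalType) (f : R * R -> V) (D : set (R * R))
    (z : R * R) (l : V) : Prop :=
  f @ within D (nbhs z) --> l.

Definition regular_at (c : R -> R * R) (t : R) : Prop :=
  [/\ \forall s \near t, derivable c s 1,
      {for t, continuous (derive1 c)} & derive1 c t != 0].

(* Right-hand unit normal: the outward one for a counterclockwise curve. *)
Definition unit_normal (c : R -> R * R) (t : R) : R * R :=
  let v := derive1 c t in (v.2 / modulus v, - v.1 / modulus v).

(* [c], parametrized by [0, 1], is a simple piecewise C^1 curve going once
   counterclockwise around the origin from (b, 0) to (a, 0), and meeting the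
   positive half-axis only at its ends; [E] lists its exceptional points. *)
Record around_origin (a b : R) (c : R -> R * R) (E : seq R) : Prop := {
  around_continuous : {within `[0, 1], continuous c};
  around_injective : {in `[0, 1] &, injective c};
  around_start : c 0 = (b, 0);
  around_end : c 1 = (a, 0);
  around_regular : forall t : R, 0 < t < 1 -> t \notin E -> regular_at c t;
  around_angle : exists theta : R -> R,
    [/\ {within `[0, 1], continuous theta}, theta 0 = 0, theta 1 = 2 * pi,
        forall t : R, 0 < t < 1 -> 0 < theta t < 2 * pi
      & forall t : R, 0 <= t <= 1 ->
          c t = (modulus (c t) * cos (theta t), modulus (c t) * sin (theta t))]
}.

Record slit_region (a b : R) (W : set (R * R)) (c : R -> R * R)
    (E : seq R) : Prop := {
  region_slit : 0 < a < b;
  region_curve : around_origin a b c E;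
  region_open : open W;
  region_connected : connected W;
  region_bounded : bounded_set W;
  region_origin : W (0, 0);
  region_boundary : closure W `\` interior W =
    (c @` `[0, 1]) `|` [set z | a <= z.1 <= b /\ z.2 = 0]
}.

(* Potential of a source at the origin.  As the origin is the tip of the slit,
   where the type of the singularity depends on [p], the source is expressed
   by positivity together with unboundedness at the origin only; among
   functions with these boundary values this leaves the positive multiples of
   a single one (for p = 1 positivity excludes the potentials behaving like
   2 pi - arg z at 0, which have no source).
   The conditions are imposed in the relative interior of each piece of the
   boundary: at the junction (a, 0) the two sides of the slit have different
   boundary values, and there only boundedness is required. *)
Record source_potential (p a b : R) (W : set (R * R)) (c : R -> R * R)
    (Phi : R * R -> R) : Prop := {
  potential_harmonic : harmonic_on (W `\` pos_axis) Phi;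
  potential_gt0 : forall z, (W `\` pos_axis) z -> 0 < Phi z;
  potential_source : forall M e : R, 0 < e ->
    exists z, [/\ (W `\` pos_axis) z, modulus z < e & M < Phi z];
  potential_bounded : forall e : R, 0 < e ->
    exists M : R, forall z, (W `\` pos_axis) z -> e <= modulus z -> Phi z <= M;
  potential_curve : forall t : R, 0 < t < 1 -> trace Phi (W `\` pos_axis) (c t) 0;
  potential_reflecting : forall x : R, a < x < b ->
    exists (l : R) (g : R * R),
      let above := W `&` [set z | 0 < z.2] in
      [/\ trace Phi above (x, 0) l, trace (grad Phi) above (x, 0) g & g.2 = 0];
  potential_passing : forall x : R, 0 < x < a ->
    exists (l : R) (gp gm : R * R),
      let above := W `&` [set z | 0 < z.2] in
      let below := W `&` [set z | z.2 < 0] in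
      [/\ trace Phi above (x, 0) l, trace (grad Phi) above (x, 0) gp,
          trace Phi below (x, 0) 0, trace (grad Phi) below (x, 0) gm
        & gp.2 = p * gm.2]
}.

(* The boundary moves with outward normal velocity - dPhi/dn; the homothetic
   deformation is the one given by the vector field k z with k > 0. *)
Definition homothetic_flow (W : set (R * R)) (c : R -> R * R) (E : seq R)
    (Phi : R * R -> R) : Prop :=
  exists2 k : R, 0 < k & forall t : R, 0 < t < 1 -> t \notin E ->
    exists2 g : R * R, trace (grad Phi) (W `\` pos_axis) (c t) g &
      - dot g (unit_normal c t) = dot (k *: c t) (unit_normal c t).

Definition kpr_hele_shaw_solution (p : R) (W : set (R * R)) : Prop :=
  exists (a b : R) (c : R -> R * R) (E : seq R) (Phi : R * R -> R),
    [/\ slit_region a b W c E, source_potential p a b W c Phi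
      & homothetic_flow W c E Phi].

End Plane.

(* Main.v *)
Require Import Defs.
From mathcomp Require Import all_boot all_order all_algebra.
From mathcomp Require Import all_classical all_reals all_analysis.
From mathcomp Require Import measurable_realfun complex ring lra.
Import Order.TTheory GRing.Theory Num.Theory numFieldNormedType.Exports.

Set Implicit Arguments.
Unset Strict Implicit.
Unset Printing Implicit Defensive.

Local Open Scope classical_set_scope.
Local Open Scope ring_scope.

(** Write [D] for the region without the positive half-axis, [Phi] for the
    potential and [k > 0] for the rate of the homothety.  Let [f] be harmonic on
    the slit plane, with no flux through the upper side of the slit and with a
    value on the lower side equal to [p] times the value on the upper side (the
    record [adjoint]).  The field
    [f (grad Phi + k z) - Phi grad f]
    has divergence [k (2 f + z . grad f)].  It is tangent to the moving boundary,
    because homothety says that [grad Phi + k z] is and because [Phi] vanishes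
    there, and its normal components on the two sides of the slit agree, because
    [l (p g) = (p l) g].  Hence the integral of [2 f + z . grad f] over [D] is
    zero (theorem [orthogonality]).  For [f = Re (z^s)] this reads
    [(2 + s) int f = 0], and the conditions on the slit reduce to
    [cos (2 pi s) = p], that is [s = n + alpha] or [s = n - alpha].  When [p = 1]
    the function [Re (z^n log z)] is also adjoint, and its radial derivative is
    [n] times itself plus [Re (z^n)].

    Three things keep this from being a direct use of the divergence theorem.

    The boundary is only a piecewise [C^1] curve and the data are known only as
    limits at its regular points.  The divergence theorem is therefore proved in
    the weak form, against test functions with support in a small box: near a
    regular point the curve is a graph, which a shear straightens
    ([graph_weak_divergence]); bumps and compactness glue the boxes
    ([weak_divergence_global], [green_identity]).  Extended by zero, the field
    is tangent to the curve from both sides, whichever of them belongs to the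
    region, and so has no jump in the normal direction.

    Nothing is known at the finitely many exceptional points.  They are removed
    by cutoffs that vary slowly in the logarithm of the distance ([cut]), for which
    [|grad|^2] and [|lap|] have integrals of order [1 / L]; away from the origin
    [Phi] is bounded, so the error tends to zero.

    At the origin [Phi] is unbounded, with an unknown singularity.  The identity
    itself bounds it: with the positive adjoint solution [Re (z^alpha)] times a
    function of [|z|] whose second logarithmic derivative is nonnegative, it
    shows that the mass of [Phi Re (z^alpha) / |z|^2] on the ring
    [e^(-4L) < |z| < e^(-L)] is at most of order [L^2] ([moment]).  All the
    functions [f] above are dominated by [|z|^kappa Re (z^alpha)] with
    [kappa > 0] ([dominated_pow], [dominated_log]), and the exponential gain
    [e^(-kappa L)] beats the power of [L]. *)

(** * Integration over rectangles *)

Section PlaneMeasure.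
Context {R : realType}.
Local Notation leb := (@lebesgue_measure R).
Local Notation mR2 := (measurableTypeR R * measurableTypeR R)%type.
Definition area : {measure set mR2 -> \bar R} := (leb \x leb)%E.

Lemma near_box (z : R * R) (P : set (R * R)) : (\forall w \near z, P w) ->
  exists2 r : R, 0 < r & forall w, `|w.1 - z.1| < r -> `|w.2 - z.2| < r -> P w.
Proof.
move=> /nbhs_ballP [r r0 h]; exists r => // w w1 w2; apply: h; split => /=;
  by rewrite /ball /= distrC.
Qed.

Lemma box_near (z : R * R) (P : set (R * R)) (r : R) : 0 < r ->
  (forall w, `|w.1 - z.1| < r -> `|w.2 - z.2| < r -> P w) -> \forall w \near z, P w.
Proof.
move=> r0 h; apply/nbhs_ballP; exists r => // w [w1 w2]; apply: h;
  by rewrite distrC.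
Qed.

Lemma continuous_pair (T : topologicalType) (f g : T -> R) (t : T) :
  {for t, continuous f} -> {for t, continuous g} ->
  {for t, continuous (fun s => (f s, g s) : R * R)}.
Proof. by move=> cf cg; exact: (cvg_pair cf cg). Qed.

(** An open set is a countable union of rational boxes, so Borel sets of the
    plane belong to the product sigma-algebra. *)
Lemma open_measurable_plane (A : set (R * R)) : open A -> measurable (A : set mR2).
Proof.
move=> oA.
pose B (q : rat * rat * rat) : set (R * R) :=
  [set x | `|x - ratr q.1.1| < ratr q.2] `*` [set y | `|y - ratr q.1.2| < ratr q.2].
have mI (x r : R) : measurable ([set y | `|y - x| < r] : set (measurableTypeR R)).
  rewrite (_ : mkset _ = `]x - r, x + r[%classic); first exact: measurable_itv.
  by apply/seteqP; split => y /=; rewrite in_itv/= ltr_distl.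
have mB q : measurable (B q : set mR2) by apply: measurableX; exact: mI.
have -> : A = \bigcup_(q in [set q | B q `<=` A]) B q.
  apply/seteqP; split; last by move=> z [q qA Bz]; exact: qA.
  move=> z Az.
  have [r r0 h] := near_box (open_nbhs_nbhs (conj oA Az)).
  have [q] := @rat_in_itvoo R 0 (r / 2) ltac:(lra); rewrite in_itv/= => /andP[q0 qr].
  have [q1] := @rat_in_itvoo R (z.1 - ratr q) (z.1 + ratr q) ltac:(lra).
  have [q2] := @rat_in_itvoo R (z.2 - ratr q) (z.2 + ratr q) ltac:(lra).
  rewrite !in_itv/= -!ltr_distl => q2z q1z.
  exists (q1, q2, q) => [w [/= w1 w2]|]; last by split; rewrite /= distrC.
  apply: h.
  - have := ler_distD (ratr q1) w.1 z.1; lra.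
  - have := ler_distD (ratr q2) w.2 z.2; lra.
rewrite bigcup_mkcond; apply: countable_bigcupT_measurable => // q; case: ifPn => // _; exact: mB.
Qed.

Lemma continuous_measurable_plane (D : set (R * R)) (f : R * R -> R) :
  open D -> (forall z, D z -> {for z, continuous f}) ->
  measurable_fun (D : set mR2) (f : mR2 -> measurableTypeR R).
Proof.
move=> oD cf; apply: (measurability _ (RGenOpens.measurableE R)).
move=> _ [_ [a [b ->] <-]]; apply: open_measurable_plane.
rewrite openE => z [Dz fz]; rewrite /interior; apply: filterI.
  exact: open_nbhs_nbhs.
apply: (cf z Dz); apply: open_nbhs_nbhs; split => //; exact: interval_open.
Qed.

Lemma integrable_rect (X Y : set R) (f : R * R -> R) (C : R) :
  measurable (X : set (measurableTypeR R)) -> measurable (Y : set (measurableTypeR R)) ->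
  (leb X < +oo)%E -> (leb Y < +oo)%E ->
  measurable_fun (X `*` Y : set mR2) (f : mR2 -> measurableTypeR R) ->
  (forall z, (X `*` Y) z -> `|f z| <= C) ->
  area.-integrable (X `*` Y : set mR2) (EFin \o f).
Proof.
move=> mX mY lX lY mf bf; apply: measurable_bounded_integrable => //.
- exact: measurableX.
- have -> : area (X `*` Y) = (leb X * leb Y)%E by exact: product_measure1E.
  by apply: lte_mul_pinfty => //; rewrite ge0_fin_numE.
- by exists C; split => [|M CM z /bf]; [rewrite num_real|move/le_trans; apply; exact: ltW].
Qed.

Lemma fubini_rect (X Y : set R) (f : R * R -> R) :
  measurable (X : set (measurableTypeR R)) -> measurable (Y : set (measurableTypeR R)) ->
  area.-integrable (X `*` Y : set mR2) (EFin \o f) ->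
  (\int[area]_(z in X `*` Y) (f z)%:E = \int[leb]_(x in X) \int[leb]_(y in Y) (f (x, y))%:E)%E /\
  (\int[area]_(z in X `*` Y) (f z)%:E = \int[leb]_(y in Y) \int[leb]_(x in X) (f (x, y))%:E)%E.
Proof.
move=> mX mY intf.
have mXY : measurable (X `*` Y : set mR2) by exact: measurableX.
have i0 : area.-integrable setT (((EFin \o f) \_ (X `*` Y)) : mR2 -> \bar R).
  by apply/(integrable_mkcond _ mXY).
split.
- rewrite integral_mkcond -(integral12_prod_meas1 i0) [RHS]integral_mkcond.
  apply: eq_integral => x _; rewrite [in RHS]patchE; case: ifPn => xX.
    rewrite [RHS]integral_mkcond; apply: eq_integral => y _; rewrite !patchE.
    by rewrite in_setX xX.
  by apply: integral0_eq => y _; rewrite patchE in_setX (negbTE xX).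
- rewrite integral_mkcond -(integral21_prod_meas1 i0) [RHS]integral_mkcond.
  apply: eq_integral => y _; rewrite [in RHS]patchE; case: ifPn => yY.
    rewrite [RHS]integral_mkcond; apply: eq_integral => x _; rewrite !patchE.
    by rewrite in_setX yY andbT.
  by apply: integral0_eq => x _; rewrite patchE in_setX (negbTE yY) andbF.
Qed.

Lemma leb_itv_lty (a b : R) : (leb `[a, b]%classic < +oo)%E.
Proof.
by rewrite lebesgue_measure_itv/=; case: ifP => _; rewrite ?ltry// -EFinD ltry.
Qed.

Lemma FTC_is_derive (F f : R -> R) (a b : R) : a < b ->
  (forall x, a <= x <= b -> is_derive x 1 F (f x)) ->
  (forall x, a <= x <= b -> {for x, continuous f}) ->
  (\int[leb]_(x in `[a, b]) (f x)%:E = (F b - F a)%:E)%E.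
Proof.
move=> ab dF cf; rewrite EFinB; apply: continuous_FTC2 => //.
- by apply: continuous_in_subspaceT => x /set_mem; rewrite /= in_itv/=; exact: cf.
- have cF x : a <= x <= b -> {for x, continuous F}.
    by move=> /dF h; apply: differentiable_continuous; apply/derivable1_diffP.
  split.
  + by move=> x; rewrite in_itv/= => /andP[/ltW ax /ltW xb]; have := dF x; rewrite ax xb => /(_ isT).
  + by apply: cvg_at_right_filter; apply: cF; rewrite lexx ltW.
  + by apply: cvg_at_left_filter; apply: cF; rewrite lexx ltW.
- move=> x; rewrite in_itv/= => /andP[/ltW ax /ltW xb].
  by have := dF x; rewrite ax xb => /(_ isT) h; rewrite derive1E derive_val.
Qed.

Lemma continuous_rect_bounded (x1 x2 u1 u2 : R) (f : R * R -> R) :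
  (forall x u, x1 <= x <= x2 -> u1 <= u <= u2 -> {for (x, u), continuous f}) ->
  exists C, forall z, (`[x1, x2]%classic `*` `[u1, u2]%classic) z -> `|f z| <= C.
Proof.
move=> cf.
have cQ : compact (`[x1, x2]%classic `*` `[u1, u2]%classic).
  by apply: compact_setX; exact: segment_compact.
have : compact (f @` (`[x1, x2]%classic `*` `[u1, u2]%classic)).
  apply: continuous_compact => //; apply: continuous_in_subspaceT => -[x u].
  by rewrite inE => -[/= ]; rewrite !in_itv/=; exact: cf.
move=> /compact_bounded [M [_ h]]; exists (`|M| + 1) => z Qz.
by apply: (h (`|M| + 1)); [rewrite ltr_pwDr// ler_norm|exists z].
Qed.

Lemma continuous_rect_integrable (x1 x2 u1 u2 : R) (O : set (R * R)) (f : R * R -> R) :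
  open O -> (forall z, O z -> {for z, continuous f}) ->
  (forall x u, x1 <= x <= x2 -> u1 <= u <= u2 -> O (x, u)) ->
  area.-integrable (`[x1, x2]%classic `*` `[u1, u2]%classic : set mR2) (EFin \o f).
Proof.
move=> oO cf QO.
have [C fC] : exists C, forall z, (`[x1, x2]%classic `*` `[u1, u2]%classic) z -> `|f z| <= C.
  by apply: continuous_rect_bounded => x u hx hu; apply: cf; exact: QO.
apply: (@integrable_rect _ _ f C) => //; try exact: leb_itv_lty.
apply: (@measurable_funS _ _ _ _ (O : set mR2)).
- exact: open_measurable_plane.
- by move=> [x u] [/=]; rewrite !in_itv/=; exact: QO.
- exact: continuous_measurable_plane.
Qed.

(** Fubini and the fundamental theorem of calculus; only two opposite sides
    contribute, since the first component takes equal values on the others. *)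
Lemma divergence_rect (x1 x2 u1 u2 : R) (O : set (R * R)) (A B Ax Bu : R -> R -> R) :
  x1 < x2 -> u1 < u2 -> open O ->
  (forall x u, x1 <= x <= x2 -> u1 <= u <= u2 -> O (x, u)) ->
  (forall x u, O (x, u) -> is_derive x 1 (A ^~ u) (Ax x u)) ->
  (forall x u, O (x, u) -> is_derive u 1 (B x) (Bu x u)) ->
  (forall z, O z -> {for z, continuous (fun z => Ax z.1 z.2)}) ->
  (forall z, O z -> {for z, continuous (fun z => Bu z.1 z.2)}) ->
  (forall u, u1 <= u <= u2 -> A x1 u = A x2 u) ->
  (\int[area]_(z in `[x1, x2] `*` `[u1, u2]) (Ax z.1 z.2 + Bu z.1 z.2)%:E =
   \int[leb]_(x in `[x1, x2]) (B x u2 - B x u1)%:E)%E.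
Proof.
move=> x12 u12 oO QO dA dB cA cB A12.
have iA := continuous_rect_integrable oO cA QO.
have iB := continuous_rect_integrable oO cB QO.
have mQ : measurable (`[x1, x2]%classic `*` `[u1, u2]%classic : set mR2).
  by apply: measurableX; exact: measurable_itv.
under eq_integral do rewrite EFinD.
rewrite integralD//=.
rewrite (fubini_rect _ _ iA).2//= (fubini_rect _ _ iB).1//=.
rewrite integral0_eq ?add0e.
  apply: eq_integral => x; rewrite inE/= in_itv/= => hx.
  apply: FTC_is_derive => // u hu; first by apply: dB; exact: QO.
  apply: (@continuous_comp _ _ _ (fun u => (x, u)) (fun z => Bu z.1 z.2)).
    by apply: continuous_pair; [exact: cvg_cst|exact: cvg_id].
  by apply: cB; exact: QO.
move=> u; rewrite /= in_itv/= => hu.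
transitivity (A x2 u - A x1 u)%:E; last by rewrite A12 ?subrr.
apply: (@FTC_is_derive (A ^~ u) (Ax ^~ u)) => //.
- by move=> x hx; apply: dA; exact: QO.
- move=> x hx.
  apply: (@continuous_comp _ _ _ (fun x => (x, u)) (fun z => Ax z.1 z.2)).
    by apply: continuous_pair; [exact: cvg_id|exact: cvg_cst].
  by apply: cA; exact: QO.
Qed.

End PlaneMeasure.

(** * Gradients *)

(* In a large context linear arithmetic is slow unless the hypotheses that are
   not (in)equalities are dropped. *)
Ltac slra :=
  repeat match goal with
  | H : ?P |- _ => lazymatch P with
    | is_true _ => fail | @eq _ _ _ => fail | _ => clear H end
  end; lra.

Section PlaneCalculus.
Context {R : realType}.
Implicit Types (f g : R * R -> R) (z v w : R * R) (h : R -> R).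

(** A gradient is recorded as a differential, so that one chain rule serves
    both functions of a function and functions along a curve. *)
Definition is_grad f z v : Prop := is_diff z f (fun w => w.1 * v.1 + w.2 * v.2).

Lemma is_grad_eq f z v w : is_grad f z v -> v = w -> is_grad f z w.
Proof. by move=> ? <-. Qed.

Lemma is_grad_cst a z : is_grad (fun=> a) z (0, 0).
Proof.
rewrite /is_grad; apply: (is_diff_eq (is_diff_cst a z)).
by apply/funext => w /=; rewrite !mulr0 addr0.
Qed.

Lemma is_grad_fst z : is_grad fst z (1, 0).
Proof.
have d1 : differentiable (fst : R * R -> R) z.
  by apply: linear_differentiable => w; exact: cvg_fst.
rewrite /is_grad; apply: (is_diff_eq (differentiableP d1)).
rewrite (diff_lin _ _) /=; last by move=> w; exact: cvg_fst.
by apply/funext => w /=; rewrite mulr1 mulr0 addr0.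
Qed.

Lemma is_grad_snd z : is_grad snd z (0, 1).
Proof.
have d1 : differentiable (snd : R * R -> R) z.
  by apply: linear_differentiable => w; exact: cvg_snd.
rewrite /is_grad; apply: (is_diff_eq (differentiableP d1)).
rewrite (diff_lin _ _) /=; last by move=> w; exact: cvg_snd.
by apply/funext => w /=; rewrite mulr1 mulr0 add0r.
Qed.

Lemma is_gradD f g z v w : is_grad f z v -> is_grad g z w ->
  is_grad (fun z => f z + g z) z (v.1 + w.1, v.2 + w.2).
Proof.
move=> df dg; rewrite /is_grad; apply: (is_diff_eq (is_diffD df dg)).
by apply/funext => u /=; rewrite !fctE/=; ring.
Qed.

Lemma is_gradN f z v : is_grad f z v -> is_grad (fun z => - f z) z (- v.1, - v.2).
Proof.
move=> df; rewrite /is_grad; apply: (is_diff_eq (is_diffN df)).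
by apply/funext => u /=; rewrite !fctE/=; ring.
Qed.

Lemma is_gradM f g z v w : is_grad f z v -> is_grad g z w ->
  is_grad (fun z => f z * g z) z (f z * w.1 + g z * v.1, f z * w.2 + g z * v.2).
Proof.
move=> df dg; rewrite /is_grad; apply: (is_diff_eq (is_diffM df dg)).
by apply/funext => u; rewrite !fctE /= /GRing.scale/=; ring.
Qed.

Lemma is_derive_to h (t d d' : R) : is_derive t 1 h d -> d = d' -> is_derive t 1 h d'.
Proof. by move=> ? <-. Qed.

Lemma is_derive_diff h (t d : R) : is_derive t 1 h d -> is_diff t h (fun k => k * d).
Proof.
move=> hd.
have dh : differentiable h t by apply/derivable1_diffP.
apply: (is_diff_eq (differentiableP dh)).
by rewrite diff1E//; apply/funext => k; rewrite derive1E derive_val.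
Qed.

Lemma diff_is_derive h (t d : R) : is_diff t h (fun k => k * d) -> is_derive t 1 h d.
Proof.
move=> hd; have dh : differentiable h t by [].
apply: DeriveDef; first exact/derivable1_diffP.
by rewrite deriveE// diff_val mul1r.
Qed.

Lemma is_grad_comp f h z v d : is_grad f z v -> is_derive (f z) 1 h d ->
  is_grad (fun z => h (f z)) z (v.1 * d, v.2 * d).
Proof.
move=> df /is_derive_diff dh; rewrite /is_grad.
apply: (is_diff_eq (is_diff_comp df dh)).
by apply/funext => u /=; ring.
Qed.

Lemma is_grad_pair f a b z v va vb : is_grad a z va -> is_grad b z vb ->
  is_grad f (a z, b z) v ->
  is_grad (fun z => f (a z, b z)) z
    (va.1 * v.1 + vb.1 * v.2, va.2 * v.1 + vb.2 * v.2).
Proof.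
move=> da db df; rewrite /is_grad.
apply: (is_diff_eq (is_diff_comp (is_diff_pair da db) df)).
by apply/funext => u /=; ring.
Qed.

Lemma is_grad_curve f (a b : R -> R) (t : R) v a' b' :
  is_derive t 1 a a' -> is_derive t 1 b b' -> is_grad f (a t, b t) v ->
  is_derive t 1 (fun t => f (a t, b t)) (a' * v.1 + b' * v.2).
Proof.
move=> /is_derive_diff da /is_derive_diff db df; apply: diff_is_derive.
apply: (is_diff_eq (is_diff_comp (is_diff_pair da db) df)).
by apply/funext => u /=; ring.
Qed.

Lemma is_grad_continuous f z v : is_grad f z v -> {for z, continuous f}.
Proof. by move=> [df _]; exact: differentiable_continuous. Qed.

Lemma differentiable_is_grad f z : differentiable f z -> is_grad f z (grad f z).
Proof.
move=> df; rewrite /is_grad; apply: (is_diff_eq (differentiableP df)).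
apply/funext => w; rewrite /grad /dx /dy/= !deriveE//.
rewrite {1}(_ : w = w.1 *: (1, 0) + w.2 *: (0, 1)); first by rewrite linearD !linearZ.
by case: w => a b; congr pair; rewrite /= /GRing.scale/= ?mulr1 ?mulr0 ?addr0 ?add0r.
Qed.

Lemma is_diff_near (V W : normedModType R) (f g df : V -> W) (z : V) :
  (\forall w \near z, f w = g w) -> is_diff z f df -> is_diff z g df.
Proof.
move=> fg dff.
have fgz : f z = g z by exact: nbhs_singleton fg.
have [dif dfE] := dff.
have /diff_locallyP [cd e] := dif.
have e' : g \o shift z = cst (g z) + 'd f z +o_ 0 id.
  apply/eqaddoP => eps eps0.
  move/eqaddoP : e => /(_ eps eps0) h.
  move: fg; rewrite (near_shift 0) subr0 => fg.
  apply: filterS2 h fg => u /=.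
  by rewrite !fctE/= fgz => h <-.
have E : 'd g z = 'd f z :> (_ -> _) by exact: diff_unique.
split; first by apply/diff_locallyP; split; rewrite E.
by rewrite E dfE.
Qed.

Lemma is_grad_near f g z v : (\forall w \near z, f w = g w) -> is_grad f z v -> is_grad g z v.
Proof. exact: is_diff_near. Qed.

End PlaneCalculus.

(** * Shears *)

Section Shear.
Context {R : realType}.
Local Notation leb := (@lebesgue_measure R).
Local Notation mR := (measurableTypeR R).
Local Notation mR2 := (measurableTypeR R * measurableTypeR R)%type.
Implicit Types (F : R * R -> R) (g : R -> R).

Lemma integrable_bounded_support F (C M : R) :
  measurable_fun setT (F : mR2 -> mR) -> (forall z, `|F z| <= C) ->
  (forall z, F z != 0 -> `|z.1| <= M /\ `|z.2| <= M) ->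
  area.-integrable (setT : set mR2) (EFin \o F).
Proof.
move=> mF bF sF.
have mI : measurable (`[- M, M]%classic : set mR) by exact: measurable_itv.
rewrite (_ : EFin \o F = (EFin \o F) \_ (`[- M, M] `*` `[- M, M])); last first.
  apply/funext => z; rewrite patchE; case: ifPn => //.
  apply: contraNeq => Fz; rewrite inE/= !in_itv/= -!ler_norml.
  by apply: sF; apply/eqP => F0; move/eqP: Fz; apply; rewrite /= F0.
have mQ : measurable (`[- M, M]%classic `*` `[- M, M]%classic : set mR2) by exact: measurableX.
apply/(integrable_mkcond _ mQ).
apply: (@integrable_rect _ _ _ F C) => //; try exact: leb_itv_lty.
exact: measurable_funTS.
Qed.

Lemma leb_translate (c : R) (A : set mR) : measurable A ->
  pushforward leb (fun u : mR => (c + u : mR)) A = leb A.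
Proof.
move=> mA; apply/esym/lebesgue_measure_unique => //=.
- by apply: continuous_measurable_fun => u; apply: cvgD; [exact: cvg_cst|exact: cvg_id].
- move=> mc _ [[a b]] _ <-.
  have -> : pushforward leb (fun u : mR => (c + u : mR)) `]a, b] = leb `]a - c, b - c]%classic.
    congr (leb _); apply/seteqP; split => u /=; rewrite !in_itv/=; lra.
  rewrite !lebesgue_measure_itv/= !lte_fin ltrD2r.
  by case: ifP => // _; rewrite -!EFinB; congr (_%:E); ring.
Qed.

Lemma integrable_translate (c : R) g : leb.-integrable setT (EFin \o g) ->
  leb.-integrable setT (EFin \o (fun u => g (c + u))) /\
  (\int[leb]_u (g (c + u))%:E = \int[leb]_y (g y)%:E)%E.
Proof.
move=> ig.
have mg : measurable_fun setT (EFin \o g) by case/integrableP : ig.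
have mc : measurable_fun setT (fun u : mR => (c + u : mR)).
  by apply: continuous_measurable_fun => u; apply: cvgD; [exact: cvg_cst|exact: cvg_id].
have i' : leb.-integrable setT (EFin \o (fun u => g (c + u))).
  apply/integrableP; split; first exact: (measurableT_comp mg mc).
  have := @ge0_integral_pushforward _ _ mR mR R _ mc leb setT (fun y => `|(g y)%:E|)%E measurableT.
  rewrite preimage_setT => <-//.
  + case/integrableP : ig => _; apply: le_lt_trans; rewrite le_eqVlt; apply/orP; left; apply/eqP.
    by apply: eq_measure_integral => A mA _; exact: leb_translate.
  + by apply: measurableT_comp => //; exact: mg.
split => //.
have := @integral_pushforward _ _ mR mR R _ mc leb setT (EFin \o g) mg.
rewrite preimage_setT => /(_ i' measurableT) <-.
by apply: eq_measure_integral => A mA _; exact: leb_translate.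
Qed.

Lemma measurable_slice F (x : R) :
  measurable_fun setT (F : mR2 -> mR) -> measurable_fun setT (fun y : mR => (F (x, y) : mR)).
Proof. by move=> mF; exact: measurable_fun_pair2. Qed.

Lemma measurable_shear F g :
  measurable_fun setT (F : mR2 -> mR) -> measurable_fun setT (g : mR -> mR) ->
  measurable_fun setT (fun z : mR2 => F (z.1, g z.1 + z.2) : mR).
Proof.
move=> mF mg; apply: (measurableT_comp mF).
apply: measurable_fun_pair; first exact: measurable_fst.
by apply: measurable_funD; [exact: (measurableT_comp mg measurable_fst)|exact: measurable_snd].
Qed.

(** Subtracting a function of the abscissa from the ordinate preserves areas;
    this straightens a boundary arc that is a graph. *)
Lemma shear_integral F g (C M x1 x2 H : R) :
  measurable_fun setT (F : mR2 -> mR) -> measurable_fun setT (g : mR -> mR) ->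
  (forall z, `|F z| <= C) ->
  (forall z, F z != 0 -> `|z.1| <= M /\ `|z.2| <= M) ->
  (forall x u, F (x, g x + u) != 0 -> x1 <= x <= x2 /\ - H <= u <= H) ->
  [/\ area.-integrable (setT : set mR2) (EFin \o F),
   area.-integrable (`[x1, x2]%classic `*` `[- H, H]%classic : set mR2)
     (EFin \o (fun z => F (z.1, g z.1 + z.2))) &
   (\int[area]_z (F z)%:E =
   \int[area]_(z in `[x1, x2] `*` `[(- H)%R, H]) (F (z.1, g z.1 + z.2)%R)%:E)%E].
Proof.
move=> mF mg bF sF sG.
have iF := integrable_bounded_support mF bF sF.
have iG : area.-integrable (`[x1, x2]%classic `*` `[- H, H]%classic : set mR2)
    (EFin \o (fun z => F (z.1, g z.1 + z.2))).
  apply: (@integrable_rect _ _ _ _ C) => //; try exact: leb_itv_lty.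
  exact: (measurable_funTS (measurable_shear mF mg)).
split => //.
have mX : measurable (`[x1, x2]%classic : set mR) by exact: measurable_itv.
have mU : measurable (`[- H, H]%classic : set mR) by exact: measurable_itv.
rewrite (fubini_rect mX mU iG).1 -(integral12_prod_meas1 iF) [RHS]integral_mkcond.
apply: eq_integral => x _ /=.
have isl : leb.-integrable setT (EFin \o (fun y => F (x, y))).
  rewrite (_ : EFin \o _ = (EFin \o (fun y => F (x, y))) \_ `[- M, M]); last first.
    apply/funext => y; rewrite patchE; case: ifPn => //.
    apply: contraNeq => Fz; rewrite inE/= in_itv/= -ler_norml.
    by apply: (sF (x, y) _).2; apply/eqP => F0; move/eqP: Fz; apply; rewrite /= F0.
  have mY : measurable (`[- M, M]%classic : set mR) by exact: measurable_itv.
  apply/(integrable_mkcond _ mY).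
  apply: measurable_bounded_integrable => //.
  - exact: leb_itv_lty.
  - exact: (measurable_funTS (measurable_slice _ mF)).
  - by exists C; split => [|K CK z _]; [rewrite num_real|apply: le_trans (bF _) _; exact: ltW].
transitivity (\int[leb]_u (F (x, g x + u))%:E)%E; first by have [_ ->] := integrable_translate (g x) isl.
rewrite patchE; case: ifPn => xX.
  rewrite [RHS]integral_mkcond; apply: eq_integral => u _; rewrite patchE.
  case: ifPn => // uH; congr (_%:E).
  apply: contraNeq uH => /sG[_]; by rewrite inE/= in_itv.
apply: integral0_eq => u _; congr (_%:E); apply: contraNeq xX => /sG[].
by rewrite inE/= in_itv.
Qed.

End Shear.

(** * Weak divergence *)

Section WeakDivergence.
Context {R : realType}.
Local Notation leb := (@lebesgue_measure R).
Local Notation mR := (measurableTypeR R).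
Local Notation mR2 := (measurableTypeR R * measurableTypeR R)%type.
Implicit Types (F : R * R -> R) (g : R -> R).

(** Partial derivatives are carried as data, which makes products and
    complements of test functions computable. *)
Record test := Test {
  tf : R * R -> R; tf1 : R * R -> R; tf2 : R * R -> R;
  tfP : forall z, [/\ is_grad tf z (tf1 z, tf2 z), {for z, continuous tf1}
                    & {for z, continuous tf2}] }.

Definition in_box (P : R * R) (r : R) (z : R * R) : Prop :=
  `|z.1 - P.1| < r /\ `|z.2 - P.2| < r.

Definition supported (phi : test) (P : R * R) (r : R) : Prop :=
  forall z, ~ in_box P r z -> [/\ tf phi z = 0, tf1 phi z = 0 & tf2 phi z = 0].

Definition weak_form (F1 F2 d : R * R -> R) (phi : test) (z : R * R) : R :=
  tf phi z * d z + (tf1 phi z * F1 z + tf2 phi z * F2 z).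

Definition null_against (F1 F2 d : R * R -> R) (phi : test) : Prop :=
  area.-integrable (setT : set mR2) (EFin \o weak_form F1 F2 d phi) /\
  (\int[area]_z (weak_form F1 F2 d phi z)%:E = 0)%E.

(** [d] is the divergence of [(F1, F2)] near [P] in the sense of distributions. *)
Definition weak_divergence (F1 F2 d : R * R -> R) (P : R * R) : Prop :=
  exists2 r, 0 < r & forall phi, supported phi P r -> null_against F1 F2 d phi.

Lemma continuous_comp2 (T : topologicalType) F (a b : T -> R) (t : T) :
  {for t, continuous a} -> {for t, continuous b} -> {for (a t, b t), continuous F} ->
  {for t, continuous (fun s => F (a s, b s))}.
Proof.
move=> ca cb cF.
exact: (@continuous_comp _ _ _ (fun s => (a s, b s)) F t (continuous_pair ca cb) cF).
Qed.

Lemma test_continuous phi z : {for z, continuous (tf phi)}.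
Proof. by have [/is_grad_continuous] := tfP phi z. Qed.

Lemma test_measurable phi : [/\ measurable_fun setT (tf phi : mR2 -> mR),
  measurable_fun setT (tf1 phi : mR2 -> mR) & measurable_fun setT (tf2 phi : mR2 -> mR)].
Proof.
split; apply: continuous_measurable_plane => [|z _]; try exact: openT.
- exact: test_continuous.
- by have [] := tfP phi z.
- by have [] := tfP phi z.
Qed.

Lemma test_bounded phi P (r : R) : 0 < r -> supported phi P r ->
  exists2 K : R, 0 <= K & forall z, [/\ `|tf phi z| <= K, `|tf1 phi z| <= K & `|tf2 phi z| <= K].
Proof.
move=> r0 sphi.
have H F : (forall z, {for z, continuous F}) -> (forall z, ~ in_box P r z -> F z = 0) ->
    exists2 K : R, 0 <= K & forall z, `|F z| <= K.
  move=> cF sF.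
  have [K hK] := @continuous_rect_bounded R (P.1 - r) (P.1 + r) (P.2 - r) (P.2 + r) F
    (fun x u _ _ => cF (x, u)).
  exists `|K| => // z; have [[z1 z2]|/sF ->] := EM (in_box P r z); last by rewrite normr0.
  apply: le_trans (ler_norm K); apply: hK; split => /=; rewrite in_itv/= -ler_distl; exact: ltW.
have [K0 K00 h0] : exists2 K : R, 0 <= K & forall z, `|tf phi z| <= K.
  by apply: H => z; [exact: test_continuous|move=> /sphi[]].
have [K1 K10 h1] : exists2 K : R, 0 <= K & forall z, `|tf1 phi z| <= K.
  by apply: H => z; [have [] := tfP phi z|move=> /sphi[]].
have [K2 K20 h2] : exists2 K : R, 0 <= K & forall z, `|tf2 phi z| <= K.
  by apply: H => z; [have [] := tfP phi z|move=> /sphi[]].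
exists (K0 + K1 + K2); first by rewrite !addr_ge0.
by move=> z; split; [have := h0 z|have := h1 z|have := h2 z]; lra.
Qed.

Lemma weak_form_measurable F1 F2 d phi :
  measurable_fun setT (F1 : mR2 -> mR) -> measurable_fun setT (F2 : mR2 -> mR) ->
  measurable_fun setT (d : mR2 -> mR) ->
  measurable_fun setT (weak_form F1 F2 d phi : mR2 -> mR).
Proof.
move=> m1 m2 md; have [p0 p1 p2] := test_measurable phi.
by apply: measurable_funD; [|apply: measurable_funD]; apply: measurable_funM.
Qed.

Lemma weak_form_bounded F1 F2 d phi P (r C : R) : 0 < r -> supported phi P r ->
  (forall z, in_box P r z -> [/\ `|F1 z| <= C, `|F2 z| <= C & `|d z| <= C]) ->
  exists K, forall z, `|weak_form F1 F2 d phi z| <= K.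
Proof.
move=> r0 sphi bF; have [K K0 hK] := test_bounded r0 sphi.
exists (3 * (K * `|C|)) => z; rewrite /weak_form.
have [/bF[b1 b2 bd]|/sphi[-> -> ->]] := EM (in_box P r z); last first.
  by rewrite !mul0r !addr0 normr0 !mulr_ge0.
have [k0 k1 k2] := hK z.
have M a b : `|a| <= K -> `|b| <= C -> `|a * b| <= K * `|C|.
  by move=> ha hb; rewrite normrM ler_pM// (le_trans hb)// ler_norm.
have := M _ _ k0 bd; have := M _ _ k1 b1; have := M _ _ k2 b2.
have := ler_normD (tf phi z * d z) (tf1 phi z * F1 z + tf2 phi z * F2 z).
have := ler_normD (tf1 phi z * F1 z) (tf2 phi z * F2 z).
lra.
Qed.

Lemma weak_form_support F1 F2 d phi P r : supported phi P r ->
  forall z, weak_form F1 F2 d phi z != 0 -> in_box P r z.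
Proof.
move=> sphi z; apply: contra_neqP => /sphi[p0 p1 p2].
by rewrite /weak_form p0 p1 p2 !mul0r !addr0.
Qed.

End WeakDivergence.

(** * Fields that jump across a graph *)

Section GraphBoundary.
Context {R : realType}.
Local Notation leb := (@lebesgue_measure R).
Local Notation mR := (measurableTypeR R).
Local Notation mR2 := (measurableTypeR R * measurableTypeR R)%type.

(** In the coordinates [(x, y - g x)] the graph becomes horizontal.  The strip
    [|y - g x| < eps n] is removed; on the two remaining rectangles the divergence
    theorem leaves the integral over the graph of the jump of
    [phi (F2 - g' F1)], which tends to zero by dominated convergence, and the
    strip itself contributes nothing in the limit. *)
Lemma graph_weak_divergence (x0 y0 r C : R) (g g' : R -> R)
    (F1 F2 F11 F12 F21 F22 d : R * R -> R) :
  let J e x := F2 (x, g x + e) - g' x * F1 (x, g x + e) in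
  0 < r -> g x0 = y0 ->
  (forall x, `|x - x0| < r -> is_derive x 1 g (g' x)) ->
  (forall x, `|x - x0| < r -> {for x, continuous g'}) ->
  measurable_fun setT (F1 : mR2 -> mR) -> measurable_fun setT (F2 : mR2 -> mR) ->
  measurable_fun setT (d : mR2 -> mR) ->
  (forall z, in_box (x0, y0) r z -> [/\ `|F1 z| <= C, `|F2 z| <= C & `|d z| <= C]) ->
  (forall z, in_box (x0, y0) r z -> z.2 != g z.1 ->
    [/\ is_grad F1 z (F11 z, F12 z), is_grad F2 z (F21 z, F22 z) & d z = F11 z + F22 z]) ->
  (forall z, in_box (x0, y0) r z -> z.2 != g z.1 ->
    [/\ {for z, continuous F11}, {for z, continuous F12} & {for z, continuous F22}]) ->
  (forall x, `|x - x0| < r -> forall eta : R, 0 < eta ->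
    exists2 delta : R, 0 < delta & forall e, 0 < e < delta -> `|J e x - J (- e) x| < eta) ->
  weak_divergence F1 F2 d (x0, y0).
Proof.
move=> J r0 gx0 dg cg' mF1 mF2 md bF dF cF jump.
have rr : 0 < r := r0.
have cg x : `|x - x0| < r -> {for x, continuous g}.
  by move=> /dg h; apply: differentiable_continuous; apply/derivable1_diffP.
have [rho2 rho20 [rho2r grho2]] : exists2 rho2 : R, 0 < rho2 & rho2 <= r /\
    forall x, `|x - x0| < rho2 -> `|g x - y0| < r / 4.
  have : \forall x \near x0, `|g x - y0| < r / 4.
    have /cvgr_dist_lt := cg x0 ltac:(by rewrite subrr normr0).
    move=> /(_ (r / 4) ltac:(slra)); rewrite gx0.
    by apply: filterS => x; rewrite distrC.
  move=> /nbhs_ballP[e /= e0 he]; exists (Num.min e r); first by rewrite lt_min e0.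
  split; first by rewrite ge_min lexx orbT.
  by move=> x; rewrite lt_min => /andP[xe _]; apply: he; rewrite /ball/= distrC.
pose rho := Num.min (rho2 / 2) (r / 4).
have rho0 : 0 < rho by rewrite lt_min; apply/andP; split; slra.
have rhoA : rho <= rho2 / 2 by rewrite ge_min lexx.
have rhoB : rho <= r / 4 by rewrite ge_min lexx orbT.
exists rho => // phi sphi.
pose x1 := x0 - rho; pose x2 := x0 + rho; pose H := r / 2.
have Xx x : x1 <= x <= x2 -> `|x - x0| < rho2.
  by rewrite -ler_distl => h; apply: le_lt_trans h _; slra.
have x12 : x1 < x2 by rewrite /x1 /x2; slra.
(* [g] is known to be continuous only near [x0]; its extension by zero is
   measurable on the whole line. *)
pose g0 := g \_ `[x1, x2]%classic.
have g0E x : x1 <= x <= x2 -> g0 x = g x.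
  by move=> hx; rewrite /g0 patchE mem_set// /= in_itv.
have mX : measurable (`[x1, x2]%classic : set mR) by exact: measurable_itv.
have cgX : {within `[x1, x2], continuous g}.
  apply: continuous_in_subspaceT => x /set_mem; rewrite /= in_itv/= => /Xx hx.
  by apply: cg; apply: lt_le_trans hx _.
have mg0 : measurable_fun setT (g0 : mR -> mR).
  by apply/(measurable_restrictT _ mX); exact: subspace_continuous_measurable_fun.
pose Psi := weak_form F1 F2 d phi.
have mPsi : measurable_fun setT (Psi : mR2 -> mR) by exact: weak_form_measurable.
have sub z : in_box (x0, y0) rho z -> in_box (x0, y0) r z.
  by move=> [a b]; split; [apply: lt_le_trans a _|apply: lt_le_trans b _]; slra.
have [K K0 hK] := test_bounded rho0 sphi.
have [C2 hC2] : exists C2, forall z, `|Psi z| <= C2.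
  by apply: (weak_form_bounded rho0 sphi) => z /sub; exact: bF.
have sPsi := weak_form_support sphi : forall z, Psi z != 0 -> _.
have [iPsi iT EPsi] : [/\ area.-integrable (setT : set mR2) (EFin \o Psi),
   area.-integrable (`[x1, x2]%classic `*` `[- H, H]%classic : set mR2)
     (EFin \o (fun z => Psi (z.1, g0 z.1 + z.2))) &
   (\int[area]_z (Psi z)%:E =
   \int[area]_(z in `[x1, x2] `*` `[(- H)%R, H]) (Psi (z.1, g0 z.1 + z.2)%R)%:E)%E].
  apply: (@shear_integral R Psi g0 C2 (`|x0| + `|y0| + rho)) => //.
  - move=> z /sPsi[/= h1 h2].
    have := ler_distD x0 z.1 0; have := ler_distD y0 z.2 0; rewrite !subr0.
    have := normr_ge0 x0; have := normr_ge0 y0; slra.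
  - move=> x u /sPsi[/= h1 h2].
    have hx : x1 <= x <= x2 by rewrite -ler_distl ltW.
    split => //; rewrite -ler_norml.
    move: h2; rewrite g0E// => h2; have := grho2 _ (Xx _ hx).
    have -> : u = (g x + u - y0) - (g x - y0) by ring.
    have := ler_normB (g x + u - y0) (g x - y0); rewrite /H; slra.
rewrite /null_against; split => //.
pose T z := Psi (z.1, g z.1 + z.2).
have ET : (\int[area]_z (Psi z)%:E =
   \int[area]_(z in `[x1, x2] `*` `[(- H)%R, H]) (T z)%:E)%E.
  rewrite EPsi; apply: eq_integral => -[x u]; rewrite in_setX/= => /andP[xX _].
  by rewrite /T/= g0E//; move: xX; rewrite inE/= in_itv.
have iT' : area.-integrable (`[x1, x2]%classic `*` `[- H, H]%classic : set mR2) (EFin \o T).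
  apply: eq_integrable iT.
    by apply: measurableX; exact: measurable_itv.
  move=> -[x u]; rewrite in_setX/= => /andP[xX _].
  by rewrite /T/= g0E//; move: xX; rewrite inE/= in_itv.
pose O : set (R * R) := [set z | `|z.1 - x0| < rho2 /\
  ((0 < z.2 /\ z.2 < 3 * r / 4) \/ (- (3 * r / 4) < z.2 /\ z.2 < 0))].
have oO : open O.
  rewrite openE => z [z1 z2]; rewrite /interior; apply: filterI.
    have : {for z, continuous (fun z : R * R => `|z.1 - x0|)}.
      by apply: cvg_norm; apply: cvgB; [exact: cvg_fst|exact: cvg_cst].
    by move=> /cvgr_lt; exact.
  have c2 : {for z, continuous (snd : R * R -> R)} by exact: cvg_snd.
  case: z2 => -[a b]; move/cvgr_gt: (c2) => /(_ _ a) ha; move/cvgr_lt: (c2) => /(_ _ b) hb;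
    apply: filterS2 ha hb => w wa wb; by [left|right].
pose p (z : R * R) := (z.1, g z.1 + z.2).
have pO z : O z -> in_box (x0, y0) r (p z) /\ (p z).2 != g (p z).1.
  move=> [z1 z2]; split; first split => /=.
  - exact: lt_le_trans z1 _.
  - have := grho2 _ z1; rewrite !ltr_norml => /andP[? ?]; apply/andP.
    by case: z2 => -[? ?]; split; slra.
  - by rewrite /= addrC -subr_eq0 addrK; case: z2 => -[? ?]; apply/eqP; slra.
have cp z (F : R * R -> R) : O z -> {for p z, continuous F} -> {for z, continuous (fun z => F (p z))}.
  move=> Oz cF'.
  have cgz : {for z, continuous (fun z : R * R => g z.1)}.
    apply: (@continuous_comp _ _ _ fst g); first exact: cvg_fst.
    by apply: cg; case: Oz => z1 _; exact: lt_le_trans z1 _.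
  have c2 : {for z, continuous (fun z : R * R => g z.1 + z.2)}.
    by apply: cvgD; [exact: cgz|exact: cvg_snd].
  exact: (@continuous_comp2 R _ F fst (fun z => g z.1 + z.2) z (@cvg_fst _ _ _ _ _) c2 cF').
have cg'O z : O z -> {for z, continuous (fun z => g' z.1)}.
  move=> [z1 _]; apply: (@continuous_comp _ _ _ fst g'); first exact: cvg_fst.
  by apply: cg'; exact: lt_le_trans z1 _.
(* [(A, B)] is the field [phi F] in the sheared coordinates. *)
pose A x u := tf phi (p (x, u)) * F1 (p (x, u)).
pose B x u := tf phi (p (x, u)) * (F2 (p (x, u)) - g' x * F1 (p (x, u))).
pose D2 (G G2 : R * R -> R) z := tf2 phi z * G z + tf phi z * G2 z.
pose Ax x u := let q := p (x, u) in
  (tf1 phi q * F1 q + tf phi q * F11 q) + g' x * D2 F1 F12 q.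
pose Bu x u := let q := p (x, u) in D2 F2 F22 q - g' x * D2 F1 F12 q.
have dA x u : O (x, u) -> is_derive x 1 (A ^~ u) (Ax x u).
  move=> Oxu; have [pb pg] := pO _ Oxu; have [d1 _ _] := dF _ pb pg.
  have [dphi _ _] := tfP phi (p (x, u)).
  have dx : is_derive x 1 (fun x : R => x) 1 by exact: is_derive_id.
  have dy : is_derive x 1 (fun x : R => g x + u) (g' x).
    have := dg _ (lt_le_trans Oxu.1 rho2r) => h.
    by have := is_deriveD h (is_derive_cst u x 1); rewrite addr0.
  apply: (is_derive_to (is_grad_curve dx dy (is_gradM dphi d1))).
  by rewrite /Ax /D2 /=; ring.
have dB x u : O (x, u) -> is_derive u 1 (B x) (Bu x u).
  move=> Oxu; have [pb pg] := pO _ Oxu; have [d1 d2 _] := dF _ pb pg.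
  have [dphi _ _] := tfP phi (p (x, u)).
  have dx : is_derive u 1 (fun u : R => x) 0 by exact: is_derive_cst.
  have dy : is_derive u 1 (fun u : R => g x + u) 1.
    by have := is_deriveD (is_derive_cst (g x) u 1) (is_derive_id u 1); rewrite add0r.
  have dG := is_gradM dphi (is_gradD d2 (is_gradN (is_gradM (is_grad_cst (g' x) _) d1))).
  apply: (is_derive_to (is_grad_curve dx dy dG)).
  by rewrite /Bu /D2 /=; ring.
have cA z : O z -> {for z, continuous (fun z => Ax z.1 z.2)}.
  move=> Oz; have [pb pg] := pO _ Oz; have [d1 _ _] := dF _ pb pg; have [c1 c2 _] := cF _ pb pg.
  have [_ t1 t2] := tfP phi (p z).
  have t0 := @test_continuous R phi (p z); have cF1 := is_grad_continuous d1.
  have H1 (F : R * R -> R) : {for p z, continuous F} -> {for z, continuous (fun z => F (p z))} by exact: cp.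
  rewrite /Ax /D2 /=; apply: cvgD.
    by apply: cvgD; (apply: cvgM; [exact: H1|exact: H1]).
  apply: cvgM; first exact: cg'O.
  by apply: cvgD; (apply: cvgM; [exact: H1|exact: H1]).
have cB z : O z -> {for z, continuous (fun z => Bu z.1 z.2)}.
  move=> Oz; have [pb pg] := pO _ Oz; have [d1 d2 _] := dF _ pb pg; have [c1 c2 c3] := cF _ pb pg.
  have [_ t1 t2] := tfP phi (p z).
  have t0 := @test_continuous R phi (p z); have cF1 := is_grad_continuous d1.
  have cF2 := is_grad_continuous d2.
  have H1 (F : R * R -> R) : {for p z, continuous F} -> {for z, continuous (fun z => F (p z))} by exact: cp.
  rewrite /Bu /D2 /=; apply: cvgB.
    by apply: cvgD; (apply: cvgM; [exact: H1|exact: H1]).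
  apply: cvgM; first exact: cg'O.
  by apply: cvgD; (apply: cvgM; [exact: H1|exact: H1]).
have phi0 q : ~ in_box (x0, y0) rho q -> tf phi q = 0 by move=> /sphi[].
have strip u1 u2 : u1 < u2 -> (0 < u1 /\ u2 < 3 * r / 4) \/ (- (3 * r / 4) < u1 /\ u2 < 0) ->
    (\int[area]_(z in `[x1, x2] `*` `[u1, u2]) (T z)%:E =
     \int[leb]_(x in `[x1, x2]) (B x u2 - B x u1)%:E)%E.
  move=> u12 hu.
  have QO x u : x1 <= x <= x2 -> u1 <= u <= u2 -> O (x, u).
    move=> /Xx hx /andP[? ?]; split => //=.
    by case: hu => -[? ?]; [left|right]; split; slra.
  have A0 u : u1 <= u <= u2 -> A x1 u = A x2 u.
    move=> _; rewrite /A !phi0 ?mul0r// => -[/= + _]; rewrite ltr_norml /x1 /x2; slra.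
  rewrite -(divergence_rect x12 u12 oO QO dA dB cA cB A0).
  apply: eq_integral => -[x u]; rewrite in_setX/= => /andP[].
  rewrite !inE/= !in_itv/= => hx hu'; have Oxu := QO _ _ hx hu'.
  have [pb pg] := pO _ Oxu; have [_ _ dE] := dF _ pb pg.
  have -> : T (x, u) = weak_form F1 F2 d phi (p (x, u)) by [].
  by congr (_%:E); rewrite /weak_form dE /Ax /Bu /D2 /=; ring.
have cB1 x e : x1 <= x <= x2 -> O (x, e) -> {for x, continuous (B ^~ e)}.
  move=> hx Oxe; have [pb pg] := pO _ Oxe; have [/is_grad_continuous c1 /is_grad_continuous c2 _] := dF _ pb pg.
  have xr := lt_le_trans (Xx _ hx) rho2r.
  have H1 (F : R * R -> R) : {for p (x, e), continuous F} -> {for x, continuous (fun x => F (p (x, e)))}.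
    move=> cF'; have cxe : {for x, continuous (fun x => g x + e)}.
      by apply: cvgD; [exact: cg|exact: cvg_cst].
    exact: (@continuous_comp2 R R F id (fun x => g x + e) x (@cvg_id _ _) cxe cF').
  have t0 := @test_continuous R phi (p (x, e)).
  by rewrite /B; repeat first [exact: H1|exact: cg'|apply: cvgM|apply: cvgB].
have [G hG] : exists G : R, forall x, x1 <= x <= x2 -> `|g' x| <= G.
  have : compact (g' @` `[x1, x2]).
    apply: continuous_compact; last exact: segment_compact.
    apply: continuous_in_subspaceT => x /set_mem; rewrite /= in_itv/= => /Xx hx.
    by apply: cg'; exact: lt_le_trans hx _.
  move=> /compact_bounded [M [_ h]]; exists (`|M| + 1) => x hx.
  apply: (h (`|M| + 1)); first by rewrite ltr_pwDr// ler_norm.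
  by exists x => //=; rewrite in_itv.
have G0 : 0 <= G by apply: le_trans (hG x0 _); rewrite // /x1 /x2; slra.
have C0 : 0 <= C.
  have [h _ _] : [/\ `|F1 (x0, y0)| <= C, `|F2 (x0, y0)| <= C & `|d (x0, y0)| <= C].
    by apply: bF; split; rewrite subrr normr0.
  exact: le_trans h.
have bB x e : x1 <= x <= x2 -> O (x, e) -> `|B x e| <= K * (C + G * C).
  move=> hx Oxe; have [pb _] := pO _ Oxe; have [f1 f2 _] := bF _ pb; have [k0 _ _] := hK (p (x, e)).
  rewrite normrM ler_pM//; apply: le_trans (ler_normB _ _) _; rewrite lerD// normrM ler_pM//.
  exact: hG.
pose eps n : R := H / n.+2%:R.
have eps0 n : 0 < eps n by rewrite divr_gt0// /H; slra.
have epsH n : eps n < H.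
  by rewrite /eps ltr_pdivrMr// ltr_pMr ?ltr1n// /H; slra.
have OX x e : x1 <= x <= x2 -> 0 < e < H -> O (x, e) /\ O (x, - e).
  move=> /Xx hx /andP[e1 e2]; rewrite /H in e2.
  by split; split => //=; [left|right]; split; slra.
pose jmp n x := B x (- eps n) - B x (eps n).
have epscvg : eps n @[n --> \oo] --> (0 : R).
  have h : harmonic n.+1 @[n --> \oo] --> (0 : R).
    by have := @cvg_harmonic R; rewrite -cvg_shiftS; exact.
  have := cvgM (cvg_cst H) h; rewrite mulr0; exact.
have jmp_cvg x : x1 <= x <= x2 -> jmp n x @[n --> \oo] --> (0 : R).
  move=> hx; have xr := lt_le_trans (Xx _ hx) rho2r.
  apply/cvgr0Pnorm_lt => eta eta0.
  have [del del0 hdel] := jump x xr (eta / (2 * (K + 1))) ltac:(by rewrite divr_gt0 ?mulr_gt0 ?ltr_wpDl).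
  pose CG := C + G * C; have CG0 : 0 <= CG by rewrite addr_ge0 ?mulr_ge0.
  have cphi s : s ^+ 2 = 1 -> \forall n \near \oo,
      `|tf phi (x, g x) - tf phi (x, g x + s * eps n)| < eta / (4 * (CG + 1)).
    move=> _; have : tf phi (x, g x + s * eps n) @[n --> \oo] --> tf phi (x, g x).
      have h2 : g x + s * eps n @[n --> \oo] --> g x.
        by have := cvgD (cvg_cst (g x)) (cvgM (cvg_cst s) epscvg); rewrite mulr0 addr0; exact.
      apply: (@cvg_comp _ _ _ (fun n => (x, g x + s * eps n)) (tf phi) _ (nbhs (x, g x))).
        exact: (cvg_pair (cvg_cst x) h2).
      exact: test_continuous.
    by move=> /cvgrPdist_lt; apply; rewrite divr_gt0 ?mulr_gt0 ?ltr_wpDl.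
  have near_eps : \forall n \near \oo, eps n < del.
    by move/cvgr_lt : (epscvg) => /(_ _ del0).
  near=> n.
  have e_n : eps n < del by near: n; exact: near_eps.
  have [pos neg] := OX x (eps n) hx ltac:(by rewrite eps0 epsH).
  have h1 := hdel (eps n) ltac:(by rewrite eps0 e_n).
  have h2 : `|tf phi (x, g x) - tf phi (x, g x + 1 * eps n)| < eta / (4 * (CG + 1)).
    by near: n; apply: cphi; rewrite expr1n.
  have h3 : `|tf phi (x, g x) - tf phi (x, g x + (- 1) * eps n)| < eta / (4 * (CG + 1)).
    by near: n; apply: cphi; rewrite sqrrN expr1n.
  have JE e : B x e = tf phi (p (x, e)) * J e x by [].
  have bJ e : O (x, e) -> `|J e x| <= CG.
    move=> Oe; have [pb _] := pO _ Oe; have [f1 f2 _] := bF _ pb.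
    apply: le_trans (ler_normB _ _) _; rewrite lerD// normrM ler_pM//; exact: hG.
  rewrite mul1r mulN1r in h2 h3.
  have -> : jmp n x = (tf phi (x, g x - eps n) - tf phi (x, g x + eps n)) * J (eps n) x
      - tf phi (x, g x - eps n) * (J (eps n) x - J (- eps n) x).
    by rewrite /jmp !JE /p /=; ring.
  apply: le_lt_trans (ler_normB _ _) _; rewrite !normrM.
  have k0 : `|tf phi (x, g x - eps n)| <= K by have [] := hK (x, g x - eps n).
  have b1 := bJ _ pos.
  have D0 : `|tf phi (x, g x - eps n) - tf phi (x, g x + eps n)| <= eta / (2 * (CG + 1)).
    have := ler_distD (tf phi (x, g x)) (tf phi (x, g x - eps n)) (tf phi (x, g x + eps n)).
    rewrite distrC in h3.
    have -> : eta / (2 * (CG + 1)) = eta / (4 * (CG + 1)) + eta / (4 * (CG + 1)).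
      by field; rewrite gt_eqF ?ltr_wpDl.
    slra.
  have e1 : `|tf phi (x, g x - eps n) - tf phi (x, g x + eps n)| * `|J (eps n) x| < eta / 2.
    apply: le_lt_trans (ler_pM _ _ D0 b1) _ => //.
    have -> : eta / (2 * (CG + 1)) * CG = eta / 2 - eta / (2 * (CG + 1)).
      by field; rewrite gt_eqF ?ltr_wpDl.
    by rewrite gtrDl oppr_lt0 divr_gt0 ?mulr_gt0 ?ltr_wpDl.
  have e2 : `|tf phi (x, g x - eps n)| * `|J (eps n) x - J (- eps n) x| < eta / 2.
    apply: le_lt_trans (ler_pM _ _ k0 (ltW h1)) _ => //.
    have -> : K * (eta / (2 * (K + 1))) = eta / 2 - eta / (2 * (K + 1)).
      by field; rewrite gt_eqF ?ltr_wpDl.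
    by rewrite gtrDl oppr_lt0 divr_gt0 ?mulr_gt0 ?ltr_wpDl.
  slra.
pose Dn n := (\int[leb]_(x in `[x1, x2]) (jmp n x)%:E)%E.
have mjmp n : measurable_fun (`[x1, x2]%classic : set mR) (jmp n : mR -> mR).
  apply: subspace_continuous_measurable_fun => //.
  apply: continuous_in_subspaceT => x /set_mem; rewrite /= in_itv/= => hx.
  have [pos neg] := OX x (eps n) hx ltac:(by rewrite eps0 epsH).
  by apply: cvgB; exact: cB1.
have bjmp n x : x1 <= x <= x2 -> `|jmp n x| <= 2 * (K * (C + G * C)).
  move=> hx; have [pos neg] := OX x (eps n) hx ltac:(by rewrite eps0 epsH).
  apply: le_trans (ler_normB _ _) _; have := bB _ _ hx pos; have := bB _ _ hx neg; slra.
have Dn0 : Dn n @[n --> \oo] --> 0%E.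
  have := @dominated_convergence _ mR R leb `[x1, x2]%classic mX
    (fun n => EFin \o jmp n) (cst 0%E)
    (cst (2 * (K * (C + G * C)))%:E).
  rewrite integral0 => h; have [] := h _ _ _ _ _; last by move=> _ _; exact.
  - by move=> n; apply/measurable_EFinP; exact: mjmp.
  - exact: measurable_cst.
  - apply: aeW => x /=; rewrite in_itv/= => hx.
    by apply: cvg_EFin; [exact: nearW|exact: jmp_cvg].
  - apply: (@measurable_bounded_integrable _ mR R leb (cst (2 * (K * (C + G * C))))) => //.
    + exact: leb_itv_lty.
    + by exists `|2 * (K * (C + G * C))|; split; [exact: num_real|move=> M hM x _; exact: ltW].
  - by apply: aeW => x n /=; rewrite in_itv/= => hx; rewrite lee_fin; exact: bjmp.
have mQ u1 u2 : measurable (`[x1, x2]%classic `*` `[u1, u2]%classic : set mR2).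
  by apply: measurableX; exact: measurable_itv.
pose Qm n : set mR2 := `[x1, x2]%classic `*` `](- eps n), (eps n)[%classic.
have mQm n : measurable (Qm n) by apply: measurableX; exact: measurable_itv.
pose Mn n := \int[area]_(z in Qm n) T z.
have iQ (S : set mR2) : measurable S -> S `<=` `[x1, x2]%classic `*` `[- H, H]%classic ->
    area.-integrable S (EFin \o T).
  by move=> mS sS; apply: integrableS iT'.
have iBe e : (forall x, x1 <= x <= x2 -> O (x, e)) ->
    leb.-integrable (`[x1, x2]%classic : set mR) (EFin \o (fun x => B x e)).
  move=> Oe; apply: measurable_bounded_integrable => //.
  - exact: leb_itv_lty.
  - apply: subspace_continuous_measurable_fun => //.
    apply: continuous_in_subspaceT => x /set_mem; rewrite /= in_itv/= => hx.
    by apply: cB1 => //; exact: Oe.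
  - exists (K * (C + G * C)); split; first exact: num_real.
    move=> M hM x; rewrite /= in_itv/= => hx.
    by apply: le_trans (ltW hM); apply: bB => //; exact: Oe.
have BH x e : x1 <= x <= x2 -> `|e| = H -> B x e = 0.
  move=> /Xx hx eH; rewrite /B phi0 ?mul0r// => -[_ /=].
  have := grho2 _ hx; rewrite /p/= !ltr_norml; move: eH; rewrite /H.
  by case: (ger0P e) => _ ?; slra.
have half_sum n : \int[leb]_(x in `[x1, x2]) (B x (- eps n) - B x (- H)) +
   \int[leb]_(x in `[x1, x2]) (B x H - B x (eps n)) = fine (Dn n).
  have [Op On] : (forall x, x1 <= x <= x2 -> O (x, eps n)) /\ (forall x, x1 <= x <= x2 -> O (x, - eps n)).
    by split=> x hx; have [] := OX x (eps n) hx ltac:(by rewrite eps0 epsH).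
  have -> : \int[leb]_(x in `[x1, x2]) (B x (- eps n) - B x (- H)) =
      \int[leb]_(x in `[x1, x2]) B x (- eps n).
    apply: eq_Rintegral => x; rewrite inE/= in_itv/= => hx.
    by rewrite (BH x (- H)) ?subr0// normrN gtr0_norm// /H; slra.
  have -> : \int[leb]_(x in `[x1, x2]) (B x H - B x (eps n)) =
      \int[leb]_(x in `[x1, x2]) (- B x (eps n)).
    apply: eq_Rintegral => x; rewrite inE/= in_itv/= => hx.
    by rewrite (BH x H) ?sub0r// gtr0_norm// /H; slra.
  rewrite -RintegralD//; first exact: iBe.
  by apply: (integrableN (iBe _ _)).
have split3 n : \int[area]_z Psi z = fine (Dn n) + Mn n.
  have e0 := eps0 n; have eH := epsH n; have HH : H = r / 2 by [].
  pose Q1 : set mR2 := `[x1, x2]%classic `*` `[- H, - eps n]%classic.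
  pose Q2 : set mR2 := `[x1, x2]%classic `*` `[eps n, H]%classic.
  have QE : `[x1, x2]%classic `*` `[- H, H]%classic = Q1 `|` (Qm n `|` Q2).
    apply/seteqP; split => -[x u] /=; rewrite /Q1 /Q2 /Qm /= !in_itv/=.
      move=> [hx /andP[? ?]]; have [?|?] := leP u (- eps n); first by left; split=> //; slra.
      right; have [?|?] := ltP u (eps n); [by left; split => //; slra|by right; split => //; slra].
    by move=> [[? ?]|[[? ?]|[? ?]]]; split => //; slra.
  have -> : \int[area]_z Psi z = \int[area]_(z in Q1 `|` (Qm n `|` Q2)) T z.
    by rewrite -QE /Rintegral ET.
  have mU : measurable (Qm n `|` Q2) by apply: measurableU => //; exact: mQ.
  have iU : area.-integrable (Q1 `|` (Qm n `|` Q2)) (EFin \o T) by rewrite -QE.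
  rewrite Rintegral_setU//; last 2 first.
  - exact: mQ.
  - apply/disj_setPS => -[x u] []; rewrite /Q1 /Q2 /Qm /= !in_itv/= => -[_ ?] [[_ ?]|[_ ?]]; slra.
  rewrite Rintegral_setU//; last 3 first.
  - exact: mQ.
  - by rewrite -QE in iU; apply: (iQ _ mU) => z ?; rewrite QE; right.
  - apply/disj_setPS => -[x u] []; rewrite /Q1 /Q2 /Qm /= !in_itv/= => -[_ ?] [_ ?]; slra.
  have -> : \int[area]_(z in Q1) T z = \int[leb]_(x in `[x1, x2]) (B x (- eps n) - B x (- H)).
    by rewrite /Rintegral strip//; [slra|right; slra].
  have -> : \int[area]_(z in Q2) T z = \int[leb]_(x in `[x1, x2]) (B x H - B x (eps n)).
    by rewrite /Rintegral strip//; left; slra.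
  by rewrite -half_sum /Mn; ring.
have bMn m : `|Mn m| <= C2 * ((2 * rho) * (2 * eps m)).
  have sQ : Qm m `<=` `[x1, x2]%classic `*` `[- H, H]%classic.
    move=> [x u] /=; rewrite /Qm /= !in_itv/= => -[? ?]; split => //.
    have := epsH m; slra.
  have ii := iQ _ (mQm m) sQ.
  have aQ : area (Qm m) = ((2 * rho) * (2 * eps m))%:E.
    have -> : area (Qm m) = (leb `[x1, x2]%classic * leb `](- eps m)%R, (eps m)%R[%classic)%E.
      exact: product_measure1E.
    rewrite !lebesgue_measure_itv/= !lte_fin x12 gtrN ?eps0//= -!EFinD -EFinM.
    by congr (_%:E); rewrite /x1 /x2; ring.
  apply: le_trans (le_normr_Rintegral (mQm m) ii) _.
  rewrite -[_ * (2 * eps m)]/(fine ((2 * rho) * (2 * eps m))%:E) -aQ -Rintegral_cst//.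
  apply: le_Rintegral => //.
  - exact: (integrable_norm ii).
  - apply: (@measurable_bounded_integrable _ mR2 R area (cst C2)) => //.
    + by rewrite aQ ltry.
    + by exists `|C2|; split; [exact: num_real|move=> M hM x _; exact: ltW].
  - by move=> z _; exact: hC2.
have I0 : \int[area]_z Psi z = 0.
  have Mn0 : Mn n @[n --> \oo] --> (0 : R).
    pose c : R := C2 * (2 * rho) * 2.
    have h : c * eps n @[n --> \oo] --> (0 : R).
      by have := cvgM (cvg_cst c) epscvg; rewrite mulr0; exact.
    have hb i : 0 <= `|Mn i| <= c * eps i.
      rewrite normr_ge0 /c; apply: le_trans (bMn i) _.
      by rewrite le_eqVlt; apply/orP; left; apply/eqP; ring.
    apply/norm_cvg0P; apply: (squeeze_cvgr _ (cvg_cst 0) h).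
    exact: nearW hb.
  have D0 : fine (Dn n) @[n --> \oo] --> (0 : R) by apply: (fine_cvg Dn0).
  have E : (fun i => fine (Dn i) + Mn i) = (fun=> \int[area]_z Psi z).
    by apply/funext => i; rewrite (split3 i).
  have h : fine (Dn i) + Mn i @[i --> \oo] --> (0 : R).
    by have := cvgD D0 Mn0; rewrite addr0; exact.
  rewrite E in h.
  exact: (cvg_unique (@Rhausdorff R) (cvg_cst (\int[area]_z Psi z)) h).
rewrite -[RHS]/(0%:E) -I0 /Rintegral fineK//.
exact: (integrable_fin_num measurableT iPsi).
Unshelve. all: by end_near.
Qed.
End GraphBoundary.

(** * A twice differentiable step *)

Section Spline.
Context {R : realType}.
Implicit Types u : R.

(** Powers of the positive part: the cubic spline below is twice continuously
    differentiable, which is all that a Laplacian needs. *)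
Definition ppart u : R := Num.max 0 u.
Definition ppart2 u : R := ppart u * ppart u.
Definition ppart3 u : R := ppart2 u * u.

Lemma ppart_ge0 u : 0 <= ppart u.
Proof. by rewrite /ppart le_max lexx. Qed.

Lemma ppart_pos u : 0 <= u -> ppart u = u.
Proof. by move=> h; rewrite /ppart max_r. Qed.

Lemma ppart_neg u : u <= 0 -> ppart u = 0.
Proof. by move=> h; rewrite /ppart max_l. Qed.

Lemma ppart_continuous u : {for u, continuous ppart}.
Proof. by apply: continuous_max; [exact: cvg_cst|exact: cvg_id]. Qed.

Lemma ppart_taylor u h : `|ppart2 (u + h) - ppart2 u - h * (2 * ppart u)| <= h ^+ 2.
Proof.
rewrite /ppart2 ler_norml; have [a|/ltW a] := lerP 0 u; have [b|/ltW b] := lerP 0 (u + h);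
  rewrite ?(ppart_pos a) ?(ppart_neg a) ?(ppart_pos b) ?(ppart_neg b); nra.
Qed.

(** A quadratic remainder gives the derivative at the corner of the positive
    part in the same way as elsewhere. *)
Lemma is_derive_quadratic (f : R -> R) (u d : R) :
  (forall h, `|f (u + h) - f u - h * d| <= h ^+ 2) -> is_derive u 1 f d.
Proof.
move=> H.
have c : (fun h => h^-1 *: (f (h *: 1 + u) - f u)) @ 0^' --> d.
  apply/cvgrPdist_le => e e0; near=> h.
  have h0 : h != 0 by near: h; exact: nbhs_dnbhs_neq.
  have he : `|h| <= e.
    by near: h; apply: nbhs_dnbhs; apply/nbhs_ballP; exists e => // k; rewrite /ball/= sub0r normrN => /ltW.
  have := H h; rewrite /GRing.scale/= mulr1 (addrC h u) => Hh.
  have -> : d - h^-1 * (f (u + h) - f u) = - (h^-1 * (f (u + h) - f u - h * d)).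
    by field.
  rewrite normrN normrM normfV ler_pdivrMl ?normr_gt0//.
  apply: le_trans Hh _; rewrite -real_normK ?num_real// expr2 ler_pM//.
split; first by apply/cvg_ex; exists d.
by apply: cvg_lim.
Unshelve. all: by end_near. Qed.

Lemma ppart2_derive u : is_derive u 1 ppart2 (2 * ppart u).
Proof. by apply: is_derive_quadratic => h; exact: ppart_taylor. Qed.

Lemma ppart3_derive u : is_derive u 1 ppart3 (3 * ppart2 u).
Proof.
apply: (is_derive_to (is_deriveM (ppart2_derive u) (is_derive_id u 1))).
rewrite /GRing.scale/= mulr1 /ppart2; have [a|/ltW a] := lerP 0 u.
  by rewrite (ppart_pos a); ring.
by rewrite (ppart_neg a); ring.
Qed.

(** Third difference of [u^3 / 6]: it vanishes for [u <= 0] and equals 1 for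
    [3 <= u]. *)
Definition step u : R :=
  6^-1 * (ppart3 u + (- 3 * ppart3 (u - 1) + (3 * ppart3 (u - 2) + - 1 * ppart3 (u - 3)))).
Definition step1 u : R :=
  2^-1 * (ppart2 u + (- 3 * ppart2 (u - 1) + (3 * ppart2 (u - 2) + - 1 * ppart2 (u - 3)))).
Definition step2 u : R :=
  ppart u + (- 3 * ppart (u - 1) + (3 * ppart (u - 2) + - 1 * ppart (u - 3))).

Lemma derive_add (f g : R -> R) (u a b : R) : is_derive u 1 f a -> is_derive u 1 g b ->
  is_derive u 1 (fun x => f x + g x) (a + b).
Proof. by move=> df dg; exact: (is_deriveD df dg). Qed.

Lemma derive_scale (k : R) (f : R -> R) (u a : R) : is_derive u 1 f a ->
  is_derive u 1 (fun x => k * f x) (k * a).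
Proof. by move=> df; exact: (is_deriveZ k df). Qed.

Lemma derive_shift (f f' : R -> R) (c u : R) : (forall u, is_derive u 1 f (f' u)) ->
  is_derive u 1 (fun u => f (u - c)) (f' (u - c)).
Proof.
move=> df.
have h : is_derive u 1 (fun u : R => u - c) 1.
  exact: (is_derive_to (is_deriveB (is_derive_id u 1) (is_derive_cst c u 1)) (subr0 _)).
have X := @is_derive1_comp R f (fun u : R => u - c) u _ _ (df (u - c)) h; rewrite mulr1 in X.
exact: X.
Qed.

Lemma third_difference (f f' : R -> R) (k u : R) : (forall u, is_derive u 1 f (f' u)) ->
  is_derive u 1 (fun u => k * (f u + (- 3 * f (u - 1) + (3 * f (u - 2) + - 1 * f (u - 3)))))
    (k * (f' u + (- 3 * f' (u - 1) + (3 * f' (u - 2) + - 1 * f' (u - 3))))).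
Proof.
move=> df; have d c := derive_shift c u df.
exact: (derive_scale k (derive_add (df u) (derive_add (derive_scale (-3) (d 1))
  (derive_add (derive_scale 3 (d 2)) (derive_scale (- 1) (d 3)))))).
Qed.

Lemma step_derive u : is_derive u 1 step (step1 u).
Proof.
apply: (is_derive_to (third_difference 6^-1 u ppart3_derive)).
by rewrite /step1; field.
Qed.

Lemma step1_derive u : is_derive u 1 step1 (step2 u).
Proof.
apply: (is_derive_to (third_difference 2^-1 u ppart2_derive)).
by rewrite /step2; field.
Qed.

Lemma step2_continuous u : {for u, continuous step2}.
Proof.
have c (a : R) : {for u, continuous (fun u => ppart (u - a))}.
  apply: (@continuous_comp _ _ _ (fun u => u - a) ppart); last exact: ppart_continuous.
  by apply: cvgB; [exact: cvg_id|exact: cvg_cst].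
have m (k a : R) : {for u, continuous (fun u => k * ppart (u - a))}.
  by apply: cvgM; [exact: cvg_cst|exact: c].
by apply: cvgD; [exact: ppart_continuous|do 2! (apply: cvgD; first exact: m); exact: m].
Qed.

Lemma step_le0 u : u <= 0 -> [/\ step u = 0, step1 u = 0 & step2 u = 0].
Proof.
move=> u0; rewrite /step /step1 /step2 /ppart3 /ppart2.
rewrite (ppart_neg u0) !(@ppart_neg (u - _)); try lra.
by split; field.
Qed.

Lemma step_ge3 u : 3 <= u -> [/\ step u = 1, step1 u = 0 & step2 u = 0].
Proof.
move=> u0; rewrite /step /step1 /step2 /ppart3 /ppart2.
rewrite !(@ppart_pos (u - _)) ?(@ppart_pos u); try lra.
by split; field.
Qed.

Lemma step_bounded u : [/\ `|step u| <= 99, `|step1 u| <= 99 & `|step2 u| <= 99].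
Proof.
have [u0|u0] := lerP u 0.
  by have [-> -> ->] := step_le0 u0; rewrite normr0; split; lra.
have [u3|u3] := lerP 3 u.
  by have [-> -> ->] := step_ge3 u3; rewrite normr0 normr1; split; lra.
have b (a : R) : 0 <= a <= 3 -> 0 <= ppart (u - a) <= 3.
  by move=> a0; rewrite /ppart le_max lexx ge_max /=; lra.
have sq (x : R) : 0 <= x <= 3 -> 0 <= x * x <= 9 by move=> h; nra.
have cu (x y : R) : 0 <= x <= 3 -> 0 <= y <= 9 -> 0 <= y * x <= 27 by move=> h h'; nra.
have p3 v : ppart3 v = ppart2 v * ppart v.
  rewrite /ppart3 /ppart2; have [a|/ltW a] := lerP 0 v; first by rewrite (ppart_pos a).
  by rewrite (ppart_neg a) !mul0r.
have b0 := b 0 ltac:(lra); have b1 := b 1 ltac:(lra); have b2 := b 2 ltac:(lra); have b3 := b 3 ltac:(lra).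
rewrite subr0 in b0.
have s0 := sq _ b0; have s1 := sq _ b1; have s2 := sq _ b2; have s3 := sq _ b3.
have c0 := cu _ _ b0 s0; have c1 := cu _ _ b1 s1; have c2 := cu _ _ b2 s2; have c3 := cu _ _ b3 s3.
rewrite /step /step1 /step2 !p3 /ppart2.
by rewrite !ler_norml; split; apply/andP; split; lra.
Qed.

End Spline.

(** * From local to global *)

Section Localization.
Context {R : realType}.
Local Notation leb := (@lebesgue_measure R).
Local Notation mR := (measurableTypeR R).
Local Notation mR2 := (measurableTypeR R * measurableTypeR R)%type.
Implicit Types (F : R * R -> R).

Definition flip (z : R * R) : R * R := (z.2, z.1).

Lemma flip_continuous z : {for z, continuous flip}.
Proof. by apply: (@continuous_pair R _ snd fst); [exact: cvg_snd|exact: cvg_fst]. Qed.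

Lemma flip_measurable : measurable_fun setT (flip : mR2 -> mR2).
Proof. by apply: measurable_fun_pair; [exact: measurable_snd|exact: measurable_fst]. Qed.

Lemma area_flip (A : set mR2) : measurable A -> pushforward area (flip : mR2 -> mR2) A = area A.
Proof.
move=> mA; apply/esym.
apply: product_measure_unique => //=; first exact: flip_measurable.
move=> fm X Y mX mY.
have -> : pushforward area (flip : mR2 -> mR2) (X `*` Y) = area (Y `*` X).
  by congr (area _); apply/seteqP; split => -[x y] [/= ? ?]; split.
rewrite muleC; exact: product_measure1E.
Qed.

Lemma integrable_flip F : area.-integrable (setT : set mR2) (EFin \o F) ->
  area.-integrable (setT : set mR2) (EFin \o (F \o flip)) /\
  (\int[area]_z (F (flip z))%:E = \int[area]_z (F z)%:E)%E.
Proof.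
move=> iF.
have mF : measurable_fun setT (EFin \o F : mR2 -> \bar R) by case/integrableP : iF.
have i' : area.-integrable (setT : set mR2) (EFin \o (F \o flip)).
  apply/integrableP; split; first exact: (measurableT_comp mF flip_measurable).
  have := @ge0_integral_pushforward _ _ mR2 mR2 R _ flip_measurable area setT (fun y => `|(F y)%:E|)%E measurableT.
  rewrite preimage_setT => <-//.
  + case/integrableP : iF => _; apply: le_lt_trans; rewrite le_eqVlt; apply/orP; left; apply/eqP.
    apply: eq_measure_integral; first exact: flip_measurable.
    by move=> ? A mA _; exact: area_flip.
  + by apply: measurableT_comp => //; exact: mF.
split => //.
have := @integral_pushforward _ _ mR2 mR2 R _ flip_measurable area setT (EFin \o F) mF.
rewrite preimage_setT => /(_ i' measurableT) <-.
apply: eq_measure_integral; first exact: flip_measurable.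
by move=> ? A mA _; exact: area_flip.
Qed.

Lemma is_grad_flip F z v : is_grad F (flip z) v -> is_grad (F \o flip) z (v.2, v.1).
Proof.
move=> dF.
apply: (is_grad_eq (is_grad_pair (is_grad_snd z) (is_grad_fst z) dF)) => /=.
by congr pair; ring.
Qed.

Lemma continuous_flip F z : {for flip z, continuous F} -> {for z, continuous (F \o flip)}.
Proof. by move=> cF; apply: continuous_comp => //; exact: flip_continuous. Qed.

Definition test_flip (phi : @test R) : @test R.
Proof.
apply: (@Test R (tf phi \o flip) (tf2 phi \o flip) (tf1 phi \o flip)) => z.
have [d c1 c2] := tfP phi (flip z).
by split; [exact: (is_grad_flip d)|exact: continuous_flip|exact: continuous_flip].
Defined.

(** Exchanging the coordinates lets vertical arcs be treated as graphs too. *)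
Lemma weak_divergence_flip F1 F2 d P :
  weak_divergence (F2 \o flip) (F1 \o flip) (d \o flip) (flip P) -> weak_divergence F1 F2 d P.
Proof.
move=> [r r0 h]; exists r => // phi sphi.
have [i0 e0] : null_against (F2 \o flip) (F1 \o flip) (d \o flip) (test_flip phi).
  apply: h => z hz; have [|a b c] := sphi (flip z); last by split.
  by move=> [/= h1 h2]; apply: hz.
have E : weak_form F1 F2 d phi =
    weak_form (F2 \o flip) (F1 \o flip) (d \o flip) (test_flip phi) \o flip.
  apply/funext => -[x y]; rewrite /weak_form /flip /=; ring.
rewrite /null_against E.
by have [i1 e1] := integrable_flip i0; split => //; rewrite -e0 -e1.
Qed.

Definition test_cst (c : R) : @test R.
Proof.
apply: (@Test R (fun=> c) (fun=> 0) (fun=> 0)) => z.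
by split; [exact: is_grad_cst|exact: cvg_cst|exact: cvg_cst].
Defined.

Definition test_mul (phi psi : @test R) : @test R.
Proof.
apply: (@Test R (fun z => tf phi z * tf psi z)
  (fun z => tf phi z * tf1 psi z + tf psi z * tf1 phi z)
  (fun z => tf phi z * tf2 psi z + tf psi z * tf2 phi z)) => z.
have [d c1 c2] := tfP phi z; have [d' c1' c2'] := tfP psi z.
have c := is_grad_continuous d; have c' := is_grad_continuous d'.
by split; [exact: (is_gradM d d')| |]; apply: cvgD; exact: cvgM.
Defined.

Definition test_compl (phi : @test R) : @test R.
Proof.
apply: (@Test R (fun z => 1 + - tf phi z) (fun z => - tf1 phi z) (fun z => - tf2 phi z)) => z.
have [d c1 c2] := tfP phi z.
split; [|exact: cvgN|exact: cvgN].
by apply: (is_grad_eq (is_gradD (is_grad_cst 1 z) (is_gradN d))); rewrite /= !add0r.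
Defined.

(** Product of four steps; the factor 6 makes each of them pass from 0 to 1
    over a length [r / 2]. *)
Lemma bump_exists (P : R * R) (r : R) : 0 < r -> exists2 b : @test R,
  supported b P r &
  forall z, in_box P (r / 2) z -> [/\ tf b z = 1, tf1 b z = 0 & tf2 b z = 0].
Proof.
move=> r0.
pose l (c x : R) := step (6 * (x - c) / r + 6) * step (6 - 6 * (x - c) / r).
pose l' (c x : R) := step (6 * (x - c) / r + 6) * (step1 (6 - 6 * (x - c) / r) * (- (6 / r)))
  + step (6 - 6 * (x - c) / r) * (step1 (6 * (x - c) / r + 6) * (6 / r)).
have da (k m x : R) : is_derive x 1 (fun x : R => k * x + m) k.
  apply: (is_derive_to (derive_add (derive_scale k (is_derive_id x 1)) (is_derive_cst m x 1))).
  by rewrite mulr1 addr0.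
have aff c (x : R) : 6 * (x - c) / r + 6 = 6 / r * x + (6 - 6 * c / r) by ring.
have aff' c (x : R) : 6 - 6 * (x - c) / r = - (6 / r) * x + (6 + 6 * c / r) by ring.
have dl (c x : R) : is_derive x 1 (l c) (l' c x).
  have a1 : is_derive x 1 (fun x : R => 6 * (x - c) / r + 6) (6 / r).
    by rewrite (funext (aff c)); exact: da.
  have a2 : is_derive x 1 (fun x : R => 6 - 6 * (x - c) / r) (- (6 / r)).
    by rewrite (funext (aff' c)); exact: da.
  have b1 := @is_derive1_comp R step (fun x : R => 6 * (x - c) / r + 6) x _ _ (step_derive _) a1.
  have b2 := @is_derive1_comp R step (fun x : R => 6 - 6 * (x - c) / r) x _ _ (step_derive _) a2.
  exact: (is_deriveM b1 b2).
have cS (k m x : R) : {for x, continuous (fun x => step (k * x + m))}.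
  apply: (@continuous_comp _ _ _ (fun x => k * x + m) step).
    by apply: differentiable_continuous; apply/derivable1_diffP; have [] := da k m x.
  by apply: differentiable_continuous; apply/derivable1_diffP; have [] := step_derive (k * x + m).
have cS1 (k m x : R) : {for x, continuous (fun x => step1 (k * x + m))}.
  apply: (@continuous_comp _ _ _ (fun x => k * x + m) step1).
    by apply: differentiable_continuous; apply/derivable1_diffP; have [] := da k m x.
  by apply: differentiable_continuous; apply/derivable1_diffP; have [] := step1_derive (k * x + m).
have cl' (c x : R) : {for x, continuous (l' c)}.
  have -> : l' c = fun x => step (6 / r * x + (6 - 6 * c / r)) *
        (step1 (- (6 / r) * x + (6 + 6 * c / r)) * (- (6 / r)))
      + step (- (6 / r) * x + (6 + 6 * c / r)) *
        (step1 (6 / r * x + (6 - 6 * c / r)) * (6 / r)).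
    by apply/funext => y; rewrite /l' aff aff'.
  by apply: cvgD; (apply: cvgM; [exact: cS|apply: cvgM; [exact: cS1|exact: cvg_cst]]).
have l0 (c x : R) : ~ `|x - c| < r -> l c x = 0 /\ l' c x = 0.
  move=> /negP; rewrite -leNgt ler_normr => xc.
  have [h|h] : 6 * (x - c) / r + 6 <= 0 \/ 6 - 6 * (x - c) / r <= 0.
    rewrite -lerBrDr sub0r ler_pdivrMr// subr_le0 ler_pdivlMr//.
    by case/orP: xc => h; [right|left]; lra.
  - by rewrite /l /l'; have [-> -> _] := step_le0 h; rewrite !(mul0r,mulr0) addr0.
  - by rewrite /l /l'; have [-> -> _] := step_le0 h; rewrite !(mul0r,mulr0) addr0.
have l1 (c x : R) : `|x - c| < r / 2 -> l c x = 1 /\ l' c x = 0.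
  rewrite ltr_norml => /andP[h h'].
  have h1 : 3 <= 6 * (x - c) / r + 6 by rewrite -lerBlDr ler_pdivlMr//; lra.
  have h2 : 3 <= 6 - 6 * (x - c) / r by rewrite lerBrDr -lerBrDl ler_pdivrMr//; lra.
  rewrite /l /l'; have [-> -> _] := step_ge3 h1; have [-> -> _] := step_ge3 h2.
  by rewrite !(mul0r,mulr0) mulr1 addr0.
have dP z : [/\ is_grad (fun z : R * R => l P.1 z.1 * l P.2 z.2) z
      (l' P.1 z.1 * l P.2 z.2, l P.1 z.1 * l' P.2 z.2),
      {for z, continuous (fun z : R * R => l' P.1 z.1 * l P.2 z.2)} &
      {for z, continuous (fun z : R * R => l P.1 z.1 * l' P.2 z.2)}].
  have d1 := is_grad_comp (is_grad_fst z) (dl P.1 z.1).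
  have d2 := is_grad_comp (is_grad_snd z) (dl P.2 z.2).
  have k1 : {for z, continuous (fun z : R * R => l' P.1 z.1)}.
    by apply: (@continuous_comp _ _ _ fst (l' P.1)); [exact: cvg_fst|exact: cl'].
  have k2 : {for z, continuous (fun z : R * R => l' P.2 z.2)}.
    by apply: (@continuous_comp _ _ _ snd (l' P.2)); [exact: cvg_snd|exact: cl'].
  have j1 := is_grad_continuous d1; have j2 := is_grad_continuous d2.
  split; [|exact: (cvgM k1 j2)|exact: (cvgM j1 k2)].
  by apply: (is_grad_eq (is_gradM d1 d2)); congr pair => /=; ring.
exists (Test dP) => z /=.
  move=> nz; have [z1|/l0[-> ->]] := EM (`|z.1 - P.1| < r); last by rewrite !mul0r.
  have [z2|/l0[-> ->]] := EM (`|z.2 - P.2| < r); last by rewrite !mulr0.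
  by case: nz.
by move=> [/l1[-> ->] /l1[-> ->]]; rewrite !mulr0 mul0r mulr1.
Qed.

(** Additivity of the weak form in the test function, with a finite subcover of
    a compact set, turns the local statements into a global one: a test function
    is cut off the boxes of the cover one at a time. *)
Theorem weak_divergence_global F1 F2 d (K : set (R * R)) : compact K ->
  (forall z, ~ K z -> [/\ F1 z = 0, F2 z = 0 & d z = 0]) ->
  (forall P, K P -> weak_divergence F1 F2 d P) ->
  area.-integrable (setT : set mR2) (EFin \o d) /\ (\int[area]_z (d z)%:E = 0)%E.
Proof.
move=> cK zK wK.
have [r hr] : exists r : R * R -> R, forall P, K P -> 0 < r P /\
    forall phi, supported phi P (r P) -> null_against F1 F2 d phi.
  have := @choice (R * R)%type R (fun P rho => K P -> 0 < rho /\
    forall phi, supported phi P rho -> null_against F1 F2 d phi).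
  case=> [P|r hr]; last by exists r.
  have [/wK[rho rho0 h]|nK] := EM (K P); first by exists rho.
  by exists 0.
have cut (l : seq (R * R)) : (forall P, P \in l -> K P) -> forall phi,
    (forall z, K z -> (forall P, P \in l -> ~ in_box P (r P / 2) z) ->
      [/\ tf phi z = 0, tf1 phi z = 0 & tf2 phi z = 0]) ->
    null_against F1 F2 d phi.
  elim: l => [_|P l IH Kl] phi hphi.
    have E : weak_form F1 F2 d phi = cst 0.
      apply/funext => z; rewrite /weak_form /=.
      have [Kz|/zK[-> -> ->]] := EM (K z); last by rewrite !mulr0 !addr0.
      have [//|-> -> ->] := hphi z Kz; by rewrite !mul0r !addr0.
    rewrite /null_against E; split; first exact: integrable0.
    exact: integral0.
  have KP : K P by apply: Kl; rewrite mem_head.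
  have [rP0 hP] := hr P KP.
  have [b sb b1] := bump_exists P rP0.
  have [i1 e1] : null_against F1 F2 d (test_mul phi b).
    by apply: hP => z /sb /= [-> -> ->]; rewrite !mulr0 !mul0r addr0.
  have [i2 e2] : null_against F1 F2 d (test_mul phi (test_compl b)).
    apply: IH => [Q Ql|z Kz hz]; first by apply: Kl; rewrite inE Ql orbT.
    have [/b1[/= -> -> ->]|nb] := EM (in_box P (r P / 2) z).
      by rewrite subrr oppr0 !mulr0 !mul0r addr0.
    have [||/= -> -> ->] := hphi z => //; last by rewrite !mulr0 !mul0r addr0.
    by move=> Q; rewrite inE => /orP[/eqP ->|/hz].
  have E z : (weak_form F1 F2 d phi z)%:E = ((weak_form F1 F2 d (test_mul phi b) z)%:E
      + (weak_form F1 F2 d (test_mul phi (test_compl b)) z)%:E)%E.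
    by rewrite -EFinD; congr (_%:E); rewrite /weak_form /=; ring.
  split.
    rewrite (_ : EFin \o _ = (EFin \o weak_form F1 F2 d (test_mul phi b)) \+
      (EFin \o weak_form F1 F2 d (test_mul phi (test_compl b))))%E.
      exact: integrableD.
    by apply/funext => z; rewrite /= E.
  under eq_integral do rewrite E.
  by rewrite integralD// e1 e2 add0e.
have openB P : open [set z | in_box P (r P / 2) z].
  rewrite openE => z [h1 h2]; rewrite /interior.
  have c1 : {for z, continuous (fun z : R * R => `|z.1 - P.1|)}.
    by apply: cvg_norm; apply: cvgB; [exact: cvg_fst|exact: cvg_cst].
  have c2 : {for z, continuous (fun z : R * R => `|z.2 - P.2|)}.
    by apply: cvg_norm; apply: cvgB; [exact: cvg_snd|exact: cvg_cst].
  move/cvgr_lt : c1 => /(_ _ h1) n1; move/cvgr_lt : c2 => /(_ _ h2) n2.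
  by apply: filterS2 n1 n2 => w w1 w2; split.
(* The finite subcover: lists of points of [K] are directed by inclusion, and
   compactness says that along this filter the boxes eventually cover [K]. *)
pose inK (l : seq (R * R)) : Prop := forall P, P \in l -> K P.
pose up (l0 : seq (R * R)) : set (seq (R * R)) := [set l | inK l /\ {subset l0 <= l}].
have FF : Filter (filter_from inK up).
  apply: filter_from_filter; first by exists [::].
  move=> l1 l2 k1 k2; exists (l1 ++ l2).
    by move=> P; rewrite mem_cat => /orP[/k1|/k2].
  by move=> l [kl sl]; split; split => // P Pl; apply: sl; rewrite mem_cat Pl ?orbT.
have [l0 kl0 hl0] : (filter_from inK up)
    [set l : seq (R * R) | K `<=` [set z : R * R | exists2 P : R * R, P \in l & in_box P (r P / 2) z]].
  move/compact_near_coveringP : cK => /(_ _ _ (fun (l : seq (R * R)) (z : R * R) => exists2 P, P \in l & in_box P (r P / 2) z) FF).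
  apply => P KP; have [rP0 _] := hr P KP.
  exists ([set z | in_box P (r P / 2) z], up [:: P]) => /=.
    split; last by exists [:: P] => // Q; rewrite inE => /eqP ->.
    by apply: open_nbhs_nbhs; split; [exact: openB|rewrite /in_box /= !subrr normr0 divr_gt0].
  by move=> [z l] /= [zP [_ sl]]; exists P => //; apply: sl; rewrite inE.
have cov z : K z -> exists2 P, P \in l0 & in_box P (r P / 2) z.
  by apply: hl0; split.
have : null_against F1 F2 d (test_cst 1).
  apply: (cut l0) => // z Kz hz.
  by have [P Pl /(hz P Pl)] := cov z Kz.
rewrite /null_against (_ : weak_form _ _ _ _ = d)//.
by apply/funext => z; rewrite /weak_form /= mul1r !mul0r !addr0.
Qed.

End Localization.

(** * Polar coordinates on the slit plane *)

Section Polar.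
Context {R : realType}.
Implicit Types (z : R * R) (x y : R).

Definition nsq z : R := z.1 ^+ 2 + z.2 ^+ 2.

Lemma nsq_ge0 z : 0 <= nsq z.
Proof. by rewrite addr_ge0 ?sqr_ge0. Qed.

Lemma nsq_eq0 z : nsq z = 0 -> z = (0, 0).
Proof.
move=> /eqP; rewrite paddr_eq0 ?sqr_ge0// !sqrf_eq0 => /andP[/eqP a /eqP b].
by rewrite [z]surjective_pairing a b.
Qed.

Lemma nsq_gt0 z : z <> (0, 0) -> 0 < nsq z.
Proof. by move=> z0; rewrite lt_neqAle nsq_ge0 andbT eq_sym; apply/eqP => /nsq_eq0. Qed.

Lemma modulusE z : modulus z = Num.sqrt (nsq z). Proof. by []. Qed.

Lemma modulus_ge0 z : 0 <= modulus z. Proof. exact: sqrtr_ge0. Qed.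

Lemma modulus_sq z : modulus z ^+ 2 = nsq z.
Proof. by rewrite modulusE sqr_sqrtr// nsq_ge0. Qed.

Lemma modulus_gt0 z : z <> (0, 0) -> 0 < modulus z.
Proof. by move=> /nsq_gt0; rewrite modulusE sqrtr_gt0. Qed.

Lemma modulus_ge1 z : `|z.1| <= modulus z.
Proof. by rewrite modulusE -sqrtr_sqr ler_sqrt ?nsq_ge0// lerDl sqr_ge0. Qed.

Lemma modulus_ge2 z : `|z.2| <= modulus z.
Proof. by rewrite modulusE -sqrtr_sqr ler_sqrt ?nsq_ge0// lerDr sqr_ge0. Qed.

Lemma modulus_le z : modulus z <= `|z.1| + `|z.2|.
Proof.
rewrite -(ler_pXn2r (n := 2)) ?nnegrE ?modulus_ge0 ?addr_ge0// modulus_sq /nsq.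
have := sqr_ge0 `|z.1|; rewrite sqrrD !real_normK ?num_real// => _.
by rewrite -addrA (addrC (_ *+ 2)) addrA lerDl mulrn_wge0// mulr_ge0.
Qed.

Lemma slit_neq0 z : ~ pos_axis z -> z <> (0, 0).
Proof. by move=> nz z0; apply: nz; rewrite z0; split => /=. Qed.

Lemma slit_gt0 z : ~ pos_axis z -> 0 < modulus z - z.1.
Proof.
move=> nz; rewrite subr_gt0; have [z1|z1] := ltrP z.1 0.
  by apply: lt_le_trans z1 (modulus_ge0 _).
have z2 : z.2 != 0 by apply/eqP => z2; apply: nz; split.
rewrite -(ltr_pXn2r (n := 2)) ?nnegrE ?modulus_ge0// modulus_sq /nsq ltrDl.
by rewrite lt_neqAle sqr_ge0 eq_sym sqrf_eq0 z2.
Qed.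

Lemma ratio_itv z : z <> (0, 0) -> -1 <= z.1 / modulus z <= 1.
Proof.
move=> /modulus_gt0 r0; rewrite -ler_norml normrM normfV (gtr0_norm r0).
by rewrite ler_pdivrMr// mul1r modulus_ge1.
Qed.

Lemma cos_arg z : z <> (0, 0) -> cos (arg z) = z.1 / modulus z.
Proof.
move=> z0; have h := ratio_itv z0; have k : cos (acos (z.1 / modulus z)) = z.1 / modulus z.
  by apply: acosK; rewrite in_itv.
rewrite /arg; case: ifP => _ //.
by rewrite addrC mulr2n mulrDl mul1r addrA cosDpi cosDpi opprK cosN.
Qed.

Lemma sin_acos_ratio z : z <> (0, 0) -> sin (acos (z.1 / modulus z)) = `|z.2| / modulus z.
Proof.
move=> z0; have r0 := modulus_gt0 z0; rewrite sin_acos; last exact: ratio_itv.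
have -> : 1 - (z.1 / modulus z) ^+ 2 = (z.2 / modulus z) ^+ 2.
  rewrite !expr_div_n; have -> : z.2 ^+ 2 = modulus z ^+ 2 - z.1 ^+ 2.
    by rewrite modulus_sq /nsq addrC addKr.
  by field; rewrite gt_eqF.
by rewrite sqrtr_sqr normrM normfV (gtr0_norm r0).
Qed.

Lemma sin_arg z : z <> (0, 0) -> sin (arg z) = z.2 / modulus z.
Proof.
move=> z0; rewrite /arg; case: ifPn => [h|]; first by rewrite sin_acos_ratio// ger0_norm.
rewrite -ltNge => h; rewrite addrC mulr2n mulrDl mul1r addrA sinDpi sinDpi opprK sinN.
by rewrite sin_acos_ratio// ltr0_norm// mulNr opprK.
Qed.

Lemma arg_itv z : z <> (0, 0) -> 0 <= arg z <= 2 * pi.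
Proof.
move=> /ratio_itv h; have := acos_ge0 h; have := acos_lepi h; have := pi_ge0 R.
by rewrite /arg; case: ifP => _; lra.
Qed.

(** A single formula for the argument on the whole slit plane: half angles have
    no discontinuity there, since [modulus z - z.1] is positive. *)
Lemma arg_atan z : ~ pos_axis z -> arg z = pi - 2 * atan (z.2 / (modulus z - z.1)).
Proof.
move=> nz; have z0 := slit_neq0 nz; have r0 := modulus_gt0 z0; have d0 := slit_gt0 nz.
set a := atan _.
have E : cos (pi - 2 * a) = z.1 / modulus z.
  rewrite addrC cosDpi cosN mulr2n mulrDl mul1r cosD -!expr2.
  have -> : sin a ^+ 2 = 1 - cos a ^+ 2 by rewrite -(cos2Dsin2 a) addrC addKr.
  rewrite /a cos_atan exprVn sqr_sqrtr; last by rewrite addr_ge0// sqr_ge0.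
  have -> : 1 + (z.2 / (modulus z - z.1)) ^+ 2 = 2 * modulus z / (modulus z - z.1).
    rewrite expr_div_n; have -> : z.2 ^+ 2 = modulus z ^+ 2 - z.1 ^+ 2.
      by rewrite modulus_sq /nsq addrC addKr.
    by field; rewrite gt_eqF.
  by field; rewrite !gt_eqF.
have := atan_gtNpi2 (z.2 / (modulus z - z.1)); have := atan_ltpi2 (z.2 / (modulus z - z.1)).
rewrite -/a => a1 a2; have p0 := pi_gt0 R.
rewrite /arg; case: ifPn => [h|].
  have a0 : 0 <= a by rewrite /a -(@atan0 R) le_atan// divr_ge0// ltW.
  by rewrite -E cosK// in_itv/=; lra.
rewrite -ltNge => h.
have a0 : a <= 0 by rewrite /a -(@atan0 R) le_atan// pmulr_lle0 ?invr_gt0// ltW.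
have -> : z.1 / modulus z = cos (pi + 2 * a).
  by rewrite -E addrC cosDpi cosN [in RHS]addrC cosDpi.
by rewrite cosK; [ring|rewrite in_itv/=; lra].
Qed.

Lemma is_grad_nsq z : is_grad nsq z (2 * z.1, 2 * z.2).
Proof.
have d1 := is_gradM (is_grad_fst z) (is_grad_fst z).
have d2 := is_gradM (is_grad_snd z) (is_grad_snd z).
by apply: (is_grad_eq (is_gradD d1 d2)); congr pair => /=; ring.
Qed.

Lemma is_grad_modulus z : z <> (0, 0) ->
  is_grad modulus z (z.1 / modulus z, z.2 / modulus z).
Proof.
move=> z0; have r0 := modulus_gt0 z0.
apply: (is_grad_eq (is_grad_comp (is_grad_nsq z) (is_derive1_sqrt (nsq_gt0 z0)))).
by rewrite -modulusE /=; congr pair; field; rewrite gt_eqF.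
Qed.

Definition lnm z : R := ln (modulus z).

Lemma is_grad_lnm z : z <> (0, 0) -> is_grad lnm z (z.1 / nsq z, z.2 / nsq z).
Proof.
move=> z0; have r0 := modulus_gt0 z0.
apply: (is_grad_eq (is_grad_comp (is_grad_modulus z0) (is_derive1_ln r0))).
by rewrite -modulus_sq /=; congr pair; field; rewrite gt_eqF.
Qed.

Lemma pos_axis_closed : closed (@pos_axis R).
Proof.
have -> : @pos_axis R = [set z | 0 <= z.1] `&` [set z | z.2 = 0].
  by apply/seteqP; split => z [].
apply: closedI.
  by apply: (@closed_comp _ _ fst [set x : R | 0 <= x]) => [z _|]; [exact: cvg_fst|exact: closed_ge].
by apply: (@closed_comp _ _ snd [set x : R | x = 0]) => [z _|]; [exact: cvg_snd|exact: closed_eq].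
Qed.

Lemma slit_open : open (~` @pos_axis R).
Proof. exact: closed_openC pos_axis_closed. Qed.

Lemma slit_near z : ~ pos_axis z -> \forall w \near z, ~ pos_axis w.
Proof. by move=> nz; exact: (open_nbhs_nbhs (conj slit_open nz)). Qed.

Lemma is_grad_arg z : ~ pos_axis z -> is_grad arg z (- z.2 / nsq z, z.1 / nsq z).
Proof.
move=> nz; have z0 := slit_neq0 nz; have r0 := modulus_gt0 z0; have d0 := slit_gt0 nz.
apply: (@is_grad_near R (fun z => pi + - (2 * atan (z.2 * (modulus z + - z.1)^-1)))).
  by apply: filterS (slit_near nz) => w nw; rewrite (arg_atan nw).
have dd := is_gradD (is_grad_modulus z0) (is_gradN (is_grad_fst z)).
have di : is_derive (modulus z + - z.1) 1 (fun x : R => x^-1) (- (modulus z + - z.1) ^- 2).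
  have dn0 : modulus z + - z.1 != 0 by rewrite gt_eqF.
  have := @is_deriveV R id (modulus z + - z.1) 1 1 dn0 (is_derive_id _ _).
  by rewrite /GRing.scale/= mulr1.
have dT := is_gradM (is_grad_snd z) (is_grad_comp dd di).
have da := is_grad_comp dT (is_derive1_atan _).
apply: (is_grad_eq (is_gradD (is_grad_cst pi z) (is_gradN (is_gradM (is_grad_cst 2 z) da)))).
rewrite /= -modulus_sq.
have E : z.2 ^+ 2 = modulus z ^+ 2 - z.1 ^+ 2 by rewrite modulus_sq /nsq addrC addKr.
have H : 1 + (z.2 / (modulus z - z.1)) ^+ 2 = 2 * modulus z / (modulus z - z.1).
  by rewrite expr_div_n E; field; rewrite gt_eqF.
rewrite H; congr pair.
  by field; rewrite !gt_eqF// mulr_gt0.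
have E2 : z.2 * z.2 = modulus z ^+ 2 - z.1 ^+ 2 by rewrite -E expr2.
transitivity ((z.2 * z.2 - modulus z * (modulus z - z.1)) / (modulus z ^+ 2 * (modulus z - z.1))).
  by field; rewrite !gt_eqF// mulr_gt0.
by rewrite E2; field; rewrite !gt_eqF.
Qed.

End Polar.

(** * Jets, powers and logarithms *)

Section Jets.
Context {R : realType}.
Implicit Types (z e : R * R).

(** Derivatives are carried as data: products and compositions then have
    explicit Laplacians, and no derivative operator has to be evaluated. *)
Record jet := Jet {
  jv : R * R -> R; jx : R * R -> R; jy : R * R -> R;
  jxx : R * R -> R; jxy : R * R -> R; jyy : R * R -> R }.

Definition is_jet (f : jet) z : Prop :=
  [/\ is_grad (jv f) z (jx f z, jy f z), is_grad (jx f) z (jxx f z, jxy f z)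
    & is_grad (jy f) z (jxy f z, jyy f z)] /\
  [/\ {for z, continuous (jxx f)}, {for z, continuous (jxy f)}
    & {for z, continuous (jyy f)}].

Definition lap (f : jet) z : R := jxx f z + jyy f z.

Definition euler (f : jet) z : R := z.1 * jx f z + z.2 * jy f z.

Definition jcst (c : R) : jet :=
  Jet (fun=> c) (fun=> 0) (fun=> 0) (fun=> 0) (fun=> 0) (fun=> 0).

Definition jmul (f g : jet) : jet :=
  Jet (fun z => jv f z * jv g z)
    (fun z => jv f z * jx g z + jv g z * jx f z)
    (fun z => jv f z * jy g z + jv g z * jy f z)
    (fun z => jv f z * jxx g z + jv g z * jxx f z + 2 * (jx f z * jx g z))
    (fun z => jv f z * jxy g z + jv g z * jxy f z + (jx f z * jy g z + jy f z * jx g z))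
    (fun z => jv f z * jyy g z + jv g z * jyy f z + 2 * (jy f z * jy g z)).

Definition jcomp (h h1 h2 : R -> R) (g : jet) : jet :=
  Jet (fun z => h (jv g z))
    (fun z => jx g z * h1 (jv g z)) (fun z => jy g z * h1 (jv g z))
    (fun z => jxx g z * h1 (jv g z) + jx g z * jx g z * h2 (jv g z))
    (fun z => jxy g z * h1 (jv g z) + jx g z * jy g z * h2 (jv g z))
    (fun z => jyy g z * h1 (jv g z) + jy g z * jy g z * h2 (jv g z)).

Definition jshift e (f : jet) : jet :=
  let s z := (z.1 - e.1, z.2 - e.2) in
  Jet (fun z => jv f (s z)) (fun z => jx f (s z)) (fun z => jy f (s z))
    (fun z => jxx f (s z)) (fun z => jxy f (s z)) (fun z => jyy f (s z)).

Lemma is_jet_continuous f z : is_jet f z ->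
  [/\ {for z, continuous (jv f)}, {for z, continuous (jx f)} & {for z, continuous (jy f)}].
Proof.
by move=> [[/is_grad_continuous ? /is_grad_continuous ? /is_grad_continuous ?] _].
Qed.

Lemma is_jet_cst c z : is_jet (jcst c) z.
Proof. by split; split; (exact: is_grad_cst || exact: cvg_cst). Qed.

Lemma is_jet_mul f g z : is_jet f z -> is_jet g z -> is_jet (jmul f g) z.
Proof.
move=> jf jg; have [f0 f1 f2] := is_jet_continuous jf; have [g0 g1 g2] := is_jet_continuous jg.
case: jf => -[df0 df1 df2] [f3 f4 f5]; case: jg => -[dg0 dg1 dg2] [g3 g4 g5].
split; split.
- exact: (is_gradM df0 dg0).
- by apply: (is_grad_eq (is_gradD (is_gradM df0 dg1) (is_gradM dg0 df1))); congr pair => /=; ring.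
- by apply: (is_grad_eq (is_gradD (is_gradM df0 dg2) (is_gradM dg0 df2))); congr pair => /=; ring.
- apply: cvgD; first by apply: cvgD; apply: cvgM.
  by apply: cvgM; [exact: cvg_cst|apply: cvgM].
- apply: cvgD; first by apply: cvgD; apply: cvgM.
  by apply: cvgD; apply: cvgM.
- apply: cvgD; first by apply: cvgD; apply: cvgM.
  by apply: cvgM; [exact: cvg_cst|apply: cvgM].
Qed.

Lemma is_jet_comp (h h1 h2 : R -> R) g z : is_jet g z ->
  (forall u : R, is_derive u 1 h (h1 u)) -> (forall u : R, is_derive u 1 h1 (h2 u)) ->
  (forall u : R, {for u, continuous h2}) -> is_jet (jcomp h h1 h2 g) z.
Proof.
move=> jg dh dh1 ch2; have [g0 g1 g2] := is_jet_continuous jg.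
case: jg => -[dg0 dg1 dg2] [g3 g4 g5].
have d1 := is_grad_comp dg0 (dh1 (jv g z)).
have c1 : {for z, continuous (fun z => h1 (jv g z))} by exact: is_grad_continuous d1.
have c2 : {for z, continuous (fun z => h2 (jv g z))}.
  by apply: (@continuous_comp _ _ _ (jv g) h2).
split; split.
- by apply: (is_grad_eq (is_grad_comp dg0 (dh (jv g z)))).
- by apply: (is_grad_eq (is_gradM dg1 d1)); congr pair => /=; ring.
- by apply: (is_grad_eq (is_gradM dg2 d1)); congr pair => /=; ring.
- by apply: cvgD; apply: cvgM => //; apply: cvgM.
- by apply: cvgD; apply: cvgM => //; apply: cvgM.
- by apply: cvgD; apply: cvgM => //; apply: cvgM.
Qed.

Lemma is_jet_shift e f z : is_jet f (z.1 - e.1, z.2 - e.2) -> is_jet (jshift e f) z.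
Proof.
have d1 := is_gradD (is_grad_fst z) (is_grad_cst (- e.1) z).
have d2 := is_gradD (is_grad_snd z) (is_grad_cst (- e.2) z).
have c1 := is_grad_continuous d1; have c2 := is_grad_continuous d2.
have G F v : is_grad F (z.1 - e.1, z.2 - e.2) v ->
    is_grad (fun z => F (z.1 - e.1, z.2 - e.2)) z v.
  move=> dF; apply: (is_grad_eq (is_grad_pair d1 d2 dF)).
  by rewrite [RHS]surjective_pairing; congr pair => /=; ring.
have C (F : R * R -> R) : {for (z.1 - e.1, z.2 - e.2), continuous F} ->
    {for z, continuous (fun z => F (z.1 - e.1, z.2 - e.2))}.
  by move=> cF; exact: (continuous_comp2 c1 c2 cF).
move=> [[f0 f1 f2] [f3 f4 f5]].
by split; split; [exact: G|exact: G|exact: G|exact: C|exact: C|exact: C].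
Qed.

Lemma lap_mul f g z : lap (jmul f g) z =
  jv f z * lap g z + jv g z * lap f z + 2 * (jx f z * jx g z + jy f z * jy g z).
Proof. by rewrite /lap /=; ring. Qed.

Lemma euler_mul f g z : euler (jmul f g) z = jv f z * euler g z + jv g z * euler f z.
Proof. by rewrite /euler /=; ring. Qed.

Lemma lap_comp (h h1 h2 : R -> R) g z : lap (jcomp h h1 h2 g) z =
  h1 (jv g z) * lap g z + h2 (jv g z) * (jx g z ^+ 2 + jy g z ^+ 2).
Proof. by rewrite /lap /=; ring. Qed.

Definition jln : jet :=
  Jet lnm (fun z => z.1 * (nsq z)^-1) (fun z => z.2 * (nsq z)^-1)
    (fun z => (z.2 * z.2 + - (z.1 * z.1)) * ((nsq z)^-1 * (nsq z)^-1))
    (fun z => (- 2 * (z.1 * z.2)) * ((nsq z)^-1 * (nsq z)^-1))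
    (fun z => (z.1 * z.1 + - (z.2 * z.2)) * ((nsq z)^-1 * (nsq z)^-1)).

Lemma is_jet_ln z : z <> (0, 0) -> is_jet jln z.
Proof.
move=> z0; have q0 := nsq_gt0 z0; have qn0 : nsq z != 0 by rewrite gt_eqF.
have di : is_derive (nsq z) 1 (fun x : R => x^-1) (- (nsq z) ^- 2).
  by have := @is_deriveV R id (nsq z) 1 1 qn0 (is_derive_id _ _); rewrite /GRing.scale/= mulr1.
have dq := is_grad_comp (is_grad_nsq z) di.
have d1 := is_grad_fst z; have d2 := is_grad_snd z.
have cq := is_grad_continuous (is_gradM dq dq).
have c11 := is_grad_continuous (is_gradM d1 d1); have c22 := is_grad_continuous (is_gradM d2 d2).
have c12 := is_grad_continuous (is_gradM d1 d2).
split; split.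
- exact: is_grad_lnm.
- apply: (is_grad_eq (is_gradM d1 dq)); congr pair => /=;
    by rewrite /nsq in qn0 *; field.
- apply: (is_grad_eq (is_gradM d2 dq)); congr pair => /=;
    by rewrite /nsq in qn0 *; field.
- by apply: (@cvgM); [apply: cvgD; [exact: c22|apply: cvgN; exact: c11]|exact: cq].
- by apply: (@cvgM); [apply: cvgM; [exact: cvg_cst|exact: c12]|exact: cq].
- by apply: (@cvgM); [apply: cvgD; [exact: c11|apply: cvgN; exact: c22]|exact: cq].
Qed.

Lemma lap_ln z : lap jln z = 0.
Proof. by rewrite /lap /=; ring. Qed.

Lemma grad_ln z : z <> (0, 0) -> jx jln z ^+ 2 + jy jln z ^+ 2 = (nsq z)^-1.
Proof.
move=> /nsq_gt0 q0; rewrite /= !exprMn -mulrDl -/(nsq z) exprVn.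
by field; rewrite gt_eqF.
Qed.

Lemma euler_ln z : z <> (0, 0) -> euler jln z = 1.
Proof.
move=> /nsq_gt0 q0; rewrite /euler /= !mulrA -mulrDl -!expr2 -/(nsq z).
by rewrite divff// gt_eqF.
Qed.

(** [a + i b] is holomorphic at [z] with derivative [a' + i b']. *)
Definition holo (a b a' b' : R * R -> R) z : Prop :=
  is_grad a z (a' z, - b' z) /\ is_grad b z (b' z, a' z).

(** Real and imaginary parts of [z ^ s]. *)
Definition pc (s : R) z : R := expR (s * lnm z) * cos (s * arg z).
Definition ps (s : R) z : R := expR (s * lnm z) * sin (s * arg z).

Lemma expR_lnm z : z <> (0, 0) -> expR (lnm z) = modulus z.
Proof. by move=> z0; rewrite /lnm lnK// posrE modulus_gt0. Qed.

(** Division by [z], which turns the derivatives of [z ^ s] into powers again. *)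
Lemma pc_ps_div s z : z <> (0, 0) ->
  pc (s - 1) z = pc s z * (z.1 / nsq z) + ps s z * (z.2 / nsq z) /\
  ps (s - 1) z = ps s z * (z.1 / nsq z) - pc s z * (z.2 / nsq z).
Proof.
move=> z0; have r0 := modulus_gt0 z0.
rewrite /pc /ps !mulrDl !mulN1r expRD expRN expR_lnm// cosD sinD cosN sinN cos_arg// sin_arg//.
by rewrite -modulus_sq; split; field; rewrite gt_eqF.
Qed.

Lemma holo_pow s z : ~ pos_axis z ->
  holo (pc s) (ps s) (fun z => s * pc (s - 1) z) (fun z => s * ps (s - 1) z) z.
Proof.
move=> nz; have z0 := slit_neq0 nz; have [Ec Es] := pc_ps_div s z0.
have dr := is_gradM (is_grad_cst s z) (is_grad_lnm z0).
have dt := is_gradM (is_grad_cst s z) (is_grad_arg nz).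
have de := is_grad_comp dr (is_derive_expR _).
split.
- apply: (is_grad_eq (is_gradM de (is_grad_comp dt (is_derive_cos _)))).
  by rewrite Ec Es /pc /ps; congr pair => /=; ring.
- apply: (is_grad_eq (is_gradM de (is_grad_comp dt (is_derive_sin _)))).
  by rewrite Ec Es /pc /ps; congr pair => /=; ring.
Qed.

(** The jet of the real part of a holomorphic function, by the Cauchy-Riemann
    equations: [a' + i b'] and [a'' + i b''] are the complex derivatives. *)
Definition jet_of (a b a' b' a'' b'' : R * R -> R) : jet :=
  Jet a a' (fun z => - b' z) a'' (fun z => - b'' z) (fun z => - a'' z).

Lemma is_jet_of a b a' b' a'' b'' z : holo a b a' b' z -> holo a' b' a'' b'' z ->
  {for z, continuous a''} -> {for z, continuous b''} ->
  is_jet (jet_of a b a' b' a'' b'') z.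
Proof.
move=> [da _] [da' db'] ca cb; split; split => //=.
- exact: is_gradN db'.
- exact: cvgN.
- exact: cvgN.
Qed.

Lemma holo_continuous a b a' b' z : holo a b a' b' z ->
  {for z, continuous a} /\ {for z, continuous b}.
Proof. by move=> [/is_grad_continuous ? /is_grad_continuous ?]. Qed.

Lemma holo_scale c a b a' b' z : holo a b a' b' z ->
  holo (fun z => c * a z) (fun z => c * b z) (fun z => c * a' z) (fun z => c * b' z) z.
Proof.
move=> [da db]; split.
- by apply: (is_grad_eq (is_gradM (is_grad_cst c z) da)); congr pair => /=; ring.
- by apply: (is_grad_eq (is_gradM (is_grad_cst c z) db)); congr pair => /=; ring.
Qed.

Lemma holo_add a b a' b' c d c' d' z : holo a b a' b' z -> holo c d c' d' z ->
  holo (fun z => a z + c z) (fun z => b z + d z) (fun z => a' z + c' z) (fun z => b' z + d' z) z.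
Proof.
move=> [da db] [dc dd]; split.
- by apply: (is_grad_eq (is_gradD da dc)); congr pair => /=; ring.
- by apply: (is_grad_eq (is_gradD db dd)); congr pair => /=; ring.
Qed.

Definition jpow (s : R) : jet :=
  jet_of (pc s) (ps s) (fun z => s * pc (s - 1) z) (fun z => s * ps (s - 1) z)
    (fun z => s * ((s - 1) * pc (s - 1 - 1) z)) (fun z => s * ((s - 1) * ps (s - 1 - 1) z)).

Lemma is_jet_pow s z : ~ pos_axis z -> is_jet (jpow s) z.
Proof.
move=> nz; have [c2 s2] := holo_continuous (holo_pow (s - 1 - 1) nz).
apply: is_jet_of; [exact: holo_pow|exact: holo_scale (holo_pow _ nz)| |];
  by apply: cvgM; [exact: cvg_cst|apply: cvgM; [exact: cvg_cst|]].
Qed.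

(** [z ^ s * log z], real and imaginary parts. *)
Definition lc (s : R) z : R := pc s z * lnm z - ps s z * arg z.
Definition ls (s : R) z : R := pc s z * arg z + ps s z * lnm z.

Lemma holo_log s z : ~ pos_axis z -> holo (lc s) (ls s)
  (fun z => s * lc (s - 1) z + pc (s - 1) z) (fun z => s * ls (s - 1) z + ps (s - 1) z) z.
Proof.
move=> nz; have z0 := slit_neq0 nz; have [Ec Es] := pc_ps_div s z0.
have [dc ds] := holo_pow s nz.
have dr := is_grad_lnm z0; have dt := is_grad_arg nz.
split.
- apply: (is_grad_eq (is_gradD (is_gradM dc dr) (is_gradN (is_gradM ds dt)))).
  by rewrite /lc /ls Ec Es; congr pair => /=; ring.
- apply: (is_grad_eq (is_gradD (is_gradM dc dt) (is_gradM ds dr))).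
  by rewrite /lc /ls Ec Es; congr pair => /=; ring.
Qed.

Definition jlog (s : R) : jet :=
  jet_of (lc s) (ls s)
    (fun z => s * lc (s - 1) z + pc (s - 1) z) (fun z => s * ls (s - 1) z + ps (s - 1) z)
    (fun z => s * ((s - 1) * lc (s - 1 - 1) z + pc (s - 1 - 1) z) + (s - 1) * pc (s - 1 - 1) z)
    (fun z => s * ((s - 1) * ls (s - 1 - 1) z + ps (s - 1 - 1) z) + (s - 1) * ps (s - 1 - 1) z).

Lemma is_jet_log s z : ~ pos_axis z -> is_jet (jlog s) z.
Proof.
move=> nz; have [c2 s2] := holo_continuous (holo_pow (s - 1 - 1) nz).
have [c3 s3] := holo_continuous (holo_log (s - 1 - 1) nz).
apply: is_jet_of; [exact: holo_log|
  exact: (holo_add (holo_scale s (holo_log (s - 1) nz)) (holo_pow (s - 1) nz))| |];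
  (apply: cvgD; last (by apply: cvgM; [exact: cvg_cst|]);
   apply: cvgM; first exact: cvg_cst;
   apply: cvgD => //; apply: cvgM => //; exact: cvg_cst).
Qed.

Lemma lap_of a b a' b' a'' b'' z : lap (jet_of a b a' b' a'' b'') z = 0.
Proof. by rewrite /lap /= subrr. Qed.

Lemma euler_pow s z : z <> (0, 0) -> euler (jpow s) z = s * pc s z.
Proof.
move=> z0; have [Ec Es] := pc_ps_div s z0; have q0 := nsq_gt0 z0.
rewrite /euler /= Ec Es; transitivity (s * pc s z * ((z.1 ^+ 2 + z.2 ^+ 2) / nsq z)); first by ring.
by rewrite -/(nsq z) divff ?mulr1// gt_eqF.
Qed.

Lemma euler_log s z : z <> (0, 0) -> euler (jlog s) z = s * lc s z + pc s z.
Proof.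
move=> z0; have [Ec Es] := pc_ps_div s z0; have q0 := nsq_gt0 z0.
rewrite /euler /= /lc /ls Ec Es; rewrite -[X in _ = s * X + _]/(lc s z).
transitivity ((s * lc s z + pc s z) * ((z.1 ^+ 2 + z.2 ^+ 2) / nsq z)); first by rewrite /lc; ring.
by rewrite -/(nsq z) divff ?mulr1// gt_eqF.
Qed.

End Jets.

(** * Adjoint boundary conditions *)

Section Adjoint.
Context {R : realType}.
Implicit Types (z : R * R) (S : set (R * R)).

Definition bounded_on S (f : R * R -> R) : Prop := exists C, forall z, S z -> `|f z| <= C.

Lemma bounded_onD S f g : bounded_on S f -> bounded_on S g -> bounded_on S (fun z => f z + g z).
Proof.
move=> [C hC] [D hD]; exists (C + D) => z Sz.
by apply: le_trans (ler_normD _ _) _; rewrite lerD// ?hC ?hD.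
Qed.

Lemma bounded_onN S f : bounded_on S f -> bounded_on S (fun z => - f z).
Proof. by move=> [C hC]; exists C => z /hC; rewrite normrN. Qed.

Lemma bounded_onM S f g : bounded_on S f -> bounded_on S g -> bounded_on S (fun z => f z * g z).
Proof.
by move=> [C hC] [D hD]; exists (C * D) => z Sz; rewrite normrM ler_pM// ?hC ?hD.
Qed.

Lemma bounded_on_cst S c : bounded_on S (fun=> c).
Proof. by exists `|c|. Qed.

Lemma bounded_onS S T f : S `<=` T -> bounded_on T f -> bounded_on S f.
Proof. by move=> ST [C hC]; exists C => z /ST /hC. Qed.

Definition jet_bounded S (f : jet) : Prop :=
  [/\ bounded_on S (jv f), bounded_on S (jx f) & bounded_on S (jy f)] /\
  [/\ bounded_on S (jxx f), bounded_on S (jxy f) & bounded_on S (jyy f)].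

Lemma jet_bounded_cst S c : jet_bounded S (jcst c).
Proof. by split; split; exact: bounded_on_cst. Qed.

Definition upper : set (R * R) := [set z | 0 < z.2].
Definition lower : set (R * R) := [set z | z.2 < 0].
Definition annulus (d M : R) : set (R * R) := [set z | d <= modulus z <= M].

(** The boundary conditions adjoint to those of the potential: with them the
    fluxes of [f grad Phi - Phi grad f] through the two sides of the slit cancel
    where the potential passes, and vanish where it is reflected. *)
Record adjoint (p : R) (f : jet) : Prop := {
  adjoint_jet : forall z, ~ pos_axis z -> is_jet f z;
  adjoint_lap : forall z, ~ pos_axis z -> lap f z = 0;
  adjoint_trace : forall x : R, 0 < x -> exists l lx mx my : R,
    [/\ trace (jv f) upper (x, 0) l, trace (jx f) upper (x, 0) lx
      & trace (jy f) upper (x, 0) 0] /\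
    [/\ trace (jv f) lower (x, 0) (p * l), trace (jx f) lower (x, 0) mx
      & trace (jy f) lower (x, 0) my];
  adjoint_bounded : forall d M : R, 0 < d -> jet_bounded (~` pos_axis `&` annulus d M) f
}.

Lemma trace_near D f g z (l : R) : (\forall w \near z, D w -> f w = g w) ->
  trace f D z l -> trace g D z l.
Proof.
move=> fg; rewrite /trace => h; apply: cvg_trans h; apply: near_eq_cvg.
by rewrite /within /=; apply: filterS fg => w h /h.
Qed.

Lemma continuous_trace D (f : R * R -> R) z : {for z, continuous f} -> trace f D z (f z).
Proof. by move=> cf; apply: cvg_within_filter. Qed.

Lemma traceM D f g z (a b : R) : trace f D z a -> trace g D z b ->
  trace (fun z => f z * g z) D z (a * b).
Proof. exact: cvgM. Qed.

Lemma traceD D f g z (a b : R) : trace f D z a -> trace g D z b ->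
  trace (fun z => f z + g z) D z (a + b).
Proof. exact: cvgD. Qed.

Lemma traceN D f z (a : R) : trace f D z a -> trace (fun z => - f z) D z (- a).
Proof. exact: cvgN. Qed.

Lemma trace_cst D z (a : R) : trace (fun=> a) D z a.
Proof. exact: cvg_cst. Qed.
Arguments trace_cst : clear implicits.

Lemma trace_comp D f (h : R -> R) z (a : R) : {for a, continuous h} -> trace f D z a ->
  trace (fun z => h (f z)) D z (h a).
Proof. by move=> ch tf; exact: (continuous_cvg _ ch tf). Qed.

Lemma trace_eq D f z (a b : R) : trace f D z a -> a = b -> trace f D z b.
Proof. by move=> ? <-. Qed.

Lemma trace_sub D D' f z (a : R) : D' `<=` D -> trace f D z a -> trace f D' z a.
Proof.
move=> sD tf U /tf; rewrite !nbhs_simpl /within /= => h.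
by apply: filterS h => w h /sD; exact: h.
Qed.

Lemma arg_upper z : 0 < z.1 -> 0 < z.2 -> arg z = atan (z.2 / z.1).
Proof.
move=> z1 z2; have z0 : z <> (0, 0) by move=> h; rewrite h ltxx in z1.
have r0 := modulus_gt0 z0.
rewrite /arg (ltW z2); set a := acos _.
have ca : cos a = z.1 / modulus z by have := cos_arg z0; rewrite /arg (ltW z2).
have sa : sin a = z.2 / modulus z by have := sin_arg z0; rewrite /arg (ltW z2).
have h := ratio_itv z0; have a0 : 0 <= a by exact: acos_ge0.
have api : a <= pi by exact: acos_lepi.
have a2 : a < pi / 2.
  have p0 := pi_gt0 R; rewrite -ltr_cos ?in_itv/=; [|lra|lra].
  by rewrite cos_pihalf ca divr_gt0.
have -> : z.2 / z.1 = tan a by rewrite /tan sa ca; field; rewrite !gt_eqF.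
by rewrite tanK// in_itv/= a2 andbT; have := pi_gt0 R; lra.
Qed.

Lemma arg_lower z : 0 < z.1 -> z.2 < 0 -> arg z = 2 * pi + atan (z.2 / z.1).
Proof.
move=> z1 z2; have := @arg_upper (z.1, - z.2) z1; rewrite /= oppr_gt0 => /(_ z2).
rewrite mulNr atanN /arg /= oppr_ge0 (ltW z2) leNgt z2 /=.
by rewrite /modulus /= sqrrN => ->; rewrite opprK.
Qed.

Lemma trace_ratio D (x : R) : 0 < x -> trace (fun z => atan (z.2 / z.1)) D (x, 0) 0.
Proof.
move=> x0; have c : {for ((x, 0) : R * R), continuous (fun z : R * R => z.2 / z.1)}.
  apply: (@cvgM); first exact: cvg_snd.
  by apply: cvgV; [rewrite /= gt_eqF|exact: cvg_fst].
have t : trace (fun z : R * R => z.2 / z.1) D (x, 0) 0.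
  by apply: (trace_eq (continuous_trace _ c)); rewrite /= mul0r.
by apply: (trace_eq (trace_comp (@continuous_atan R 0) t)); rewrite atan0.
Qed.

Lemma near_right (x : R) : 0 < x -> \forall w \near ((x, 0) : R * R), 0 < w.1.
Proof.
move=> x0; have h : {for ((x, 0) : R * R), continuous (fst : R * R -> R)} by exact: cvg_fst.
by move/cvgr_gt : h => /(_ _ x0).
Qed.

Lemma trace_arg_upper (x : R) : 0 < x -> trace arg upper (x, 0) 0.
Proof.
move=> x0; apply: trace_near (trace_ratio _ x0).
by apply: filterS (near_right x0) => w w1 w2; rewrite arg_upper.
Qed.

Lemma trace_arg_lower (x : R) : 0 < x -> trace arg lower (x, 0) (2 * pi).
Proof.
move=> x0; apply: (@trace_near _ (fun z => 2 * pi + atan (z.2 / z.1))).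
  by apply: filterS (near_right x0) => w w1 w2; rewrite arg_lower.
by apply: (trace_eq (traceD (trace_cst _ _ _) (trace_ratio _ x0))); rewrite addr0.
Qed.

Section TraceOfPowers.
Variables (D : set (R * R)) (x t : R).
Hypotheses (x0 : 0 < x) (ht : trace arg D (x, 0) t).

Lemma trace_lnm : trace lnm D (x, 0) (ln x).
Proof.
have z0 : ((x, 0) : R * R) <> (0, 0) by case=> h; move: x0; rewrite h ltxx.
apply: (trace_eq (continuous_trace _ (is_grad_continuous (is_grad_lnm z0)))).
by rewrite /lnm /modulus /= expr0n /= addr0 sqrtr_sqr gtr0_norm.
Qed.

Lemma trace_pow s : trace (pc s) D (x, 0) (expR (s * ln x) * cos (s * t)) /\
  trace (ps s) D (x, 0) (expR (s * ln x) * sin (s * t)).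
Proof.
have te : trace (fun z => expR (s * lnm z)) D (x, 0) (expR (s * ln x)).
  apply: (@trace_comp _ _ expR); first exact: continuous_expR.
  exact: traceM (trace_cst _ _ _) trace_lnm.
have tt := traceM (trace_cst D (x, 0) s) ht.
by split; apply: traceM => //; apply: trace_comp => //; [exact: continuous_cos|exact: continuous_sin].
Qed.

Lemma trace_log s :
  trace (lc s) D (x, 0) (expR (s * ln x) * cos (s * t) * ln x - expR (s * ln x) * sin (s * t) * t) /\
  trace (ls s) D (x, 0) (expR (s * ln x) * cos (s * t) * t + expR (s * ln x) * sin (s * t) * ln x).
Proof.
have [c s'] := trace_pow s; split.
  exact: (traceD (traceM c trace_lnm) (traceN (traceM s' ht))).
exact: (traceD (traceM c ht) (traceM s' trace_lnm)).
Qed.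

End TraceOfPowers.

Section BoundOfPowers.
Variables (d M : R).
Hypothesis d0 : 0 < d.
Let S : set (R * R) := ~` pos_axis `&` annulus d M.

Lemma bounded_lnm : bounded_on S lnm.
Proof.
exists (`|ln d| + `|ln M|) => z [_ /andP[h1 h2]].
have r0 := lt_le_trans d0 h1; have M0 := lt_le_trans r0 h2.
have l1 : ln d <= lnm z by rewrite ler_ln.
have l2 : lnm z <= ln M by rewrite ler_ln.
rewrite ler_norml; have := ler_norm (- ln d); have := ler_norm (ln M); rewrite normrN.
have := normr_ge0 (ln d); have := normr_ge0 (ln M); lra.
Qed.

Lemma bounded_pow s : bounded_on S (pc s) /\ bounded_on S (ps s).
Proof.
have [C hC] := bounded_lnm.
have E z : S z -> expR (s * lnm z) <= expR (`|s| * C).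
  move=> /hC h; rewrite ler_expR; apply: le_trans (ler_norm _) _.
  by rewrite normrM ler_pM.
split; exists (expR (`|s| * C)) => z Sz; rewrite normrM (ger0_norm (expR_ge0 _));
  apply: le_trans (E z Sz); rewrite ler_piMr ?expR_ge0//.
- by rewrite ler_norml cos_geN1 cos_le1.
- by rewrite ler_norml sin_geN1 sin_le1.
Qed.

Lemma bounded_arg : bounded_on S arg.
Proof.
exists (2 * pi) => z [/slit_neq0 /arg_itv h _]; rewrite ler_norml; have := pi_ge0 R; lra.
Qed.

Lemma bounded_log s : bounded_on S (lc s) /\ bounded_on S (ls s).
Proof.
have [c s'] := bounded_pow s; have l := bounded_lnm; have a := bounded_arg.
split; first by apply: bounded_onD; [apply: bounded_onM|apply: bounded_onN; apply: bounded_onM].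
by apply: bounded_onD; apply: bounded_onM.
Qed.

End BoundOfPowers.

(** The argument tends to [0] above the slit and to [2 pi] below it, so the two
    values of [Re (z ^ s)] have the ratio [cos (2 pi s)], while its normal
    derivative above is a multiple of [sin 0]. *)
Lemma adjoint_pow p s : cos (s * (2 * pi)) = p -> adjoint p (jpow s).
Proof.
move=> hp; split.
- exact: is_jet_pow.
- by move=> z _; exact: lap_of.
- move=> x x0; have u := trace_pow x0 (trace_arg_upper x0); have l := trace_pow x0 (trace_arg_lower x0).
  exists (expR (s * ln x)); do 3 eexists; split; split.
  + by apply: (trace_eq (u s).1); rewrite mulr0 cos0 mulr1.
  + exact: traceM (trace_cst _ _ _) (u (s - 1)).1.
  + apply: (trace_eq (traceN (traceM (trace_cst _ _ s) (u (s - 1)).2))).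
    by rewrite mulr0 sin0 !mulr0 oppr0.
  + by apply: (trace_eq (l s).1); rewrite hp mulrC.
  + exact: traceM (trace_cst _ _ _) (l (s - 1)).1.
  + exact: traceN (traceM (trace_cst _ _ s) (l (s - 1)).2).
- move=> d M d0; have c s := bounded_on_cst (~` pos_axis `&` annulus d M) s.
  have b t := bounded_pow M d0 t.
  split; split => /=; repeat first [exact: (b _).1|exact: (b _).2|exact: c|
    apply: bounded_onN|apply: bounded_onM].
Qed.

(** The term of [Re (z ^ n log z)] that sees the argument carries the factor
    [sin (2 pi n) = 0], so for an integer exponent both sides agree. *)
Lemma adjoint_log (n : nat) : adjoint 1 (jlog n%:R).
Proof.
split.
- exact: is_jet_log.
- by move=> z _; exact: lap_of.
- move=> x x0; have u := trace_log x0 (trace_arg_upper x0); have l := trace_log x0 (trace_arg_lower x0).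
  have v := trace_pow x0 (trace_arg_upper x0); have w := trace_pow x0 (trace_arg_lower x0).
  exists (expR (n%:R * ln x) * ln x); do 3 eexists; split; split.
  + by apply: (trace_eq (u n%:R).1); rewrite mulr0 cos0 mulr1 sin0 !mulr0 subr0.
  + exact: traceD (traceM (trace_cst _ _ _) (u (n%:R - 1)).1) (v (n%:R - 1)).1.
  + apply: (trace_eq (traceN (traceD (traceM (trace_cst _ _ n%:R) (u (n%:R - 1)).2) (v (n%:R - 1)).2))).
    by rewrite !(mulr0, sin0, mul0r, addr0, oppr0).
  + apply: (trace_eq (l n%:R).1).
    have [-> ->] : cos (n%:R * (2 * pi)) = 1 :> R /\ sin (n%:R * (2 * pi)) = 0 :> R.
      have -> : n%:R * (2 * pi) = 0 + (pi *+ 2) *+ n :> R.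
        by rewrite add0r !mulr_natl.
      by rewrite (periodicn (@cosD2pi R)) (periodicn (@sinD2pi R)) cos0 sin0.
    by rewrite mulr1 mulr0 mul0r subr0 mul1r.
  + exact: traceD (traceM (trace_cst _ _ _) (l (n%:R - 1)).1) (w (n%:R - 1)).1.
  + exact: traceN (traceD (traceM (trace_cst _ _ n%:R) (l (n%:R - 1)).2) (w (n%:R - 1)).2).
- move=> d M d0; have c s := bounded_on_cst (~` pos_axis `&` annulus d M) s.
  have b t := bounded_pow M d0 t; have b' t := bounded_log M d0 t.
  split; split => /=; repeat first [exact: (b _).1|exact: (b _).2|exact: (b' _).1|exact: (b' _).2|exact: c|
    apply: bounded_onN|apply: bounded_onM|apply: bounded_onD].
Qed.

End Adjoint.

(** * Regular arcs as graphs *)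

Section CurveGraph.
Context {R : realType}.
Implicit Types (u v : R -> R).

Lemma derive_continuous u (t d : R) : is_derive t 1 u d -> {for t, continuous u}.
Proof. by move=> h; apply: differentiable_continuous; apply/derivable1_diffP. Qed.

Lemma derive_mvt u u' (s t : R) : s < t -> (forall r, s <= r <= t -> is_derive r 1 u (u' r)) ->
  exists2 r, s < r < t & u t - u s = u' r * (t - s).
Proof.
move=> st du; have [||r] := @MVT R u u' s t st.
- by move=> r; rewrite in_itv/= => /andP[/ltW a /ltW b]; apply: du; rewrite a b.
- apply: continuous_in_subspaceT => r /set_mem; rewrite /= in_itv/= => h.
  exact: derive_continuous (du r h).
by rewrite in_itv/=; exists r.
Qed.

(** Where [u'] is not zero the abscissa [u] is strictly monotone, and the arc is
    the graph of [v] composed with the inverse of [u]. *)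
Lemma curve_graph u v u' v' (t0 eta : R) : 0 < eta ->
  (forall t, `|t - t0| < eta -> is_derive t 1 u (u' t)) ->
  (forall t, `|t - t0| < eta -> is_derive t 1 v (v' t)) ->
  (forall t, `|t - t0| < eta -> {for t, continuous u'}) ->
  (forall t, `|t - t0| < eta -> {for t, continuous v'}) ->
  u' t0 != 0 ->
  exists eta' r : R, exists g g' : R -> R,
    [/\ 0 < eta' <= eta, 0 < r,
        (forall t, `|t - t0| < eta' -> g (u t) = v t),
        (forall x, `|x - u t0| < r -> is_derive x 1 g (g' x) /\ {for x, continuous g'})
      & (forall x, `|x - u t0| < r -> exists t,
          [/\ `|t - t0| < eta', u t = x, u' t != 0 & g' x = v' t / u' t])].
Proof.
move=> eta0 du dv cu' cv' u0.
have tt0 : `|t0 - t0| < eta by rewrite subrr normr0.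
have [e1 e10 he1] : exists2 e1 : R, 0 < e1 & forall t, `|t - t0| < e1 -> `|u' t - u' t0| < `|u' t0|.
  have nu : 0 < `|u' t0| by rewrite normr_gt0.
  have := cu' t0 tt0 => /cvgrPdist_lt /(_ _ nu) /nbhs_ballP[e /= e0 he]; exists e => // t h.
  by rewrite distrC; apply: he; rewrite /ball/= distrC.
pose eta' := Num.min e1 eta.
have eta'0 : 0 < eta' by rewrite lt_min e10.
have lt1 t : `|t - t0| < eta' -> `|t - t0| < eta by rewrite lt_min => /andP[].
have usgn t : `|t - t0| < eta' -> 0 < u' t * u' t0.
  rewrite lt_min => /andP[/he1 h _]; have := u0; rewrite neq_lt => /orP[n|p].
    by rewrite nmulr_rgt0//; move: h; rewrite (ltr0_norm n) ltr_distl; lra.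
  by rewrite pmulr_lgt0//; move: h; rewrite (gtr0_norm p) ltr_distl; lra.
have une t : `|t - t0| < eta' -> u' t != 0.
  by move=> /usgn; apply: contraTneq => ->; rewrite mul0r ltxx.
have inc s t : `|s - t0| < eta' -> `|t - t0| < eta' -> s < t -> 0 < (u t - u s) * u' t0.
  move=> hs ht st.
  have btw r : s <= r <= t -> `|r - t0| < eta'.
    by move: hs ht; rewrite !ltr_distl; lra.
  have [r rst ->] := @derive_mvt u u' s t st (fun r h => du r (lt1 r (btw r h))).
  have := usgn r (btw r ltac:(lra)); rewrite mulrAC => h; rewrite mulr_gt0// subr_gt0//.
have inj s t : `|s - t0| < eta' -> `|t - t0| < eta' -> u s = u t -> s = t.
  move=> hs ht E; have [st|ts|//] := ltgtP s t.
    by have := inc s t hs ht st; rewrite E subrr mul0r ltxx.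
  by have := inc t s ht hs ts; rewrite E subrr mul0r ltxx.
pose inv x : R := xget t0 [set t | `|t - t0| < eta' /\ u t = x].
have invK t : `|t - t0| < eta' -> inv (u t) = t.
  move=> ht; rewrite /inv; case: xgetP => [s _ [hs E]|/(_ t)]; first exact: inj.
  by case.
pose h := eta' / 2.
have h0 : 0 < h by rewrite /h; lra.
have hl : `|t0 - h - t0| < eta' by rewrite addrAC subrr add0r normrN gtr0_norm// /h; lra.
have hr : `|t0 + h - t0| < eta' by rewrite addrAC subrr add0r gtr0_norm// /h; lra.
have t0e : `|t0 - t0| < eta' by rewrite subrr normr0.
have p1 := inc (t0 - h) t0 hl t0e ltac:(lra).
have p2 := inc t0 (t0 + h) t0e hr ltac:(lra).
pose r := Num.min `|u t0 - u (t0 - h)| `|u (t0 + h) - u t0|.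
have r0 : 0 < r.
  rewrite lt_min !normr_gt0; apply/andP; split.
    by apply: contraTneq p1 => ->; rewrite mul0r ltxx.
  by apply: contraTneq p2 => ->; rewrite mul0r ltxx.
have surj x : `|x - u t0| < r -> exists2 t, `|t - t0| < eta' & u t = x.
  move=> hx.
  have [t] : exists2 t, t \in `[t0 - h, t0 + h] & u t = x.
    apply: IVT; first by lra.
      apply: continuous_in_subspaceT => t /set_mem; rewrite /= in_itv/= => ht.
      by apply: derive_continuous (du t _); apply: lt1; rewrite ltr_distl /h in ht *; lra.
    rewrite ge_min le_max; move: hx; rewrite lt_min => /andP[].
    rewrite !ltr_norml; have := u0; rewrite neq_lt => /orP[n|p].
      have q1 : u t0 - u (t0 - h) < 0 by rewrite -(nmulr_lgt0 _ n).
      have q2 : u (t0 + h) - u t0 < 0 by rewrite -(nmulr_lgt0 _ n).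
      rewrite (ltr0_norm q1) (ltr0_norm q2) => /andP[a1 a2] /andP[b1 b2].
      by apply/andP; split; apply/orP; [right|left]; lra.
    have q1 : 0 < u t0 - u (t0 - h) by rewrite -(pmulr_lgt0 _ p).
    have q2 : 0 < u (t0 + h) - u t0 by rewrite -(pmulr_lgt0 _ p).
    rewrite (gtr0_norm q1) (gtr0_norm q2) => /andP[a1 a2] /andP[b1 b2].
    by apply/andP; split; apply/orP; [left|right]; lra.
  rewrite in_itv/= => ht E; exists t => //.
  by rewrite ltr_distl; rewrite /h in ht; lra.
have nearI t : `|t - t0| < eta' -> \forall s \near t, `|s - t0| < eta'.
  move=> ht; have c : {for t, continuous (fun s : R => `|s - t0|)}.
    by apply: cvg_norm; apply: cvgB; [exact: cvg_id|exact: cvg_cst].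
  by move/cvgr_lt : c => /(_ _ ht).
have dinv t : `|t - t0| < eta' -> is_derive (u t) 1 inv (u' t)^-1.
  move=> ht; apply: is_derive_inverse.
  - by apply: filterS (nearI t ht) => s; exact: invK.
  - by apply: filterS (nearI t ht) => s hs; apply: derive_continuous (du s (lt1 s hs)).
  - exact: du (lt1 t ht).
  - exact: une.
exists eta', r, (fun x => v (inv x)), (fun x => v' (inv x) / u' (inv x)); split => //.
- by rewrite eta'0 /eta' ge_min lexx orbT.
- by move=> t ht; rewrite invK.
- move=> x /surj[t ht <-]; have it := invK t ht.
  have di := dinv t ht; have dvi : is_derive (inv (u t)) 1 v (v' t) by rewrite it; exact: dv (lt1 t ht).
  split.
    by have := @is_derive1_comp R v inv (u t) _ _ dvi di; rewrite it.
  have ci : {for u t, continuous inv} := derive_continuous di.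
  apply: (@cvgM).
    by apply: (@continuous_comp _ _ _ inv v') => //; rewrite it; exact: cv' (lt1 t ht).
  apply: cvgV; first by rewrite it une.
  by apply: (@continuous_comp _ _ _ inv u') => //; rewrite it; exact: cu' (lt1 t ht).
- move=> x /surj[t ht <-]; exists t; split => //; first exact: une.
  by rewrite (invK t ht).
Qed.

End CurveGraph.

(** * Topology of the slit region *)

Section SlitTopology.
Context {R : realType}.
Variables (a b : R) (W : set (R * R)) (c : R -> R * R) (E : seq R).
Hypothesis SR : slit_region a b W c E.

Let lt00 : (0 : R) < 0 -> False. Proof. by rewrite ltxx. Qed.
Let ab : 0 < a < b := region_slit SR.
Let a0 : 0 < a. Proof. by case/andP: ab. Qed.
Let a_lt_b : a < b. Proof. by case/andP: ab. Qed.
Ltac clra := intros; have := a0; have := a_lt_b; intros; exfalso; apply: lt00; lra.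
Let ar := region_curve SR.
Let Wopen := region_open SR.
Let IW : interior W = W. Proof. exact/interior_id. Qed.

Lemma region_frontier z : closure W z -> ~ W z ->
  (exists2 t, 0 <= t <= 1 & z = c t) \/ (a <= z.1 <= b /\ z.2 = 0).
Proof.
move=> cz nW; have : (closure W `\` interior W) z.
  by split => // /interior_subset.
rewrite (region_boundary SR) => -[[t /= + <-]|]; last by right.
by rewrite in_itv/= => ht; left; exists t.
Qed.

Lemma curve_outside (t : R) : 0 <= t <= 1 -> closure W (c t) /\ ~ W (c t).
Proof.
move=> ht; have : (closure W `\` interior W) (c t).
  by rewrite (region_boundary SR); left; exists t => //=; rewrite in_itv.
by rewrite IW => -[].
Qed.

Lemma segment_outside (x : R) : a <= x <= b -> closure W (x, 0) /\ ~ W (x, 0).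
Proof.
move=> hx; have : (closure W `\` interior W) (x, 0) by rewrite (region_boundary SR); right.
by rewrite IW.
Qed.

Lemma curve_neq0 (t : R) : 0 <= t <= 1 -> c t <> (0, 0).
Proof. by move=> /curve_outside[_ h] ct; apply: h; rewrite ct; exact: region_origin SR. Qed.

(** Strictly between its ends the angle lies in [(0, 2 pi)], where no positive
    multiple of [(cos, sin)] is on the positive half-axis. *)
Lemma curve_off_axis (t : R) : 0 < t < 1 -> ~ pos_axis (c t).
Proof.
move=> ht [c1 c2]; have [theta [_ _ _ h1 h2]] := around_angle ar.
have ht' : 0 <= t <= 1 by lra.
have r0 := modulus_gt0 (curve_neq0 ht').
have th := h1 t ht; have Et := h2 t ht'.
have s0 : sin (theta t) = 0.
  by move: c2; rewrite Et /= => /eqP; rewrite mulf_eq0 gt_eqF//= => /eqP.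
have c0 : 0 <= cos (theta t) by move: c1; rewrite Et /= pmulr_rge0.
have [tp|tp|tp] := ltgtP (theta t) pi.
- have : 0 < sin (theta t) by apply: sin_gt0_pi; lra.
  by rewrite s0 ltxx.
- have : 0 < sin (theta t - pi) by apply: sin_gt0_pi; lra.
  by have := sinDpi (theta t - pi); rewrite subrK s0 => /eqP; rewrite eq_sym oppr_eq0 => /eqP ->; rewrite ltxx.
- by move: c0; rewrite tp cospi; clra.
Qed.

Lemma curve_starts_above : exists2 t0 : R, 0 < t0 <= 1 & forall t, 0 < t < t0 -> 0 < (c t).2.
Proof.
have [theta [ct th0 _ h1 h2]] := around_angle ar.
have cth : theta @ within `[0, 1] (nbhs (0 : R)) --> (0 : R).
  rewrite -[X in _ --> X]th0; apply: (subspace_continuousP _ _).1 ct 0 _.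
  by rewrite /= in_itv/= lexx ler01.
move/cvgr_lt : cth => /(_ pi (pi_gt0 R)).
move=> /nbhs_ballP[e /= e0 he]; exists (Num.min e 1).
  by rewrite lt_min e0 ltr01 ge_min lexx orbT.
move=> t /andP[t0]; rewrite lt_min => /andP[te t1].
have ht : 0 < t < 1 by rewrite t0.
have ht' : 0 <= t <= 1 by lra.
have tp : theta t < pi.
  apply: he; first by rewrite /ball/= sub0r normrN gtr0_norm.
  by rewrite /= in_itv.
rewrite h2//= mulr_gt0 ?modulus_gt0//; first exact: curve_neq0.
by apply: sin_gt0_pi; have := h1 t ht; lra.
Qed.

(** A connected set that meets the region and avoids its frontier stays in it:
    its trace on the region is both relatively open and relatively closed. *)
Lemma connected_in_region (C : set (R * R)) : connected C -> C `&` W !=set0 ->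
  (forall z, C z -> closure W z -> W z) -> C `<=` W.
Proof.
move=> cC CW h.
have CE : C `&` W = C `&` closure W.
  apply/seteqP; split => z [Cz Wz]; split => //; [exact: subset_closure|exact: h].
have E2 : C `&` W = C.
  apply: cC => //; first by exists W.
  by exists (closure W); [exact: closed_closure|rewrite CE].
by rewrite -E2 => z [].
Qed.

Lemma connected_path (f : R -> R * R) (I : set R) : is_interval I ->
  (forall t, {for t, continuous f}) -> connected (f @` I).
Proof.
move=> /connected_intervalP cI cf; apply: connected_continuous_connected => //.
by apply: continuous_subspaceT.
Qed.

Lemma hline_continuous y t : {for t, continuous (fun x : R => (x, y) : R * R)}.
Proof. by apply: continuous_pair; [exact: cvg_id|exact: cvg_cst]. Qed.

Lemma vline_continuous x t : {for t, continuous (fun y : R => (x, y) : R * R)}.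
Proof. by apply: continuous_pair; [exact: cvg_cst|exact: cvg_id]. Qed.

Lemma hsegment_in_region (y x1 x2 : R) : W (x1, y) ->
  (forall x : R, x1 <= x <= x2 -> closure W (x, y) -> W (x, y)) ->
  forall x : R, x1 <= x <= x2 -> W (x, y).
Proof.
move=> W1 h x hx; pose C := (fun x : R => (x, y) : R * R) @` `[x1, x2].
have x12 : x1 <= x2 by lra.
apply: (@connected_in_region C); last by exists x => //=; rewrite in_itv.
- by apply: connected_path; [exact: interval_is_interval|exact: hline_continuous].
- by exists (x1, y); split => //; exists x1 => //=; rewrite in_itv/= lexx.
- by move=> _ [s /= + <-]; rewrite in_itv/=; exact: h.
Qed.

Lemma vsegment_in_region (x y1 y2 : R) : W (x, y1) ->
  (forall y : R, y1 <= y <= y2 -> closure W (x, y) -> W (x, y)) ->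
  forall y : R, y1 <= y <= y2 -> W (x, y).
Proof.
move=> W1 h y hy; pose C := (fun y : R => (x, y) : R * R) @` `[y1, y2].
have y12 : y1 <= y2 by lra.
apply: (@connected_in_region C); last by exists y => //=; rewrite in_itv.
- by apply: connected_path; [exact: interval_is_interval|exact: vline_continuous].
- by exists (x, y1); split => //; exists y1 => //=; rewrite in_itv/= lexx.
- by move=> _ [s /= + <-]; rewrite in_itv/=; exact: h.
Qed.

Lemma region_bound : exists2 M : R, 0 < M & forall z, W z -> `|z.1| < M /\ `|z.2| < M.
Proof.
have [M [_ hM]] := region_bounded SR; exists (`|M| + 2); first by rewrite ltr_wpDl.
move=> z Wz; have h := hM (`|M| + 1) ltac:(by rewrite ltr_pwDr// ler_norm) z Wz.
have : `|z.1| <= `|z| /\ `|z.2| <= `|z|.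
  by rewrite prod_normE !le_max !lexx orbT.
by move=> [h1 h2]; split; [apply: le_lt_trans h1 _|apply: le_lt_trans h2 _];
  apply: le_lt_trans h _; rewrite ltrD2l ltr1n.
Qed.

Lemma axis_frontier (y : R) : 0 <= y -> closure W (y, 0) -> ~ W (y, 0) -> a <= y <= b.
Proof.
move=> y0 cW nW; case: (region_frontier cW nW) => [[t ht E']|[/= h _]] //.
have [t0|t0] := ltrP 0 t; last first.
  have t00 : t = 0 by lra.
  move: E'; rewrite t00 (around_start ar) => -[yb].
  by rewrite yb lexx ltW.
have [t1|t1] := ltrP t 1; last first.
  have t11 : t = 1 by lra.
  move: E'; rewrite t11 (around_end ar) => -[ya].
  by rewrite ya lexx ltW.
exfalso; apply: (@curve_off_axis t); first by rewrite t0.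
by rewrite -E'.
Qed.

Lemma axis_in_region (x : R) : 0 <= x < a -> W (x, 0).
Proof.
move=> hx; apply: (@hsegment_in_region 0 0 x); [exact: region_origin SR| |lra].
move=> y hy cW; apply: contrapT => nW.
by have := @axis_frontier y ltac:(lra) cW nW; clra.
Qed.

(** Otherwise the whole ray would lie in the region, which is bounded. *)
Lemma ray_outside (x : R) : b < x -> ~ closure W (x, 0).
Proof.
have out (y : R) : b < y -> closure W (y, 0) -> W (y, 0).
  move=> hy cW; apply: contrapT => nW.
  have y0 : 0 <= y by rewrite (le_trans _ (ltW hy))// (le_trans (ltW a0))// ltW.
  by have := axis_frontier y0 cW nW; clra.
move=> hx /(out x hx) Wx.
have [M M0 hM] := region_bound.
have : W (x + M, 0).
  by apply: (@hsegment_in_region 0 x (x + M)) => // [y hy|]; [apply: out; lra|lra].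
by move=> /hM[/= + _]; rewrite ltr_norml => h; clra.
Qed.

(** From just below the outer part of the slit one reaches the far end of the
    real axis without crossing the frontier: the curve leaves [(b, 0)] upwards. *)
Lemma below_slit (x0 : R) : a < x0 < b -> exists2 d : R, 0 < d &
  forall z, `|z.1 - x0| < d -> - d < z.2 < 0 -> ~ W z.
Proof.
move=> hx0.
have [t0 ht0 ab0] := curve_starts_above.
pose x1 := (a + x0) / 2.
pose g t := Num.max `|(c t).2| (Num.max (x1 - (c t).1) ((c t).1 - b)).
have [t0p t0le] : 0 < t0 /\ t0 <= 1 by case/andP: ht0.
have [d d0 hd] : exists2 d : R, 0 < d & forall t, t0 <= t <= 1 -> d <= g t.
  have cg : {within `[t0, 1], continuous g}.
    have cc : {within `[t0, 1], continuous c}.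
      apply: continuous_subspaceW (around_continuous ar) => t /=.
      by rewrite !in_itv/=; lra.
    pose G (z : R * R) := Num.max `|z.2| (Num.max (x1 - z.1) (z.1 - b)).
    have cG z : {for z, continuous G}.
      have c1 : {for z, continuous (fst : R * R -> R)} by exact: cvg_fst.
      have c2 : {for z, continuous (snd : R * R -> R)} by exact: cvg_snd.
      apply: continuous_max; first by apply: (@cvg_norm); exact: c2.
      apply: continuous_max; first by apply: cvgB; [exact: cvg_cst|exact: c1].
      by apply: cvgB; [exact: c1|exact: cvg_cst].
    apply/subspace_continuousP => t At; have h := (subspace_continuousP _ _).1 cc t At.
    exact: (cvg_comp _ G h (cG (c t))).
  have [t] := EVT_min t0le cg.
  rewrite in_itv/= => ht hmin; exists (g t); last first.
    by move=> s hs; apply: hmin; rewrite in_itv.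
  rewrite ltNge; apply/negP; rewrite /g !ge_max normr_le0 => /and3P[/eqP c2 h1 h2].
  have x1a : a < x1 by rewrite /x1; lra.
  have [t1|t1] := ltrP t 1; last first.
    have t11 : t = 1 by lra.
    by move: h1; rewrite t11 (around_end ar) /= => h1; clra.
  apply: (@curve_off_axis t); first by lra.
  by have := a0; split => //=; lra.
pose e := Num.min (d / 2) (Num.min (x0 - x1) (b - x0)).
have ed : e <= d / 2 by rewrite ge_min lexx.
have x1lt : a < x1 < x0 by rewrite /x1; lra.
exists e => [|z hz1 hz2 Wz].
  by rewrite !lt_min; apply/and3P; split; lra.
move: hz1; rewrite !lt_min !ltr_distl => /and3P[/andP[z1 z2] /andP[z3 z4] /andP[z5 z6]].
have [zd1 zd2] : - (d / 2) < z.2 /\ z.2 < 0.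
  by case/andP: hz2 => h h'; split => //; apply: le_lt_trans h; rewrite lerN2.
have [M M0 hM] := region_bound.
have out (p : R * R) : x1 < p.1 < b + d -> - (d / 2) < p.2 <= 0 -> (p.2 = 0 -> b < p.1) -> closure W p -> W p.
  move=> hp1 hp2 hp3 cW; apply: contrapT => nW.
  case: (region_frontier cW nW) => [[t ht E']|[/= h h']]; last by have := hp3 h' => h''; clra.
  have [tt|tt] := ltrP t t0; last first.
    have := hd t ltac:(lra); rewrite /g -E' !le_max => /or3P[|h|h]; [|clra|clra].
    by rewrite ler0_norm; [move=> h; clra|lra].
  have [t00|t00] := ltrP 0 t.
    by have := ab0 t ltac:(lra); rewrite -E' => h; clra.
  have t0E : t = 0 by lra.
  move: E'; rewrite t0E (around_start ar) => E'.
  by have := hp3; rewrite E' /= => /(_ erefl); rewrite ltxx.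
have W1 : W (b + d / 2, z.2).
  apply: (@hsegment_in_region z.2 z.1 (b + d / 2)); last by lra.
    by rewrite -surjective_pairing.
  by move=> x hx; apply: out => /=; [lra|lra|move=> h; clra].
have W2 : W (b + d / 2, 0).
  apply: (@vsegment_in_region (b + d / 2) z.2 0) => //; last by lra.
  by move=> y hy; apply: out => /=; [lra|lra|move=> _; lra].
by apply: (@ray_outside (b + d / 2)); [lra|exact: subset_closure].
Qed.

End SlitTopology.

(** * Vector fields near the boundary *)

Section BoundaryPoints.
Context {R : realType}.
Local Notation mR := (measurableTypeR R).
Local Notation mR2 := (measurableTypeR R * measurableTypeR R)%type.
Implicit Types (P z w : R * R).

(** [Vij] stands for the derivative of [Vi] in the [j]-th variable and [Vd] for
    the divergence; off the smooth points they are arbitrary. *)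
Record field := Field { V1 : R * R -> R; V2 : R * R -> R;
  V11 : R * R -> R; V12 : R * R -> R; V21 : R * R -> R; V22 : R * R -> R;
  Vd : R * R -> R }.

Definition smooth_at (X : field) z : Prop :=
  [/\ is_grad (V1 X) z (V11 X z, V12 X z), is_grad (V2 X) z (V21 X z, V22 X z)
    & Vd X z = V11 X z + V22 X z] /\
  [/\ {for z, continuous (V11 X)}, {for z, continuous (V12 X)},
      {for z, continuous (V21 X)} & {for z, continuous (V22 X)}].

Definition measurable_field (X : field) : Prop :=
  [/\ measurable_fun setT (V1 X : mR2 -> mR), measurable_fun setT (V2 X : mR2 -> mR)
    & measurable_fun setT (Vd X : mR2 -> mR)].

Definition bounded_field (X : field) P : Prop := exists2 r : R, 0 < r & exists C, forall z,
  in_box P r z -> [/\ `|V1 X z| <= C, `|V2 X z| <= C & `|Vd X z| <= C].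

Definition solenoidal_at (X : field) P : Prop := weak_divergence (V1 X) (V2 X) (Vd X) P.

Lemma vanishing_solenoidal X P (r : R) : 0 < r ->
  (forall z, in_box P r z -> [/\ V1 X z = 0, V2 X z = 0 & Vd X z = 0]) -> solenoidal_at X P.
Proof.
move=> r0 h; exists r => // phi sphi.
have E : weak_form (V1 X) (V2 X) (Vd X) phi = cst 0.
  apply/funext => z; rewrite /weak_form /=.
  have [/h[-> -> ->]|/sphi[-> -> ->]] := EM (in_box P r z); rewrite ?mulr0 ?mul0r !addr0 //.
rewrite /null_against E; split; first exact: integrable0.
exact: integral0.
Qed.

(** Near a point of the slit the graph is the axis itself, and the jump is that
    of the vertical component. *)
Lemma axis_solenoidal X P (r : R) : 0 < r -> measurable_field X -> bounded_field X P ->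
  (forall z, in_box P r z -> z.2 != P.2 -> smooth_at X z) ->
  (forall x : R, `|x - P.1| < r -> forall eta : R, 0 < eta -> exists2 delta : R, 0 < delta &
    forall e : R, 0 < e < delta -> `|V2 X (x, P.2 + e) - V2 X (x, P.2 - e)| < eta) ->
  solenoidal_at X P.
Proof.
move=> r0 [m1 m2 md] [r' r'0 [C hC]] sm jump.
pose s := Num.min r r'.
have s0 : 0 < s by rewrite lt_min r0.
have sr z : in_box P s z -> in_box P r z /\ in_box P r' z.
  by rewrite /in_box !lt_min => -[/andP[? ?] /andP[? ?]].
have sr1 (x : R) : `|x - P.1| < s -> `|x - P.1| < r by rewrite lt_min => /andP[].
rewrite [P]surjective_pairing.
apply: (@graph_weak_divergence R P.1 P.2 s C (fun=> P.2) (fun=> 0)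
  (V1 X) (V2 X) (V11 X) (V12 X) (V21 X) (V22 X) (Vd X)) => //.
- by move=> x _; exact: cvg_cst.
- by rewrite -surjective_pairing => z /sr[_ /hC].
- by rewrite -surjective_pairing => z /sr[/sm h _] /h[].
- by rewrite -surjective_pairing => z /sr[/sm h _] /h[_ [? ? ? ?]].
- move=> x /sr1 hx eta eta0; have [delta d0 h] := jump x hx eta eta0.
  by exists delta => // e he; rewrite !mul0r !subr0; exact: h.
Qed.

Lemma smooth_continuous X z : smooth_at X z ->
  [/\ {for z, continuous (V1 X)}, {for z, continuous (V2 X)}
    & {for z, continuous (fun z => V11 X z + V22 X z)}].
Proof.
move=> [[/is_grad_continuous ? /is_grad_continuous ? _] [? ? ? ?]]; split => //.
exact: cvgD.
Qed.

Lemma continuous_box (f : R * R -> R) z (eta : R) : {for z, continuous f} -> 0 < eta ->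
  exists2 delta : R, 0 < delta & forall w, in_box z delta w -> `|f w - f z| < eta.
Proof.
move=> cf eta0; have /cvgrPdist_lt /(_ eta eta0) /near_box[d d0 h] := cf.
by exists d => // w [w1 w2]; rewrite distrC; exact: h.
Qed.

Lemma smooth_solenoidal X P (r : R) : 0 < r -> measurable_field X ->
  (forall z, in_box P r z -> smooth_at X z) -> solenoidal_at X P.
Proof.
move=> r0 mX sm.
have PP : in_box P r P by rewrite /in_box !subrr normr0.
have [c1 c2 cd] := smooth_continuous (sm P PP).
apply: (axis_solenoidal r0 mX).
- have [d1 d10 h1] := continuous_box c1 ltr01.
  have [d2 d20 h2] := continuous_box c2 ltr01.
  have [d3 d30 h3] := continuous_box cd ltr01.
  pose s := Num.min r (Num.min d1 (Num.min d2 d3)).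
  exists s; first by rewrite !lt_min r0 d10 d20 d30.
  exists (`|V1 X P| + `|V2 X P| + `|V11 X P + V22 X P| + 1) => z.
  rewrite /in_box !lt_min => -[/and4P[a1 a2 a3 a4] /and4P[b1 b2 b3 b4]].
  have [[_ _ ->] _] := sm z (conj a1 b1).
  have B (x y : R) : `|x - y| < 1 -> `|x| <= `|y| + 1.
    by move=> h; have := ler_distD y x 0; rewrite !subr0; lra.
  have := B _ _ (h1 z (conj a2 b2)); have := B _ _ (h2 z (conj a3 b3)).
  have := B _ _ (h3 z (conj a4 b4)).
  have := normr_ge0 (V1 X P); have := normr_ge0 (V2 X P); have := normr_ge0 (V11 X P + V22 X P).
  by split; lra.
- by move=> z /sm.
- move=> x hx eta eta0.
  have xP : in_box P r (x, P.2) by rewrite /in_box /= subrr normr0.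
  have [_ cc _] := smooth_continuous (sm _ xP).
  have [d d0 h] := continuous_box cc (divr_gt0 eta0 (ltr0n R 2)).
  exists d => // e /andP[e0 ed].
  have l1 := h (x, P.2 + e) ltac:(by rewrite /in_box /= subrr normr0 addrAC subrr add0r gtr0_norm).
  have l2 := h (x, P.2 - e) ltac:(by rewrite /in_box /= subrr normr0 addrAC subrr add0r normrN gtr0_norm).
  have := ler_distD (V2 X (x, P.2)) (V2 X (x, P.2 + e)) (V2 X (x, P.2 - e)).
  rewrite (distrC (V2 X (x, P.2))); lra.
Qed.

(** Tangency on both sides makes the jump of the normal component vanish,
    whichever sides of the arc belong to the region: extended by zero, a field is
    trivially tangent from outside. *)
Lemma arc_solenoidal X (u v u' v' : R -> R) (t0 eta : R) : 0 < eta ->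
  (forall t, `|t - t0| < eta -> is_derive t 1 u (u' t)) ->
  (forall t, `|t - t0| < eta -> is_derive t 1 v (v' t)) ->
  (forall t, `|t - t0| < eta -> {for t, continuous u'}) ->
  (forall t, `|t - t0| < eta -> {for t, continuous v'}) ->
  u' t0 != 0 ->
  measurable_field X -> bounded_field X (u t0, v t0) ->
  (forall eta', 0 < eta' <= eta -> exists2 r : R, 0 < r & forall z, in_box (u t0, v t0) r z ->
    (forall t, `|t - t0| < eta' -> z <> (u t, v t)) -> smooth_at X z) ->
  (forall t, `|t - t0| < eta -> forall e : R, 0 < e -> exists2 d : R, 0 < d &
    forall w, in_box (u t, v t) d w -> `|v' t * V1 X w - u' t * V2 X w| < e) ->
  solenoidal_at X (u t0, v t0).
Proof.
move=> eta0 du dv cu' cv' u0 [m1 m2 md] [r1 r10 [C hC]] sm tan.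
have [eta' [r2 [g [g' [eta'0 r20 gu dg sg]]]]] := curve_graph eta0 du dv cu' cv' u0.
have [r3 r30 sm3] := sm eta' eta'0.
have tt0 : `|t0 - t0| < eta' by rewrite subrr normr0; case/andP: eta'0.
pose s := Num.min r1 (Num.min r2 r3).
have s0 : 0 < s by rewrite !lt_min r10 r20.
have sP z : in_box (u t0, v t0) s z ->
    [/\ in_box (u t0, v t0) r1 z, in_box (u t0, v t0) r3 z & `|z.1 - u t0| < r2].
  by rewrite /in_box /= !lt_min => -[/and3P[? ? ?] /and3P[? ? ?]].
have s2 (x : R) : `|x - u t0| < s -> `|x - u t0| < r2 by rewrite !lt_min => /and3P[].
have off z : in_box (u t0, v t0) s z -> z.2 != g z.1 -> smooth_at X z.
  move=> /sP[_ h3 _] /eqP zg; apply: sm3 => // t ht zt; apply: zg.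
  by rewrite zt /= gu.
apply: (@graph_weak_divergence R (u t0) (v t0) s C g g'
  (V1 X) (V2 X) (V11 X) (V12 X) (V21 X) (V22 X) (Vd X)) => //.
- exact: gu.
- by move=> x /s2 /dg[].
- by move=> x /s2 /dg[].
- by move=> z /sP[/hC].
- by move=> z hz /(off z hz)[].
- by move=> z hz /(off z hz)[_ [? ? ? ?]].
- move=> x /s2 hx e e0; have [t [ht ux ut0 gx]] := sg x hx.
  have gt : g x = v t by rewrite -ux gu.
  have tlt : `|t - t0| < eta by apply: lt_le_trans ht _; case/andP: eta'0.
  have na : 0 < `|u' t| by rewrite normr_gt0.
  have [d d0 hd] := tan t tlt (`|u' t| * (e / 2)) ltac:(by rewrite mulr_gt0// divr_gt0).
  have K w : in_box (u t, v t) d w -> `|V2 X w - g' x * V1 X w| < e / 2.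
    move=> /hd; have -> : v' t * V1 X w - u' t * V2 X w = - (u' t * (V2 X w - g' x * V1 X w)).
      by rewrite gx; field.
    by rewrite normrN normrM ltr_pM2l.
  exists d => // f /andP[f0 fd].
  have k1 := K (x, g x + f) ltac:(by rewrite /in_box /= ux gt subrr normr0 addrAC subrr add0r gtr0_norm).
  have k2 := K (x, g x - f) ltac:(by rewrite /in_box /= ux gt subrr normr0 addrAC subrr add0r normrN gtr0_norm).
  have := ler_normB (V2 X (x, g x + f) - g' x * V1 X (x, g x + f))
    (V2 X (x, g x - f) - g' x * V1 X (x, g x - f)); lra.
Qed.

Definition field_flip (X : field) : field :=
  Field (V2 X \o flip) (V1 X \o flip) (V22 X \o flip) (V21 X \o flip)
    (V12 X \o flip) (V11 X \o flip) (Vd X \o flip).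

Lemma smooth_flip X z : smooth_at X (flip z) -> smooth_at (field_flip X) z.
Proof.
move=> [[d1 d2 dd] [c1 c2 c3 c4]]; split; split => /=; try exact: continuous_flip.
- exact: (is_grad_flip d2).
- exact: (is_grad_flip d1).
- by rewrite dd addrC.
Qed.

Lemma in_box_flip P (r : R) z : in_box (flip P) r z -> in_box P r (flip z).
Proof. by move=> [h1 h2]; split. Qed.

Lemma field_flip_props X P : (measurable_field X -> measurable_field (field_flip X)) /\
  (bounded_field X P -> bounded_field (field_flip X) (flip P)).
Proof.
split.
  move=> [m1 m2 md]; split; apply: measurableT_comp => //; exact: flip_measurable.
move=> [r r0 [C hC]]; exists r => //; exists C => z /in_box_flip /hC[? ? ?].
by split.
Qed.

Lemma solenoidal_flip X P : solenoidal_at (field_flip X) (flip P) -> solenoidal_at X P.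
Proof. exact: weak_divergence_flip. Qed.

End BoundaryPoints.

(** * Traces and extension by zero *)

Section GreenIdentity.
Context {R : realType}.
Local Notation mR := (measurableTypeR R).
Local Notation mR2 := (measurableTypeR R * measurableTypeR R)%type.
Implicit Types (P z w : R * R) (D S : set (R * R)) (f g : R * R -> R).

Lemma trace_box S f P (l : R) : trace f S P l -> forall eta : R, 0 < eta ->
  exists2 d : R, 0 < d & forall z, in_box P d z -> S z -> `|f z - l| < eta.
Proof.
move=> /cvgrPdist_lt h eta eta0; have /near_box[d d0 hd] := h eta eta0.
by exists d => // z [z1 z2] Sz; rewrite distrC; exact: hd.
Qed.

Lemma box_trace S f P (l : R) : (forall eta : R, 0 < eta ->
  exists2 d : R, 0 < d & forall z, in_box P d z -> S z -> `|f z - l| < eta) -> trace f S P l.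
Proof.
move=> h; apply/cvgrPdist_lt => eta eta0; have [d d0 hd] := h eta eta0.
apply: (box_near d0) => z z1 z2 Sz; rewrite distrC; exact: hd.
Qed.

Lemma trace_bounded S f P (l : R) : trace f S P l ->
  exists2 r : R, 0 < r & bounded_on (in_box P r `&` S) f.
Proof.
move=> /trace_box/(_ 1 ltr01)[r r0 h]; exists r => //; exists (`|l| + 1) => z [Pz Sz].
have := ler_distD l (f z) 0; rewrite !subr0 => /le_trans; apply.
by rewrite addrC lerD2l ltW// h.
Qed.

Lemma trace_bounded0 S f g P : bounded_on S f -> trace g S P 0 ->
  trace (fun z => f z * g z) S P 0.
Proof.
move=> [C hC] tg; apply: box_trace => eta eta0.
have C0 : 0 < `|C| + 1 by rewrite ltr_wpDl.
have [d d0 h] := trace_box tg (divr_gt0 eta0 C0).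
exists d => // z Pz Sz; rewrite subr0 normrM.
have := h z Pz Sz; rewrite subr0 ltr_pdivlMr// => hg.
apply: le_lt_trans hg; rewrite mulrC ler_wpM2l//.
by rewrite (le_trans (hC z Sz))// (le_trans (ler_norm C))// lerDl.
Qed.

Lemma trace_grad f S P (l : R * R) : trace (grad f) S P l ->
  trace (dx f) S P l.1 /\ trace (dy f) S P l.2.
Proof.
move=> h; have K (e : R) : 0 < e -> \forall z \near P, S z -> ball l e (grad f z).
  by move=> e0; have /cvg_ball/(_ e e0) := h.
by split; apply/cvgrPdist_lt => e /K; apply: filterS => z hz Sz; [exact: (hz Sz).1|exact: (hz Sz).2].
Qed.

Lemma in_box_min P (r s : R) z : in_box P (Num.min r s) z -> in_box P r z /\ in_box P s z.
Proof. by rewrite /in_box !lt_min => -[/andP[? ?] /andP[? ?]]. Qed.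

Lemma open_box S P : open S -> S P -> exists2 r : R, 0 < r & in_box P r `<=` S.
Proof.
move=> oS SP; have /near_box[r r0 h] : nbhs P S by exact: open_nbhs_nbhs.
by exists r => // z [z1 z2]; exact: h.
Qed.

Lemma continuous_near (V : topologicalType) (f g : R * R -> V) z :
  (\forall w \near z, f w = g w) -> {for z, continuous f} -> {for z, continuous g}.
Proof.
move=> fg cf; have fz : f z = g z := nbhs_singleton fg.
suff : g @ nbhs z --> f z by rewrite fz.
apply: cvg_trans cf.
by apply: near_eq_cvg; apply: filterS fg => w ->.
Qed.

Lemma patch_near D f z : open D -> D z -> \forall w \near z, f w = (f \_ D) w.
Proof.
move=> oD Dz; have : nbhs z D by exact: open_nbhs_nbhs.
by apply: filterS => w Dw; rewrite patchE mem_set.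
Qed.

(** Extension by zero: the field lives on the slit domain, but the weak form is
    integrated over the whole plane. *)
Definition field_patch (X : @field R) D : field :=
  Field (V1 X \_ D) (V2 X \_ D) (V11 X \_ D) (V12 X \_ D) (V21 X \_ D) (V22 X \_ D) (Vd X \_ D).

Lemma smooth_patch_in X D z : open D -> D z -> smooth_at X z -> smooth_at (field_patch X D) z.
Proof.
move=> oD Dz [[d1 d2 dd] [c1 c2 c3 c4]].
have zD : z \in D by rewrite mem_set.
split; split => /=.
- by rewrite !patchE zD; apply: is_grad_near d1; exact: patch_near.
- by rewrite !patchE zD; apply: is_grad_near d2; exact: patch_near.
- by rewrite !patchE zD.
- by apply: continuous_near c1; exact: patch_near.
- by apply: continuous_near c2; exact: patch_near.
- by apply: continuous_near c3; exact: patch_near.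
- by apply: continuous_near c4; exact: patch_near.
Qed.

Lemma smooth_patch_out X D z : ~ closure D z -> smooth_at (field_patch X D) z.
Proof.
move=> Dz.
have nD : \forall w \near z, ~ D w.
  have : nbhs z (~` closure D) by apply: open_nbhs_nbhs; split => //; apply: closed_openC; exact: closed_closure.
  by apply: filterS => w h /subset_closure.
have Z f : \forall w \near z, 0 = (f \_ D) w.
  by apply: filterS nD => w Dw; rewrite patchE memNset.
have z0 f : (f \_ D) z = 0 by rewrite (nbhs_singleton (Z f)).
have C0 f : {for z, continuous (f \_ D)}.
  by apply: (continuous_near (Z f)); exact: cvg_cst.
split; split => //=; rewrite !z0 ?addr0 //.
- by apply: (is_grad_near (Z (V1 X))); exact: is_grad_cst.
- by apply: (is_grad_near (Z (V2 X))); exact: is_grad_cst.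
Qed.

Lemma measurable_patch X D : open D -> (forall z, D z -> smooth_at X z) ->
  measurable_field (field_patch X D).
Proof.
move=> oD sm; have mD := open_measurable_plane oD.
have M f : (forall z, D z -> {for z, continuous f}) -> measurable_fun setT (f \_ D : mR2 -> mR).
  by move=> cf; apply/(measurable_restrictT _ mD); exact: continuous_measurable_plane.
split; apply: M => z Dz; have [c1 c2 c3] := smooth_continuous (sm z Dz) => //.
apply: continuous_near c3; have : nbhs z D by exact: open_nbhs_nbhs.
by apply: filterS => w /sm[[_ _ ->]].
Qed.

Lemma bounded_patch X D P (r : R) : 0 < r -> bounded_on (in_box P r `&` D) (V1 X) ->
  bounded_on (in_box P r `&` D) (V2 X) -> bounded_on (in_box P r `&` D) (Vd X) ->
  bounded_field (field_patch X D) P.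
Proof.
move=> r0 [C1 h1] [C2 h2] [C3 h3]; exists r => //; exists (`|C1| + `|C2| + `|C3|) => z Pz.
have [n1 n2 n3] : [/\ 0 <= `|C1|, 0 <= `|C2| & 0 <= `|C3|] by [].
have := ler_norm C1; have := ler_norm C2; have := ler_norm C3 => l3 l2 l1.
have [zD|zD] := boolP (z \in D); rewrite /= !patchE ?zD ?(negbTE zD); last first.
  by rewrite normr0; split; lra.
have Sz : (in_box P r `&` D) z by split => //; rewrite -in_setE.
by have := h1 z Sz; have := h2 z Sz; have := h3 z Sz; split; lra.
Qed.

End GreenIdentity.

(** * The Green identity *)

Section GreenIdentity2.
Context {R : realType}.
Local Notation mR := (measurableTypeR R).
Local Notation mR2 := (measurableTypeR R * measurableTypeR R)%type.
Implicit Types (P z w : R * R) (S : set (R * R)) (f g : R * R -> R).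
Variables (p a b : R) (W : set (R * R)) (c : R -> R * R) (E : seq R) (Phi : R * R -> R) (k : R).
Hypothesis SR : slit_region a b W c E.
Hypothesis SP : source_potential p a b W c Phi.
Hypothesis flow : forall t : R, 0 < t < 1 -> t \notin E ->
  exists2 g : R * R, trace (grad Phi) (W `\` pos_axis) (c t) g &
    - dot g (unit_normal c t) = dot (k *: c t) (unit_normal c t).

Local Notation D := (W `\` pos_axis).

(** The ends of the curve and its exceptional points: the boundary points where
    nothing is assumed about the potential. *)
Definition exceptional P : Prop :=
  P = (a, 0) \/ P = (b, 0) \/ exists2 t, 0 < t < 1 /\ t \in E & P = c t.

(** What a multiplier of the potential must satisfy for the Green identity: the
    adjoint conditions on the slit, and vanishing near the points where the
    potential is not under control. *)
Record green_test (v : @jet R) : Prop := {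
  green_jet : forall z, D z -> is_jet v z;
  green_exceptional : forall P, exceptional P -> exists2 r : R, 0 < r & forall z,
    in_box P r z -> D z -> [/\ jv v z = 0, jx v z = 0, jy v z = 0 & lap v z = 0];
  green_origin : exists2 d : R, 0 < d & forall z, D z -> modulus z < d ->
    [/\ jv v z = 0, jx v z = 0, jy v z = 0 & lap v z = 0];
  green_trace : forall x : R, 0 < x < b -> x != a -> exists l lx mx my : R,
    [/\ trace (jv v) upper (x, 0) l, trace (jx v) upper (x, 0) lx
      & trace (jy v) upper (x, 0) 0] /\
    [/\ trace (jv v) lower (x, 0) (p * l), trace (jx v) lower (x, 0) mx
      & trace (jy v) lower (x, 0) my];
  green_bounded : [/\ bounded_on D (jv v), bounded_on D (jx v), bounded_on D (jy v)
      & bounded_on D (lap v)] }.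

Lemma slit_domain_open : open D.
Proof. by apply: openI; [exact: region_open SR|exact: closed_openC pos_axis_closed]. Qed.

Definition green_density (v : @jet R) z : R :=
  2 * k * jv v z + k * euler v z - Phi z * lap v z.

(** The field [v (grad Phi + k z) - Phi grad v]: its divergence involves the
    potential only through [Phi lap v], and it is tangent to the moving boundary
    because [grad Phi + k z] is. *)
Definition green_field (v : @jet R) : field :=
  Field
    (fun z => jv v z * (dx Phi z + k * z.1) - Phi z * jx v z)
    (fun z => jv v z * (dy Phi z + k * z.2) - Phi z * jy v z)
    (fun z => jv v z * (dx (dx Phi) z + k) + (dx Phi z + k * z.1) * jx v z
       - (Phi z * jxx v z + jx v z * dx Phi z))
    (fun z => jv v z * dy (dx Phi) z + (dx Phi z + k * z.1) * jy v z
       - (Phi z * jxy v z + jx v z * dy Phi z))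
    (fun z => jv v z * dx (dy Phi) z + (dy Phi z + k * z.2) * jx v z
       - (Phi z * jxy v z + jy v z * dx Phi z))
    (fun z => jv v z * (dy (dy Phi) z + k) + (dy Phi z + k * z.2) * jy v z
       - (Phi z * jyy v z + jy v z * dy Phi z))
    (green_density v).

Lemma green_smooth v z : D z -> is_jet v z -> smooth_at (green_field v) z.
Proof.
move=> Dz jv0; have [v0 v1 v2] := is_jet_continuous jv0.
case: jv0 => -[dv0 dv1 dv2] [v3 v4 v5].
have [[d0 d1 d2] [p1 p2 p3 p4] hl] := potential_harmonic SP Dz.
have g0 := differentiable_is_grad d0.
have g1 := differentiable_is_grad d1.
have g2 := differentiable_is_grad d2.
have c0 := is_grad_continuous g0; have c1 := is_grad_continuous g1; have c2 := is_grad_continuous g2.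
have gk1 := is_gradM (is_grad_cst k z) (is_grad_fst z).
have gk2 := is_gradM (is_grad_cst k z) (is_grad_snd z).
have h1 := is_gradD g1 gk1; have h2 := is_gradD g2 gk2.
have ch1 := is_grad_continuous h1; have ch2 := is_grad_continuous h2.
have CM f g : {for z, continuous f} -> {for z, continuous g} -> {for z, continuous (fun w => f w * g w)}.
  by move=> cf cg; exact: (cvgM cf cg).
have CD f g : {for z, continuous f} -> {for z, continuous g} -> {for z, continuous (fun w => f w + g w)}.
  by move=> cf cg; exact: (cvgD cf cg).
have CB f g : {for z, continuous f} -> {for z, continuous g} -> {for z, continuous (fun w => f w - g w)}.
  by move=> cf cg; exact: (cvgB cf cg).
have ck : {for z, continuous (fun=> k)} by exact: cvg_cst.
split; split => /=.
- apply: (is_grad_eq (is_gradD (is_gradM dv0 h1) (is_gradN (is_gradM g0 dv1)))).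
  by congr pair => /=; rewrite /grad /=; ring.
- apply: (is_grad_eq (is_gradD (is_gradM dv0 h2) (is_gradN (is_gradM g0 dv2)))).
  by congr pair => /=; rewrite /grad /=; ring.
- rewrite /green_density /euler /lap.
  have -> : dx (dx Phi) z = - dy (dy Phi) z by apply/eqP; rewrite -addr_eq0 hl.
  by ring.
- exact: (CB _ _ (CD _ _ (CM _ _ v0 (CD _ _ p1 ck)) (CM _ _ ch1 v1)) (CD _ _ (CM _ _ c0 v3) (CM _ _ v1 c1))).
- exact: (CB _ _ (CD _ _ (CM _ _ v0 p3) (CM _ _ ch1 v2)) (CD _ _ (CM _ _ c0 v4) (CM _ _ v1 c2))).
- exact: (CB _ _ (CD _ _ (CM _ _ v0 p2) (CM _ _ ch2 v1)) (CD _ _ (CM _ _ c0 v4) (CM _ _ v2 c1))).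
- exact: (CB _ _ (CD _ _ (CM _ _ v0 (CD _ _ p4 ck)) (CM _ _ ch2 v2)) (CD _ _ (CM _ _ c0 v5) (CM _ _ v2 c2))).
Qed.

(** The part of the curve with parameters at distance at least [d] from [t0] is
    compact; since the curve is simple this isolates the arc through [c t0]. *)
Lemma curve_avoid P (t0 d : R) : (forall t, 0 <= t <= 1 -> d <= `|t - t0| -> c t <> P) ->
  exists2 r : R, 0 < r & forall z, in_box P r z ->
    forall t, 0 <= t <= 1 -> d <= `|t - t0| -> z <> c t.
Proof.
move=> h; pose A := `[0, 1]%classic `&` [set t : R | d <= `|t - t0|].
have cA : compact A.
  apply: (subclosed_compact _ (@segment_compact R 0 1)); last by move=> t [].
  apply: closedI; first exact: interval_closed.
  have cn : continuous (fun t : R => `|t - t0|).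
    by move=> t; apply: (@cvg_norm); apply: cvgB; [exact: cvg_id|exact: cvg_cst].
  exact: (closed_comp (f := fun t : R => `|t - t0|) (fun t _ => cn t) (@closed_ge R d)).
have cc : compact (c @` A).
  apply: continuous_compact => //; apply: continuous_subspaceW (around_continuous (region_curve SR)).
  by move=> t [].
have clc : closed (c @` A) by apply: compact_closed => //; exact: norm_hausdorff.
have [r r0 hr] := open_box (closed_openC clc) (P := P) ltac:(by move=> -[t [/= t1 t2] ct]; apply: (h t)).
by exists r => // z /hr nz t t1 t2 zt; apply: nz; exists t.
Qed.

Section Test.
Variable v : @jet R.
Hypothesis T : green_test v.

Local Notation X := (field_patch (green_field v) D).

Lemma green_smooth_in z : D z -> smooth_at X z.
Proof.
move=> Dz; apply: smooth_patch_in => //; first exact: slit_domain_open.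
by apply: green_smooth => //; exact: green_jet.
Qed.

Lemma green_measurable : measurable_field X.
Proof.
apply: measurable_patch; first exact: slit_domain_open.
by move=> z Dz; apply: green_smooth => //; exact: green_jet.
Qed.

(** Away from the origin the potential is bounded, and near it the test
    vanishes. *)
Lemma potential_times_bounded f : bounded_on D f ->
  (forall d : R, (forall z, D z -> modulus z < d -> [/\ jv v z = 0, jx v z = 0, jy v z = 0 & lap v z = 0]) ->
    forall z, D z -> modulus z < d -> f z = 0) ->
  bounded_on D (fun z => Phi z * f z).
Proof.
move=> [C hC] f0; have [d d0 hd] := green_origin T.
have [M hM] := potential_bounded SP d0.
exists (`|M| * C) => z Dz.
have C0 : 0 <= C by apply: le_trans (hC z Dz).
have [zd|zd] := ltP (modulus z) d; first by rewrite (f0 d)// mulr0 normr0 mulr_ge0.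
rewrite normrM ler_pM//; last exact: hC.
rewrite gtr0_norm; last exact: (potential_gt0 SP Dz).
by rewrite (le_trans (hM z Dz zd))// ler_norm.
Qed.

Lemma green_bounded_at P (r : R) : 0 < r -> bounded_on (in_box P r `&` D) (dx Phi) ->
  bounded_on (in_box P r `&` D) (dy Phi) -> bounded_field X P.
Proof.
move=> r0 b1 b2; have [v0 v1 v2 vl] := green_bounded T.
have [M M0 hM] := region_bound SR.
have bz1 : bounded_on D fst by exists M => z [/hM[/ltW]].
have bz2 : bounded_on D snd by exists M => z [/hM[_ /ltW]].
have sub f : bounded_on D f -> bounded_on (in_box P r `&` D) f.
  by apply: bounded_onS => z [].
have k0 S : bounded_on S (fun=> k) by exact: bounded_on_cst.
have q1 : bounded_on D (fun z => Phi z * jx v z).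
  by apply: potential_times_bounded => // d h z Dz /(h z Dz)[].
have q2 : bounded_on D (fun z => Phi z * jy v z).
  by apply: potential_times_bounded => // d h z Dz /(h z Dz)[].
have ql : bounded_on D (fun z => Phi z * lap v z).
  by apply: potential_times_bounded => // d h z Dz /(h z Dz)[].
apply: (bounded_patch r0) => /=.
- apply: bounded_onD; last by apply: bounded_onN; exact: sub.
  apply: bounded_onM; first exact: sub.
  by apply: bounded_onD => //; apply: bounded_onM => //; exact: sub.
- apply: bounded_onD; last by apply: bounded_onN; exact: sub.
  apply: bounded_onM; first exact: sub.
  by apply: bounded_onD => //; apply: bounded_onM => //; exact: sub.
- apply: sub; apply: bounded_onD; last by apply: bounded_onN.
  apply: bounded_onD; apply: bounded_onM => //; first by apply: bounded_on_cst.
  by apply: bounded_onD; apply: bounded_onM.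
Qed.

Lemma vanishing_at P (r : R) : 0 < r ->
  (forall z, in_box P r z -> D z -> [/\ jv v z = 0, jx v z = 0, jy v z = 0 & lap v z = 0]) ->
  solenoidal_at X P.
Proof.
move=> r0 h; apply: (vanishing_solenoidal r0) => z Pz; rewrite /= !patchE.
have [zD|//] := boolP (z \in D).
have Dz : D z by rewrite -in_setE.
have [e0 e1 e2 e3] := h z Pz Dz.
by rewrite /green_density /euler e0 e1 e2 e3; split; ring.
Qed.

Lemma modulus_lt_near (d : R) : 0 < d -> exists2 r : R, 0 < r &
  forall z, in_box (0, 0) r z -> modulus z < d.
Proof.
move=> d0; exists (d / 2); first by rewrite divr_gt0.
move=> z []; rewrite /= !subr0 => z1 z2; apply: le_lt_trans (modulus_le z) _; lra.
Qed.

Lemma origin_solenoidal : solenoidal_at X (0, 0).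
Proof.
have [d d0 hd] := green_origin T; have [r r0 hr] := modulus_lt_near d0.
by apply: (vanishing_at r0) => z /hr zd Dz; exact: hd.
Qed.

Lemma exceptional_solenoidal P : exceptional P -> solenoidal_at X P.
Proof. by move=> /(green_exceptional T)[r r0 h]; exact: (vanishing_at r0). Qed.

Lemma flux_trace S (x l gy lv ly : R) : trace Phi S (x, 0) l -> trace (dy Phi) S (x, 0) gy ->
  trace (jv v) S (x, 0) lv -> trace (jy v) S (x, 0) ly ->
  trace (V2 (green_field v)) S (x, 0) (lv * gy - l * ly).
Proof.
move=> t1 t2 t3 t4.
have ts : trace snd S (x, 0) 0 by apply: (@continuous_trace _ _ snd (x, 0)); exact: cvg_snd.
have th := traceD t2 (traceM (@trace_cst R S (x, 0) k) ts).
apply: (trace_eq (traceD (traceM t3 th) (traceN (traceM t1 t4)))).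
by rewrite mulr0 addr0.
Qed.

Local Notation above := (W `&` [set z : R * R | 0 < z.2]).
Local Notation below := (W `&` [set z : R * R | z.2 < 0]).

Lemma off_axis_domain z : W z -> z.2 != 0 -> D z.
Proof. by move=> Wz z2; split => // -[_ /eqP]; rewrite (negbTE z2). Qed.

Lemma domain_sides z : D z -> 0 < z.1 -> above z \/ below z.
Proof.
move=> [Wz nz] z1; have [h|h|h] := ltgtP 0 z.2; [by left|by right|].
by case: nz; split; rewrite ?ltW.
Qed.

Lemma side_bounded f (x r1 r2 : R) : 0 < x -> 0 < r1 -> 0 < r2 ->
  bounded_on (in_box (x, 0) r1 `&` above) f -> bounded_on (in_box (x, 0) r2 `&` below) f ->
  bounded_on (in_box (x, 0) (Num.min x (Num.min r1 r2)) `&` D) f.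
Proof.
move=> x0 r10 r20 [C1 h1] [C2 h2]; exists (`|C1| + `|C2|) => z [/in_box_min[zx /in_box_min[z1 z2]] Dz].
have n1 := normr_ge0 C1; have n2 := normr_ge0 C2.
have l1 := ler_norm C1; have l2 := ler_norm C2.
have zp : 0 < z.1 by case: zx => /=; rewrite ltr_distl => /andP[h _] _; lra.
case: (domain_sides Dz zp) => hz.
- by have := h1 z (conj z1 hz); lra.
- by have := h2 z (conj z2 hz); lra.
Qed.

Lemma axis_bounded (x r1 r2 : R) : 0 < x -> 0 < r1 -> 0 < r2 ->
  bounded_on (in_box (x, 0) r1 `&` above) (dx Phi) -> bounded_on (in_box (x, 0) r1 `&` above) (dy Phi) ->
  bounded_on (in_box (x, 0) r2 `&` below) (dx Phi) -> bounded_on (in_box (x, 0) r2 `&` below) (dy Phi) ->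
  bounded_field X (x, 0).
Proof.
move=> x0 r10 r20 b1 b2 b3 b4; have s0 : 0 < Num.min x (Num.min r1 r2) by rewrite !lt_min x0 r10.
by apply: (green_bounded_at s0); exact: side_bounded.
Qed.

Lemma grad_trace_bounded S P (g : R * R) : trace (grad Phi) S P g -> exists2 r : R, 0 < r &
  bounded_on (in_box P r `&` S) (dx Phi) /\ bounded_on (in_box P r `&` S) (dy Phi).
Proof.
move=> /trace_grad[/trace_bounded[r1 r10 b1] /trace_bounded[r2 r20 b2]].
exists (Num.min r1 r2); first by rewrite lt_min r10.
by split; [apply: bounded_onS b1|apply: bounded_onS b2] => z [/in_box_min[z1 z2] Sz].
Qed.

(** Both one-sided limits of the vertical component are [p l g], where [l] is
    the value of the test above and [g] the flux of the potential below. *)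
Lemma passing_solenoidal (x0 : R) : 0 < x0 < a -> solenoidal_at X (x0, 0).
Proof.
move=> hx0; have x00 : 0 < x0 by case/andP: hx0.
have ab : a < b by have /andP[] := region_slit SR.
have [r1 r10 hW] := open_box (region_open SR) (axis_in_region SR (x := x0) ltac:(lra)).
pose r := Num.min r1 (Num.min x0 (a - x0)).
have r0 : 0 < r by rewrite !lt_min r10 x00 /= subr_gt0; case/andP: hx0.
have hr z : in_box (x0, 0) r z -> W z by move=> /in_box_min[/hW].
have hxr (x : R) : `|x - x0| < r -> 0 < x < a.
  by rewrite !lt_min => /and3P[_ + +]; rewrite !ltr_distl; lra.
clearbody r.
apply: (axis_solenoidal r0); first exact: green_measurable.
- have [l [gp [gm [_ tp _ tm _]]]] := potential_passing SP hx0.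
  have [s1 s10 [b1 b2]] := grad_trace_bounded tp.
  have [s2 s20 [b3 b4]] := grad_trace_bounded tm.
  exact: (axis_bounded x00 s10 s20 b1 b2 b3 b4).
- by move=> z /hr Wz z2; apply: green_smooth_in; exact: off_axis_domain.
- move=> x hx eta eta0; have hxa := hxr x hx.
  have [l [gp [gm [t1 tp t2 tm g2]]]] := potential_passing SP hxa.
  have [lv [lx [mx [my [[u1 _ u2] [u3 _ u4]]]]]] := green_trace T (x := x) ltac:(lra) ltac:(lra).
  have sa : above `<=` upper by move=> z [].
  have sb : below `<=` lower by move=> z [].
  have f1 := flux_trace t1 (trace_grad tp).2 (trace_sub sa u1) (trace_sub sa u2).
  have f2 := flux_trace t2 (trace_grad tm).2 (trace_sub sb u3) (trace_sub sb u4).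
  have [d1 d10 h1] := trace_box f1 (divr_gt0 eta0 (ltr0n R 2)).
  have [d2 d20 h2] := trace_box f2 (divr_gt0 eta0 (ltr0n R 2)).
  exists (Num.min r (Num.min d1 d2)); first by rewrite !lt_min r0 d10.
  move=> e; rewrite !lt_min => /and4P[e0 er ed1 ed2].
  have n1 : `|e| = e by rewrite gtr0_norm.
  have Ne : - e < 0 by rewrite oppr_lt0.
  have Wp : W (x, e) by apply: hr; split => //=; rewrite subr0 n1.
  have Wm : W (x, - e) by apply: hr; split => //=; rewrite subr0 normrN n1.
  have Dp : D (x, e) by apply: off_axis_domain => //=; rewrite gt_eqF.
  have Dm : D (x, - e) by apply: off_axis_domain => //=; rewrite oppr_eq0 gt_eqF.
  have k1 := h1 (x, e) ltac:(by split; rewrite /= ?subrr ?normr0// subr0 n1) (conj Wp e0).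
  have k2 := h2 (x, - e) ltac:(by split; rewrite /= ?subrr ?normr0// subr0 normrN n1) (conj Wm Ne).
  rewrite /= add0r sub0r !patchE !mem_set//.
  move: k1 k2; rewrite g2 mulr0 mul0r !subr0 /= (mulrCA lv) mulrA.
  rewrite !ltr_distl => /andP[k1 k2] /andP[k3 k4].
  by apply/andP; split; lra.
Qed.

(** Just below this part of the slit there is nothing of the region, and the
    vertical component tends to zero above. *)
Lemma reflecting_solenoidal (x0 : R) : a < x0 < b -> solenoidal_at X (x0, 0).
Proof.
move=> hx0; have a0 : 0 < a by have /andP[] := region_slit SR.
have x00 : 0 < x0 by lra.
have [r1 r10 hB] := below_slit SR hx0.
have [r2 r20 hC] : exists2 r : R, 0 < r & forall z, in_box (x0, 0) r z ->
    forall t, 0 <= t <= 1 -> 0 <= `|t - 0| -> z <> c t.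
  apply: curve_avoid => t ht _ ct.
  have [t0|t0] := ltrP 0 t; last first.
    have t00 : t = 0 by lra.
    by move: ct; rewrite t00 (around_start (region_curve SR)) => -[e1]; lra.
  have [t1|t1] := ltrP t 1; last first.
    have t11 : t = 1 by lra.
    by move: ct; rewrite t11 (around_end (region_curve SR)) => -[e1]; lra.
  apply: (@curve_off_axis _ a b W c E SR t); first by rewrite t0.
  by rewrite ct; split => //=; lra.
pose r := Num.min (Num.min r1 r2) (Num.min (x0 - a) (b - x0)).
have r0 : 0 < r by rewrite !lt_min r10 r20 /=; apply/andP; split; lra.
have r1r : r <= r1 by rewrite !ge_min lexx.
have hxr (x : R) : `|x - x0| < r -> a < x < b.
  by rewrite !lt_min => /and3P[_ + +]; rewrite !ltr_distl; lra.
have low z : in_box (x0, 0) r z -> z.2 < 0 -> ~ W z.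
  move=> [/= z1 z2] zn; apply: hB; first by apply: lt_le_trans z1 _.
  by move: z2; rewrite subr0 ltr_norml => /andP[h _]; lra.
have offc z : in_box (x0, 0) r z -> forall t, 0 <= t <= 1 -> z <> c t.
  by move=> /in_box_min[/in_box_min[_ /hC h] _] t ht; apply: h.
clearbody r.
have [l0 [g0 [_ tg0 _]]] := potential_reflecting SP hx0.
apply: (axis_solenoidal r0); first exact: green_measurable.
- have [s1 s10 [b1 b2]] := grad_trace_bounded tg0.
  have e0 f : bounded_on (in_box (x0, 0) r `&` below) f.
    by exists 0 => z [/low h [Wz zn]]; case: (h zn).
  exact: (axis_bounded x00 s10 r0 b1 b2 (e0 _) (e0 _)).
- move=> z zr /= z2; have [Wz|nW] := EM (W z).
    by apply: green_smooth_in; exact: off_axis_domain.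
  apply: smooth_patch_out => cD.
  have cW : closure W z by apply: closure_subset cD => w [].
  case: (region_frontier SR cW nW) => [[t ht zt]|[_ z20]]; last by rewrite z20 eqxx in z2.
  exact: (offc z zr t ht zt).
- move=> x hx eta eta0; have hxab := hxr x hx.
  have [l [g [t1 tg g2]]] := potential_reflecting SP hxab.
  have [lv [lx [mx [my [[u1 _ u2] _]]]]] := green_trace T (x := x) ltac:(lra) ltac:(lra).
  have sa : above `<=` upper by move=> z [].
  have f1 := flux_trace t1 (trace_grad tg).2 (trace_sub sa u1) (trace_sub sa u2).
  have [d1 d10 h1] := trace_box f1 eta0.
  exists (Num.min r d1); first by rewrite !lt_min r0 d10.
  move=> e; rewrite !lt_min => /and3P[e0 er ed1].
  have n1 : `|e| = e by rewrite gtr0_norm.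
  have Ne : - e < 0 by rewrite oppr_lt0.
  have nW : ~ W (x, - e).
    apply: low; last by [].
    by split => //=; rewrite subr0 normrN n1.
  rewrite /= add0r sub0r !patchE [X in _ - (if X then _ else _)]memNset ?subr0; last by case.
  have [/set_mem[Wp _]|_] := boolP ((x, e) \in D); last by rewrite normr0.
  have := h1 (x, e) ltac:(by split; rewrite /= ?subrr ?normr0// subr0 n1) (conj Wp e0).
  by rewrite g2 !mulr0 !subr0.
Qed.

Lemma avoid_seq (s : seq R) (t0 : R) : t0 \notin s ->
  exists2 d : R, 0 < d & forall t, `|t - t0| < d -> t \notin s.
Proof.
elim: s => [|x s IH]; first by exists 1.
rewrite inE negb_or => /andP[tx /IH[d d0 h]].
exists (Num.min d `|t0 - x|); first by rewrite lt_min d0 normr_gt0 subr_eq0.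
move=> t; rewrite lt_min => /andP[/h ts tt]; rewrite inE negb_or ts andbT.
by apply/eqP => E1; rewrite E1 distrC ltxx in tt.
Qed.

Lemma continuous_components (g : R -> R * R) (t : R) : {for t, continuous g} ->
  {for t, continuous (fun t => (g t).1)} /\ {for t, continuous (fun t => (g t).2)}.
Proof.
move=> /cvg_ball h; split; apply/cvgrPdist_lt => e /h; apply: filterS => y [h1 h2].
  exact: h1.
exact: h2.
Qed.

Lemma curve_derive (t : R) : derivable c t 1 ->
  is_derive t 1 (fun t => (c t).1) (derive1 c t).1 /\
  is_derive t 1 (fun t => (c t).2) (derive1 c t).2.
Proof.
move=> dc; rewrite derive1E.
have h : (fun h => h^-1 *: ((c \o shift t) (h *: 1) - c t)) @ 0^' --> 'D_1 c t := dc.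
have h1 : (fun h => h^-1 *: (((fun t => (c t).1) \o shift t) (h *: 1) - (c t).1)) @ 0^' --> ('D_1 c t).1.
  apply/cvgrPdist_lt => e e0; move/cvg_ball : h => /(_ e e0).
  by apply: filterS => y; case.
have h2 : (fun h => h^-1 *: (((fun t => (c t).2) \o shift t) (h *: 1) - (c t).2)) @ 0^' --> ('D_1 c t).2.
  apply/cvgrPdist_lt => e e0; move/cvg_ball : h => /(_ e e0).
  by apply: filterS => y; case.
by split; (apply: DeriveDef; [apply: cvgP; exact: h1 || exact: h2|apply: cvg_lim => //]).
Qed.

(** The homothety condition says that [grad Phi + k z] is tangent to the curve;
    multiplying by the length of the velocity removes the unit normal. *)
Lemma curve_tangency (t : R) : regular_at c t -> 0 < t < 1 -> t \notin E ->
  exists2 g : R * R, trace (grad Phi) D (c t) g &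
    (derive1 c t).2 * (g.1 + k * (c t).1) - (derive1 c t).1 * (g.2 + k * (c t).2) = 0.
Proof.
move=> [_ _ d0] ht tE; have [g tg hg] := flow ht tE; exists g => //.
have m0 : modulus (derive1 c t) != 0.
  rewrite gt_eqF// modulus_gt0// => h; case/negP: d0; apply/eqP; exact: h.
move: hg; rewrite /dot /unit_normal /=; set m := modulus _; move=> hg.
transitivity (- m * ((- (g.1 * ((derive1 c t).2 / m) + g.2 * (- (derive1 c t).1 / m)))
  - (k * (c t).1 * ((derive1 c t).2 / m) + k * (c t).2 * (- (derive1 c t).1 / m)))).
  by field.
by rewrite hg subrr mulr0.
Qed.

(** On the curve the first term of the field is tangent by the homothety and
    the second vanishes with the potential.  A vertical velocity is handled by
    exchanging the coordinates. *)
Lemma regular_solenoidal (t0 : R) : 0 < t0 < 1 -> t0 \notin E -> solenoidal_at X (c t0).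
Proof.
move=> ht0 t0E; have [d d0 hd] := avoid_seq t0E.
pose eta := Num.min d (Num.min t0 (1 - t0)).
have eta0 : 0 < eta by rewrite !lt_min d0 /=; apply/andP; split; lra.
have he (t : R) : `|t - t0| < eta -> [/\ 0 < t < 1, t \notin E & regular_at c t].
  rewrite !lt_min => /and3P[/hd tE h1 h2]; have ht : 0 < t < 1.
    by move: h1 h2; rewrite !ltr_distl; lra.
  by split => //; exact: (around_regular (region_curve SR)).
clearbody eta.
pose cu t := (c t).1; pose cv t := (c t).2.
pose cu' t := (derive1 c t).1; pose cv' t := (derive1 c t).2.
have du t : `|t - t0| < eta -> is_derive t 1 cu (cu' t).
  by move=> /he[_ _ [/nbhs_singleton/curve_derive[h _] _ _]].
have dv t : `|t - t0| < eta -> is_derive t 1 cv (cv' t).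
  by move=> /he[_ _ [/nbhs_singleton/curve_derive[_ h] _ _]].
have cc t : `|t - t0| < eta -> {for t, continuous cu'} /\ {for t, continuous cv'}.
  by move=> /he[_ _ [_ h _]]; exact: continuous_components.
have cE t : (cu t, cv t) = c t by rewrite -surjective_pairing.
have tt0 : `|t0 - t0| < eta by rewrite subrr normr0.
have [_ _ reg0] := he t0 tt0.
have [bv bx bY _] := green_bounded T.
have bX : bounded_field X (c t0).
  have [g tg _] := curve_tangency reg0 ht0 t0E.
  have [r r0 [b1 b2]] := grad_trace_bounded tg.
  exact: (green_bounded_at r0 b1 b2).
have sm (eta' : R) : 0 < eta' <= eta -> exists2 r : R, 0 < r & forall z, in_box (c t0) r z ->
    (forall t, `|t - t0| < eta' -> z <> c t) -> smooth_at X z.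
  move=> eta'0.
  have [r1 r10 h1] := @curve_avoid (c t0) t0 eta' ltac:(move=> t ht tt ct;
    have tE : t = t0 by [apply: (around_injective (region_curve SR)) => //; rewrite in_itv/=; lra];
    by move: tt; rewrite tE subrr normr0; case/andP: eta'0 => h _; rewrite leNgt h).
  have [r2 r20 h2] := open_box (closed_openC pos_axis_closed) (curve_off_axis SR ht0).
  exists (Num.min r1 r2); first by rewrite lt_min r10.
  move=> z /in_box_min[/h1 z1 /h2 z2] zc.
  have [Dz|nD] := EM (D z); first exact: green_smooth_in.
  apply: smooth_patch_out => cD.
  have cW : closure W z by apply: closure_subset cD => w [].
  have nW : ~ W z by move=> Wz; apply: nD.
  case: (region_frontier SR cW nW) => [[t ht zt]|[hz z20]].
    have [tl|tl] := ltP `|t - t0| eta'; first exact: (zc t tl).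
    exact: (z1 t ht tl).
  by apply: z2; split => //; have /andP[a0 _] := region_slit SR; lra.
have tan (t : R) : `|t - t0| < eta -> forall e : R, 0 < e -> exists2 d : R, 0 < d &
    forall w, in_box (c t) d w -> `|cv' t * V1 X w - cu' t * V2 X w| < e.
  move=> /he[ht tE reg] e e0; have [g tg hg] := curve_tangency reg ht tE.
  have [t1 t2] := trace_grad tg.
  have ts1 : trace fst D (c t) (c t).1 by apply: (@continuous_trace _ _ fst); exact: cvg_fst.
  have ts2 : trace snd D (c t) (c t).2 by apply: (@continuous_trace _ _ snd); exact: cvg_snd.
  have tk := @trace_cst R D (c t) k.
  have tu := @trace_cst R D (c t) (cu' t).
  have tv := @trace_cst R D (c t) (cv' t).
  have q := traceD (traceM tv (traceD t1 (traceM tk ts1)))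
    (traceN (traceM tu (traceD t2 (traceM tk ts2)))).
  have q0 := trace_bounded0 bv (trace_eq q hg).
  have bw : bounded_on D (fun z => cv' t * jx v z - cu' t * jy v z).
    apply: bounded_onD; first by apply: bounded_onM => //; exact: bounded_on_cst.
    by apply: bounded_onN; apply: bounded_onM => //; exact: bounded_on_cst.
  have q1 := trace_bounded0 bw (potential_curve SP ht).
  have [d1 d10 h] := trace_box (traceD q0 (traceN q1)) e0.
  exists d1 => // w wt; rewrite /= !patchE.
  have [wD|_] := boolP (w \in D); last by rewrite !mulr0 subr0 normr0.
  have := h w wt (set_mem wD); rewrite oppr0 addr0 subr0.
  by congr (_ < _); congr (`| _ |); ring.
have mX := green_measurable.
have [u0|u0] := eqVneq (cu' t0) 0; last first.
  rewrite -cE; apply: (arc_solenoidal eta0 du dv (fun t h => (cc t h).1) (fun t h => (cc t h).2) u0 mX).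
  - by rewrite cE.
  - move=> eta' /sm[r r0 h]; exists r; first exact: r0.
  move=> z zr hz; rewrite cE in zr.
    by apply: h => // t /hz; rewrite cE.
  - by move=> t /tan h e /h[d1 d10 h1]; exists d1 => // w; rewrite cE => /h1.
have v0 : cv' t0 != 0.
  have [_ _ d00] := reg0; apply: contraNneq d00 => v0.
  by rewrite [X in X == _]surjective_pairing; apply/eqP; congr pair.
apply: solenoidal_flip.
have -> : flip (c t0) = (cv t0, cu t0) by [].
have fl w t (r : R) : in_box (cv t, cu t) r w -> in_box (c t) r (flip w).
  by rewrite /in_box /=; case.
have [mf bf] := @field_flip_props R X (c t0).
apply: (arc_solenoidal eta0 dv du (fun t h => (cc t h).2) (fun t h => (cc t h).1) v0 (mf mX)).
- exact: bf bX.
- move=> eta' /sm[r r0 h]; exists r; first exact: r0.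
  move=> z /fl zr hz.
  apply: smooth_flip; apply: h => // t /hz ht zt; apply: ht.
  by rewrite /cu /cv -zt -surjective_pairing.
- move=> t /tan h e /h[d1 d10 h1]; exists d1 => // w /fl /h1 /=.
  by rewrite distrC.
Qed.

(** Every point of the closed region is of one of the types treated above. *)
Theorem green_identity :
  area.-integrable (setT : set mR2) (EFin \o (green_density v \_ D)) /\
  (\int[area]_z ((green_density v \_ D) z)%:E = 0)%E.
Proof.
have cW : compact (closure W).
  have [M M0 hM] := region_bound SR.
  apply: (subclosed_compact (@closed_closure _ W)
    (compact_setX (@segment_compact R (- M) M) (@segment_compact R (- M) M))).
  move=> z cz.
  have cl (f : R * R -> R) : continuous f -> (forall w, W w -> f w < M) -> f z <= M.
    move=> cf hf; have : closed [set w | f w <= M].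
      exact: (closed_comp (fun t _ => cf t) (@closed_le R M)).
    rewrite closure_id => E1; have : closure [set w | f w <= M] z.
      by apply: closure_subset cz => w /hf/ltW.
    by rewrite -E1.
  split; rewrite /= in_itv/= -ler_norml.
    by apply: (cl (fun z => `|z.1|)) => [w|w /hM[]//]; apply: (@cvg_norm); exact: cvg_fst.
  by apply: (cl (fun z => `|z.2|)) => [w|w /hM[]//]; apply: (@cvg_norm); exact: cvg_snd.
apply: (@weak_divergence_global R (V1 X) (V2 X) (Vd X) (closure W)) => //.
  move=> z cz /=; rewrite !patchE memNset//.
  by move=> [Wz _]; apply: cz; exact: subset_closure.
move=> P cP; have [a0 ab] : 0 < a /\ a < b by have /andP[] := region_slit SR.
have [DP|nD] := EM (D P).
  have [r r0 h] := open_box slit_domain_open DP.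
  by apply: (smooth_solenoidal r0 green_measurable) => z /h; exact: green_smooth_in.
have [WP|nW] := EM (W P).
  have [x0 y0] : pos_axis P by apply: contrapT => nP; apply: nD.
  have PE : P = (P.1, 0) by rewrite [LHS]surjective_pairing y0.
  rewrite PE.
  have [xa|xa] := ltP P.1 a.
    have [xp|xp] := ltP 0 P.1; first by apply: passing_solenoidal; rewrite xp.
    have -> : P.1 = 0 by lra.
    exact: origin_solenoidal.
  have [xb|xb] := leP P.1 b.
    by have [_] := segment_outside SR (x := P.1) ltac:(lra); rewrite -PE.
  by have := ray_outside SR xb; rewrite -PE.
case: (region_frontier SR cP nW) => [[t ht Pt]|[hx y0]].
  have [t0|t0] := ltrP 0 t; last first.
    have t00 : t = 0 by lra.
    by apply: exceptional_solenoidal; right; left; rewrite Pt t00 (around_start (region_curve SR)).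
  have [t1|t1] := ltrP t 1; last first.
    have t11 : t = 1 by lra.
    by apply: exceptional_solenoidal; left; rewrite Pt t11 (around_end (region_curve SR)).
  have tt : 0 < t < 1 by rewrite t0.
  have [tE|tE] := boolP (t \in E).
    by apply: exceptional_solenoidal; right; right; exists t.
  by rewrite Pt; exact: regular_solenoidal.
have PE : P = (P.1, 0) by rewrite [LHS]surjective_pairing y0.
have [xa|xa] := eqVneq P.1 a.
  by apply: exceptional_solenoidal; left; rewrite PE xa.
have [xb|xb] := eqVneq P.1 b.
  by apply: exceptional_solenoidal; right; left; rewrite PE xb.
rewrite PE; apply: reflecting_solenoidal.
by case/andP: hx => h1 h2; rewrite !lt_neqAle xb h1 h2 eq_sym xa.
Qed.
End Test.

End GreenIdentity2.

(** * Majorants of rings *)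

Section Majorant.
Context {R : realType}.
Local Notation leb := (@lebesgue_measure R).
Local Notation mR := (measurableTypeR R).
Local Notation mR2 := (measurableTypeR R * measurableTypeR R)%type.
Implicit Types (F G : R * R -> R) (e z : R * R).

Definition summable F : Prop := area.-integrable (setT : set mR2) (EFin \o F).
Definition total F : R := \int[area]_z F z.

Lemma summableD F G : summable F -> summable G -> summable (fun z => F z + G z).
Proof. by move=> f g; exact: (@integrableD _ _ _ _ _ measurableT _ _ f g). Qed.

Lemma summableZ (k : R) F : summable F -> summable (fun z => k * F z).
Proof. by move=> f; exact: (@integrableZl _ _ _ _ _ measurableT k _ f). Qed.

Lemma summableB F G : summable F -> summable G -> summable (fun z => F z - G z).
Proof. by move=> f g; exact: (@integrableB _ _ _ _ _ measurableT _ _ f g). Qed.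

Lemma totalD F G : summable F -> summable G -> total (fun z => F z + G z) = total F + total G.
Proof. by move=> f g; exact: (@RintegralD _ _ _ _ _ _ _ measurableT f g). Qed.

Lemma totalB F G : summable F -> summable G -> total (fun z => F z - G z) = total F - total G.
Proof. by move=> f g; exact: (@RintegralB _ _ _ _ _ _ _ measurableT f g). Qed.

Lemma totalZ (k : R) F : summable F -> total (fun z => k * F z) = k * total F.
Proof. by move=> f; apply: RintegralZl. Qed.

Lemma total_le F G : summable F -> summable G -> (forall z, F z <= G z) -> total F <= total G.
Proof. by move=> f g h; exact: (@le_Rintegral _ _ _ _ _ _ _ measurableT f g (fun z _ => h z)). Qed.

Lemma total_norm_le F G : summable F -> summable G -> (forall z, `|F z| <= G z) -> `|total F| <= total G.
Proof.
move=> f g h; rewrite ler_norml; apply/andP; split.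
  rewrite -mulN1r -totalZ//; apply: total_le => //; first exact: summableZ.
  by move=> z; have := h z; rewrite mulN1r ler_norml => /andP[].
by apply: total_le => // z; have := h z; rewrite ler_norml => /andP[].
Qed.

Lemma total_eq0 F : (\int[area]_z (F z)%:E = 0)%E -> total F = 0.
Proof. by rewrite /total /Rintegral => ->. Qed.

Definition box e (r : R) : set (R * R) := `[e.1 - r, e.1 + r]%classic `*` `[e.2 - r, e.2 + r]%classic.

Definition box_indicator e (r : R) : R * R -> R := \1_(box e r).

Lemma box_measurable e (r : R) : measurable (box e r : set mR2).
Proof. by apply: measurableX; exact: measurable_itv. Qed.

Lemma boxE e (r : R) z : `|z.1 - e.1| <= r -> `|z.2 - e.2| <= r -> box_indicator e r z = 1.
Proof.
move=> h1 h2; rewrite /box_indicator indicE mem_set//.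
by split => /=; rewrite in_itv/= -ler_distl.
Qed.

Lemma box_indicator_itv e (r : R) z : 0 <= box_indicator e r z <= 1.
Proof. by rewrite /box_indicator indicE; case: (_ \in _); rewrite ?lexx ?ler01. Qed.

Lemma box_indicator_eq0 e (r s : R) z : r <= s -> box_indicator e s z = 0 -> box_indicator e r z = 0.
Proof.
move=> rs; rewrite /box_indicator !indicE; have [//|/negP h] := boolP (z \in box e s).
  by move=> _ /eqP; rewrite oner_eq0.
rewrite memNset//; case; rewrite /= !in_itv/= => h1 h2; apply: h; apply/mem_set; split => /=;
  rewrite in_itv/=; lra.
Qed.

Lemma box_summable e (r : R) : 0 <= r -> summable (box_indicator e r) /\ total (box_indicator e r) = (2 * r) ^+ 2.
Proof.
move=> r0; have mB := box_measurable e r.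
have A : area (box e r) = ((2 * r) ^+ 2)%:E.
  have -> : area (box e r) = (leb `[(e.1 - r)%R, (e.1 + r)%R]%classic * leb `[(e.2 - r)%R, (e.2 + r)%R]%classic)%E.
    by apply: product_measure1E; exact: measurable_itv.
  have L (x : R) : leb `[x - r, x + r]%classic = (2 * r)%:E.
    rewrite lebesgue_measure_itv/= lte_fin; case: ifPn => [_|].
      by rewrite -EFinB; congr EFin; ring.
    by rewrite -leNgt => h; congr EFin; lra.
  by rewrite !L -EFinM; congr EFin; ring.
split.
  apply: (@integrable_bounded_support R (box_indicator e r) 1 (`|e.1| + `|e.2| + r)).
  - exact: measurable_indic.
  - by move=> z; have := box_indicator_itv e r z; rewrite ler_norml; lra.
  - move=> z; rewrite /box_indicator indicE; have [/set_mem[/=]|_] := boolP (z \in _); last by rewrite eqxx.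
    rewrite !in_itv/= => h1 h2 _; have := ler_norm e.1; have := ler_norm e.2.
    have := ler_norm (- e.1); have := ler_norm (- e.2); rewrite !normrN !ler_norml.
    have := normr_ge0 e.1; have := normr_ge0 e.2.
    by move=> *; split; apply/andP; split; lra.
rewrite /total /Rintegral integral_indic// setIT A //.
Qed.

(** Dominates the inverse square of the distance to [e] on the ring
    [e^(-4L) < |z - e| < e^(-L)] by boxes of exponentially decreasing sizes: each
    of the [3 L] scales contributes the same amount to the integral.  The first
    term makes the majorant at least [L^2] wherever it is not zero. *)
Definition ring_majorant (L : nat) e z : R :=
  L%:R ^+ 2 * box_indicator e (expR (- L%:R)) z +
  \sum_(j < 3 * L) expR (2 * (L + j).+1%:R) * box_indicator e (expR (- (L + j)%:R)) z.

Lemma summable_sum (n : nat) (F : nat -> R * R -> R) : (forall j, summable (F j)) ->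
  summable (fun z => \sum_(j < n) F j z) /\
  total (fun z => \sum_(j < n) F j z) = \sum_(j < n) total (F j).
Proof.
move=> h; elim: n => [|n [IH1 IH2]].
  rewrite (_ : (fun z => _) = cst 0); last by apply/funext => z; rewrite big_ord0.
  split; first exact: integrable0.
  by rewrite big_ord0 /total Rintegral_cst//= mul0r.
rewrite (_ : (fun z => _) = (fun z => \sum_(j < n) F j z + F n z)); last first.
  by apply/funext => z; rewrite big_ord_recr.
by split; [exact: summableD|rewrite totalD// IH2 big_ord_recr].
Qed.

Lemma ring_majorant_ge0 L e z : 0 <= ring_majorant L e z.
Proof.
rewrite addr_ge0//; first by rewrite mulr_ge0// ?sqr_ge0//; case/andP: (box_indicator_itv e (expR (- L%:R)) z).
apply: sumr_ge0 => j _; by rewrite mulr_ge0 ?expR_ge0.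
Qed.

Lemma ring_majorant_le L e z : ring_majorant L e z <= L%:R ^+ 2 + \sum_(j < 3 * L) expR (2 * (L + j).+1%:R).
Proof.
apply: lerD; first by rewrite ler_piMr ?sqr_ge0//; case/andP: (box_indicator_itv e (expR (- L%:R)) z).
apply: ler_sum => j _; rewrite ler_piMr ?expR_ge0//.
by case/andP: (box_indicator_itv e (expR (- (L + j)%:R)) z).
Qed.

Lemma ring_majorant_gap L e z : ring_majorant L e z = 0 \/ L%:R ^+ 2 <= ring_majorant L e z.
Proof.
have [h|h] := eqVneq (box_indicator e (expR (- L%:R)) z) 0.
  left; rewrite /ring_majorant h mulr0 add0r big1// => j _.
  rewrite (@box_indicator_eq0 e _ (expR (- L%:R)))// ?mulr0//.
  by rewrite ler_expR lerN2 ler_nat leq_addr.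
right; rewrite /ring_majorant; have -> : box_indicator e (expR (- L%:R)) z = 1.
  by move: h; rewrite /box_indicator indicE; case: (_ \in _); rewrite ?eqxx.
rewrite mulr1 lerDl; apply: sumr_ge0 => j _; by rewrite mulr_ge0 ?expR_ge0.
Qed.

Lemma ring_majorant_ring (L : nat) e (u : R) z : `|z.1 - e.1| <= expR (- u) -> `|z.2 - e.2| <= expR (- u) ->
  L%:R <= u < (4 * L)%:R -> expR (2 * u) <= ring_majorant L e z.
Proof.
move=> h1 h2 /andP[Lu uL].
have u0 : 0 <= u by apply: le_trans Lu; rewrite ler0n.
have /andP[t1 t2] := truncn_itv u0; set n := Num.truncn u in t1 t2.
have Ln : (L <= n)%N by rewrite -ltnS -(ltr_nat R); apply: le_lt_trans t2.
have n3 : (n - L < 3 * L)%N.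
  have : (n < 4 * L)%N by rewrite -(ltr_nat R); apply: le_lt_trans uL.
  by rewrite ltn_subLR// -mulSn.
rewrite /ring_majorant (bigD1 (Ordinal n3)) //= subnKC//.
have b1 : box_indicator e (expR (- n%:R)) z = 1.
  by apply: boxE; [apply: le_trans h1 _|apply: le_trans h2 _]; rewrite ler_expR lerN2.
rewrite b1 mulr1 addrCA; apply: ler_wpDr; last first.
  by rewrite ler_expR ler_pM2l//; exact: ltW.
rewrite addr_ge0//; first by rewrite mulr_ge0// ?sqr_ge0//; case/andP: (box_indicator_itv e (expR (- L%:R)) z).
apply: sumr_ge0 => j _; by rewrite mulr_ge0 ?expR_ge0.
Qed.

Lemma ring_majorant_near (L : nat) e z : `|z.1 - e.1| <= expR (- L%:R) -> `|z.2 - e.2| <= expR (- L%:R) ->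
  L%:R ^+ 2 <= ring_majorant L e z.
Proof.
move=> h1 h2; rewrite /ring_majorant boxE// mulr1 lerDl; apply: sumr_ge0 => j _.
by rewrite mulr_ge0 ?expR_ge0//; case/andP: (box_indicator_itv e (expR (- (L + j)%:R)) z).
Qed.

Lemma ring_majorant_total (L : nat) e : (0 < L)%N -> summable (ring_majorant L e) /\
  total (ring_majorant L e) <= (4 + 12 * expR 2) * L%:R.
Proof.
move=> L0.
have b (n : nat) := box_summable e (expR_ge0 (- (n%:R : R))).
pose F (j : nat) := fun z => expR (2 * (L + j).+1%:R) * box_indicator e (expR (- (L + j)%:R)) z.
have sF j : summable (F j) by apply: summableZ; exact: (b (L + j)%N).1.
have tF j : total (F j) = 4 * expR 2.
  rewrite totalZ ?(b (L + j)%N).2; last exact: (b (L + j)%N).1.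
  rewrite exprMn -(natr1 (L + j)) mulrDr expRD mulr1 -expRM_natl.
  have -> : expR (2 * (L + j)%:R) * expR 2 * (2 ^+ 2 * expR (2%:R * - (L + j)%:R)) =
     (expR (2 * (L + j)%:R) * expR (2%:R * - (L + j)%:R)) * (4 * expR 2) :> R by ring.
  by rewrite -expRD mulrN subrr expR0 mul1r.
have [s1 s2] := summable_sum (3 * L) sF.
have s0 : summable (fun z => L%:R ^+ 2 * box_indicator e (expR (- L%:R)) z).
  by apply: summableZ; exact: (b L).1.
split; first exact: summableD.
rewrite [total _](totalD s0 s1) s2 totalZ ?(b L).2; last exact: (b L).1.
under eq_bigr do rewrite tF.
rewrite sumr_const card_ord -[_ *+ (3 * L)%N]mulr_natl natrM.
have L1 : 1 <= L%:R :> R by rewrite ler1n.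
have E1 : L%:R * expR (- L%:R) <= 1 :> R.
  rewrite expRN ler_pdivrMr ?expR_gt0// mul1r; apply: le_trans (expR_ge1Dx _).
  by rewrite lerDr.
have e0 := expR_ge0 (- (L%:R : R)); have e2 := expR_ge0 (2 : R).
have -> : L%:R ^+ 2 * (2 * expR (- L%:R)) ^+ 2 = 4 * (L%:R * expR (- L%:R)) ^+ 2 :> R by ring.
have : (L%:R * expR (- L%:R)) ^+ 2 <= 1 :> R by apply: exprn_ile1 => //; rewrite mulr_ge0.
have -> : 3 * L%:R * (4 * expR 2) = 12 * expR 2 * L%:R :> R by ring.
lra.
Qed.

End Majorant.

(** * Logarithmic cutoffs *)

Section Cutoffs.
Context {R : realType}.
Local Notation mR := (measurableTypeR R).
Local Notation mR2 := (measurableTypeR R * measurableTypeR R)%type.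
Implicit Types (e z : R * R) (L : nat) (f g y : @jet R) (es : seq (R * R)).

(** The Laplacian is the only combination of second derivatives that enters the
    Green identity, so four numbers per point are enough. *)
Definition null_jet f z : Prop := [/\ jv f z = 0, jx f z = 0, jy f z = 0 & lap f z = 0].
Definition flat_jet f z : Prop := [/\ jv f z = 1, jx f z = 0, jy f z = 0 & lap f z = 0].

Lemma null_jetM f g z : null_jet f z \/ null_jet g z -> null_jet (jmul f g) z.
Proof.
by rewrite /null_jet lap_mul /= => -[|] [-> -> -> ->]; rewrite !(mul0r, mulr0, addr0).
Qed.

Lemma flat_jetM f g z : flat_jet f z -> flat_jet g z -> flat_jet (jmul f g) z.
Proof.
by rewrite /flat_jet lap_mul /= => -[-> -> -> ->] [-> -> -> ->]; rewrite !(mul0r, mulr0, addr0, mulr1).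
Qed.

Lemma flat_jetMl f g z : flat_jet f z ->
  [/\ jv (jmul f g) z = jv g z, jx (jmul f g) z = jx g z, jy (jmul f g) z = jy g z
    & lap (jmul f g) z = lap g z].
Proof.
by rewrite lap_mul /= => -[-> -> -> ->]; rewrite !(mul0r, mulr0, addr0, mul1r).
Qed.

Definition offset e z : R * R := (z.1 - e.1, z.2 - e.2).

Lemma offset_neq0 e z : z <> e -> offset e z <> (0, 0).
Proof.
move=> ze [/eqP h1 /eqP h2]; apply: ze; move: h1 h2; rewrite !subr_eq0 => /eqP h1 /eqP h2.
by rewrite [z]surjective_pairing h1 h2 -surjective_pairing.
Qed.

(** Cutoff near [e], a function of [ln |z - e| / L]: it vanishes for
    [|z - e| <= e^(-4L)], equals 1 for [|z - e| >= e^(-L)], and has an energy of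
    order [1 / L]. *)
Definition cut L e : jet :=
  jcomp (fun u => step (L%:R^-1 * u + 4)) (fun u => L%:R^-1 * step1 (L%:R^-1 * u + 4))
    (fun u => L%:R^-1 * (L%:R^-1 * step2 (L%:R^-1 * u + 4))) (jshift e jln).

Lemma derive_rescale (h h1 : R -> R) (k q u : R) : (forall u : R, is_derive u 1 h (h1 u)) ->
  is_derive u 1 (fun u : R => h (k * u + q)) (k * h1 (k * u + q)).
Proof.
move=> dh; have d1 : is_derive u 1 (fun u : R => k * u + q) k.
  apply: (is_derive_to (derive_add (derive_scale k (is_derive_id u 1)) (is_derive_cst q u 1))).
  by rewrite mulr1 addr0.
exact: (is_derive_to (@is_derive1_comp R h (fun u : R => k * u + q) u _ _ (dh _) d1) (mulrC _ _)).
Qed.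

Lemma cut_jet L e z : z <> e -> is_jet (cut L e) z.
Proof.
move=> ze; apply: is_jet_comp.
- by apply: is_jet_shift; apply: is_jet_ln; exact: offset_neq0.
- by move=> u; apply: derive_rescale => v; exact: step_derive.
- by move=> u; apply: derive_scale; apply: derive_rescale => v; exact: step1_derive.
- move=> u.
  have c1 : {for u, continuous (fun u : R => L%:R^-1 * u + 4 : R)}.
    apply: cvgD; last exact: cvg_cst.
    by apply: cvgM; [exact: cvg_cst|exact: cvg_id].
  have c2 := @continuous_comp _ _ _ _ step2 u c1 (@step2_continuous R _).
  by apply: cvgM; [exact: cvg_cst|apply: cvgM; [exact: cvg_cst|exact: c2]].
Qed.

Lemma cut_valueE L e z : [/\ jv (cut L e) z = step (L%:R^-1 * lnm (offset e z) + 4),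
  jx (cut L e) z = jx jln (offset e z) * (L%:R^-1 * step1 (L%:R^-1 * lnm (offset e z) + 4)),
  jy (cut L e) z = jy jln (offset e z) * (L%:R^-1 * step1 (L%:R^-1 * lnm (offset e z) + 4))
  & lap (cut L e) z = L%:R^-1 * (L%:R^-1 * step2 (L%:R^-1 * lnm (offset e z) + 4)) *
      (jx jln (offset e z) ^+ 2 + jy jln (offset e z) ^+ 2)].
Proof.
split => //; rewrite lap_comp; have -> : lap (jshift e jln) z = lap jln (offset e z) by [].
by rewrite lap_ln mulr0 add0r.
Qed.

Lemma cut_null L e z : (0 < L)%N -> z <> e -> modulus (offset e z) <= expR (- (4 * L%:R)) ->
  null_jet (cut L e) z.
Proof.
move=> L0 /offset_neq0 /modulus_gt0 r0 hr; have L0' : 0 < L%:R :> R by rewrite ltr0n.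
have h : lnm (offset e z) <= - (4 * L%:R) by rewrite /lnm -[leRHS]expRK ler_ln// posrE expR_gt0.
have [s0 s1 s2] : [/\ step (L%:R^-1 * lnm (offset e z) + 4) = 0,
    step1 (L%:R^-1 * lnm (offset e z) + 4) = 0 & step2 (L%:R^-1 * lnm (offset e z) + 4) = 0].
  apply: step_le0; rewrite -(ler_pM2l L0') mulr0 mulrDr mulrA divff ?gt_eqF// mul1r; lra.
by rewrite /null_jet; have [-> -> -> ->] := cut_valueE L e z; rewrite s0 s1 s2 !(mulr0, mul0r).
Qed.

Lemma cut_flat L e z : (0 < L)%N -> expR (- L%:R) <= modulus (offset e z) -> flat_jet (cut L e) z.
Proof.
move=> L0 hr; have L0' : 0 < L%:R :> R by rewrite ltr0n.
have r0 : 0 < modulus (offset e z) by apply: lt_le_trans hr; exact: expR_gt0.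
have h : - L%:R <= lnm (offset e z) by rewrite /lnm -[leLHS]expRK ler_ln// posrE expR_gt0.
have [s0 s1 s2] : [/\ step (L%:R^-1 * lnm (offset e z) + 4) = 1,
    step1 (L%:R^-1 * lnm (offset e z) + 4) = 0 & step2 (L%:R^-1 * lnm (offset e z) + 4) = 0].
  apply: step_ge3; rewrite -(ler_pM2l L0') (mulrDr _ (L%:R^-1 * _)) mulrA divff ?gt_eqF// mul1r; lra.
by rewrite /flat_jet; have [-> -> -> ->] := cut_valueE L e z; rewrite s0 s1 s2 !(mulr0, mul0r).
Qed.

(** Bounds stable under products: a cutoff differs from 1, and has squared
    gradient and Laplacian, of order [m / L^2], where [m] is the majorant. *)
Record estimate (C : R) L y (m : R) z : Prop := {
  estimate_value : `|jv y z| <= C;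
  estimate_one : `|1 - jv y z| * L%:R ^+ 2 <= C * m;
  estimate_grad : (jx y z ^+ 2 + jy y z ^+ 2) * L%:R ^+ 2 <= C * m;
  estimate_lap : `|lap y z| * L%:R ^+ 2 <= C * m }.

Lemma cut_estimate L e z : (0 < L)%N -> z <> e ->
  estimate (100 ^+ 2) L (cut L e) (ring_majorant L e z) z.
Proof.
have [K100 K99] : (100 : R) <= 100 ^+ 2 /\ (99 : R) ^+ 2 <= 100 ^+ 2 by split; lra.
move: (100 ^+ 2) K100 K99 => K K100 K99.
move=> L0 ze; have L0' : 0 < L%:R :> R by rewrite ltr0n.
have m0 := ring_majorant_ge0 L e z.
have o0 := offset_neq0 ze; have r0 := modulus_gt0 o0.
have b1 : `|z.1 - e.1| <= modulus (offset e z) := modulus_ge1 (offset e z).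
have b2 : `|z.2 - e.2| <= modulus (offset e z) := modulus_ge2 (offset e z).
have L2 : 0 <= L%:R ^+ 2 :> R by exact: sqr_ge0.
have [far|near] := leP (expR (- L%:R)) (modulus (offset e z)).
  have [v0 v1 v2 vl] := cut_flat L0 far.
  have mm : 0 <= K * ring_majorant L e z by apply: mulr_ge0 => //; lra.
  split; rewrite ?v0 ?v1 ?v2 ?vl ?subrr ?expr0n /= ?addr0 ?normr0 ?mul0r ?normr1//; lra.
have mL : L%:R ^+ 2 <= ring_majorant L e z.
  by apply: ring_majorant_near; [apply: le_trans b1 _|apply: le_trans b2 _]; exact: ltW.
have [close|mid] := leP (modulus (offset e z)) (expR (- (4 * L%:R))).
  have [v0 v1 v2 vl] := cut_null L0 ze close.
  have mm : 0 <= K * ring_majorant L e z by apply: mulr_ge0 => //; lra.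
  have mK : L%:R ^+ 2 <= K * ring_majorant L e z.
    by apply: le_trans mL _; rewrite ler_peMl//; lra.
  split; rewrite ?v0 ?v1 ?v2 ?vl ?subr0 ?expr0n /= ?addr0 ?normr0 ?mul0r ?normr1 ?mul1r//; lra.
pose u := - lnm (offset e z).
have ru : expR (- u) = modulus (offset e z) by rewrite /u opprK expR_lnm.
have hu : L%:R <= u < (4 * L)%:R.
  rewrite natrM /u; apply/andP; split.
    by rewrite lerNr -ler_expR expR_lnm// ltW.
  by rewrite ltrNl -ltr_expR expR_lnm.
have mE := ring_majorant_ring (e := e) (u := u) (z := z) ltac:(by rewrite ru) ltac:(by rewrite ru) hu.
have gE : jx jln (offset e z) ^+ 2 + jy jln (offset e z) ^+ 2 = expR (2 * u).
  rewrite (grad_ln o0) -modulus_sq -ru -expRM_natl -expRN; congr expR; ring.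
have [v0 v1 v2 vl] := cut_valueE L e z.
move: gE v1 v2 vl; move: (jx jln (offset e z)) (jy jln (offset e z)) => A B gE v1 v2 vl.
have [s0 s1 s2] := step_bounded (L%:R^-1 * lnm (offset e z) + 4).
move: s0 s1 s2 v0 v1 v2 vl; move: (step _) (step1 _) (step2 _) => q s s' s0 s1 s2 v0 v1 v2 vl.
have eu := expR_ge0 (2 * u).
have Ln0 : L%:R != 0 :> R by rewrite gt_eqF.
split.
- by rewrite v0; lra.
- rewrite v0; apply: ler_pM => //; apply: le_trans (ler_normB _ _) _; rewrite normr1; lra.
- rewrite v1 v2 !exprMn -mulrDl gE.
  rewrite [leLHS](_ : _ = s ^+ 2 * expR (2 * u)); last by field.
  apply: ler_pM => //; first exact: sqr_ge0.
  apply: le_trans K99; rewrite -real_normK ?num_real//.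
  by rewrite ler_pXn2r ?nnegrE// ler0n.
- rewrite vl gE.
  have i0 : 0 <= L%:R^-1 :> R by rewrite invr_ge0 ltW.
  have -> : `|L%:R^-1 * (L%:R^-1 * s') * expR (2 * u)| * L%:R ^+ 2 = `|s'| * expR (2 * u).
    by rewrite !normrM (ger0_norm eu) (ger0_norm i0); field.
  by apply: ler_pM => //; lra.
Qed.

(** Products of cutoffs may overlap: the cross term [2 grad f . grad g] is at
    most [|grad f|^2 + |grad g|^2]. *)
Lemma estimateM (C1 C2 m1 m2 : R) L f g z : 1 <= C1 -> 1 <= C2 -> 0 <= m1 -> 0 <= m2 ->
  estimate C1 L f m1 z -> estimate C2 L g m2 z ->
  estimate (4 * (C1 ^+ 2 * C2 ^+ 2)) L (jmul f g) (m1 + m2) z.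
Proof.
move=> C11 C21 m10 m20 [f1 f2 f3 f4] [g1 g2 g3 g4].
have L2 : 0 <= L%:R ^+ 2 :> R by exact: sqr_ge0.
move: f2 f3 f4 g2 g3 g4.
set M := L%:R ^+ 2; set F := jv f z in f1 *; set G := jv g z in g1 *.
set Fx := jx f z; set Fy := jy f z; set Gx := jx g z; set Gy := jy g z.
set Fl := lap f z; set Gl := lap g z => f2 f3 f4 g2 g3 g4.
have F0 := normr_ge0 F; have G0 := normr_ge0 G.
have fsq : F ^+ 2 <= C1 ^+ 2 by rewrite -real_normK ?num_real// ler_pXn2r ?nnegrE//; lra.
have gsq : G ^+ 2 <= C2 ^+ 2 by rewrite -real_normK ?num_real// ler_pXn2r ?nnegrE//; lra.
pose K := C1 ^+ 2 * C2 ^+ 2.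
have C1s : C1 <= C1 ^+ 2 by rewrite expr2 ler_peMl//; lra.
have C2s : C2 <= C2 ^+ 2 by rewrite expr2 ler_peMl//; lra.
have k12 : C1 * C2 <= K by apply: ler_pM => //; lra.
have k1 : C1 <= C1 * C2 by rewrite ler_peMr//; lra.
have k2 : C2 <= C1 * C2 by rewrite ler_peMl//; lra.
have k122 : C1 ^+ 2 * C2 <= K by apply: ler_wpM2l => //; exact: sqr_ge0.
have k112 : C2 ^+ 2 * C1 <= K by rewrite mulrC; apply: ler_wpM2r => //; exact: sqr_ge0.
have Km1 c : c <= K -> c * m1 <= K * m1 by move=> h; exact: ler_wpM2r.
have Km2 c : c <= K -> c * m2 <= K * m2 by move=> h; exact: ler_wpM2r.
have P1 : 0 <= C1 * m1 by apply: mulr_ge0 => //; lra.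
have P2 : 0 <= C2 * m2 by apply: mulr_ge0 => //; lra.
have Km10 : 0 <= K * m1 by apply: le_trans (Km1 C1 _); lra.
have Km20 : 0 <= K * m2 by apply: le_trans (Km2 C2 _); lra.
rewrite -/K; clearbody K; split; rewrite /= -/F -/G.
- by rewrite normrM; apply: le_trans (_ : C1 * C2 <= _); [exact: ler_pM|lra].
- have -> : 1 - F * G = (1 - F) + F * (1 - G) by ring.
  apply: le_trans (_ : `|1 - F| * M + `|F| * (`|1 - G| * M) <= _).
    by rewrite mulrA -mulrDl; apply: ler_wpM2r => //; rewrite -normrM; exact: ler_normD.
  have : `|F| * (`|1 - G| * M) <= C1 * (C2 * m2) by apply: ler_pM => //; exact: mulr_ge0.
  by rewrite mulrA; have := Km1 C1 ltac:(lra); have := Km2 (C1 * C2) k12; lra.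
- rewrite -/Fx -/Fy -/Gx -/Gy.
  apply: le_trans (_ : 2 * (F ^+ 2 * ((Gx ^+ 2 + Gy ^+ 2) * M)) + 2 * (G ^+ 2 * ((Fx ^+ 2 + Fy ^+ 2) * M)) <= _).
    have -> : 2 * (F ^+ 2 * ((Gx ^+ 2 + Gy ^+ 2) * M)) + 2 * (G ^+ 2 * ((Fx ^+ 2 + Fy ^+ 2) * M)) =
      ((F * Gx + G * Fx) ^+ 2 + (F * Gy + G * Fy) ^+ 2) * M +
      ((F * Gx - G * Fx) ^+ 2 + (F * Gy - G * Fy) ^+ 2) * M by ring.
    by rewrite lerDl mulr_ge0// addr_ge0 ?sqr_ge0.
  have q1 : F ^+ 2 * ((Gx ^+ 2 + Gy ^+ 2) * M) <= C1 ^+ 2 * (C2 * m2).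
    by apply: ler_pM => //; rewrite ?sqr_ge0// mulr_ge0// addr_ge0 ?sqr_ge0.
  have q2 : G ^+ 2 * ((Fx ^+ 2 + Fy ^+ 2) * M) <= C2 ^+ 2 * (C1 * m1).
    by apply: ler_pM => //; rewrite ?sqr_ge0// mulr_ge0// addr_ge0 ?sqr_ge0.
  have q3 := Km2 _ k122; have q4 := Km1 _ k112; rewrite -mulrA in q3; rewrite -mulrA in q4.
  move: q1 q2 q3 q4 Km10 Km20; move: (F ^+ 2 * _) (G ^+ 2 * _) (C1 ^+ 2 * _) (C2 ^+ 2 * _) => x1 x2 x3 x4.
  by rewrite -mulrA (mulrDr K); move: (K * m1) (K * m2) => x5 x6; lra.
- rewrite lap_mul -/F -/G -/Fx -/Fy -/Gx -/Gy -/Fl -/Gl.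
  have dot2 : `|2 * (Fx * Gx + Fy * Gy)| * M <= C1 * m1 + C2 * m2.
    apply: le_trans (_ : (Fx ^+ 2 + Fy ^+ 2) * M + (Gx ^+ 2 + Gy ^+ 2) * M <= _); last exact: lerD.
    rewrite -mulrDl; apply: ler_wpM2r => //; rewrite ler_norml.
    have s1 := sqr_ge0 (Fx + Gx); have s2 := sqr_ge0 (Fy + Gy).
    have s3 := sqr_ge0 (Fx - Gx); have s4 := sqr_ge0 (Fy - Gy).
    rewrite !(sqrrD, sqrrB) in s1 s2 s3 s4.
    by apply/andP; split; lra.
  have tri (x1 x2 x3 : R) : `|x1 + x2 + x3| <= `|x1| + `|x2| + `|x3|.
    by apply: le_trans (ler_normD _ _) _; rewrite lerD2r; exact: ler_normD.
  apply: le_trans (ler_wpM2r L2 (tri _ _ _)) _.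
  have q1 : `|F| * (`|Gl| * M) <= C1 * (C2 * m2) by apply: ler_pM => //; exact: mulr_ge0.
  have q2 : `|G| * (`|Fl| * M) <= C2 * (C1 * m1) by apply: ler_pM => //; exact: mulr_ge0.
  rewrite (normrM F) (normrM G) (mulrDl (_ + _) _ M) (mulrDl (`|F| * _) _ M).
  rewrite mulrA (mulrA C1) in q1; rewrite mulrA (mulrA C2) (mulrC C2) in q2.
  have := Km2 _ k12; have := Km1 _ k12; have := Km1 C1 ltac:(lra); have := Km2 C2 ltac:(lra).
  move: q1 q2 dot2 Km10 Km20; rewrite -(mulrA 4) (mulrDr K).
  move: (`|F| * `|Gl| * M) (`|G| * `|Fl| * M) (`|_| * M) (C1 * C2 * m1) (C1 * C2 * m2).
  move: (K * m1) (K * m2) (C1 * m1) (C2 * m2) => x1 x2 x3 x4 x5 x6 x7 x8 x9; lra.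
Qed.

Definition cut_product L es : jet := foldr (fun e y => jmul (cut L e) y) (jcst 1) es.
Definition majorant L es z : R := foldr (fun e m => ring_majorant L e z + m) 0 es.

Lemma majorant_ge0 L es z : 0 <= majorant L es z.
Proof. by elim: es => //= e es IH; rewrite addr_ge0// ring_majorant_ge0. Qed.

Lemma majorant_gap L es z : majorant L es z = 0 \/ L%:R ^+ 2 <= majorant L es z.
Proof.
elim: es => [|e es IH] /=; first by left.
have h1 := ring_majorant_ge0 L e z; have h2 := majorant_ge0 L es z.
case: (ring_majorant_gap L e z) => [->|h]; last by right; lra.
by rewrite add0r.
Qed.

Lemma majorant_bounded L es : exists C : R, forall z, majorant L es z <= C.
Proof.
elim: es => [|e es [C hC]]; first by exists 0.
by eexists => z; apply: lerD; [exact: ring_majorant_le|exact: hC].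
Qed.

Lemma majorant_total es : exists2 K : R, 0 <= K & forall L, (0 < L)%N ->
  summable (majorant L es) /\ total (majorant L es) <= K * L%:R.
Proof.
elim: es => [|e es [K K0 IH]].
  exists 0 => // L L0; split; first exact: integrable0.
  by rewrite mul0r /total /majorant /= Rintegral_cst//= mul0r.
exists (4 + 12 * expR 2 + K); first by have := expR_ge0 (2 : R); lra.
move=> L L0; have [s1 t1] := ring_majorant_total e L0; have [s2 t2] := IH L L0.
split; first exact: summableD s1 s2.
by rewrite [total _](totalD s1 s2) mulrDl lerD.
Qed.

(** Uniformity in the scale [L] is what makes the error of the cutoffs tend to
    zero. *)
Lemma cut_product_estimate es : exists2 C : R, 1 <= C & forall L z, (0 < L)%N ->
  (forall e, e \in es -> z <> e) -> estimate C L (cut_product L es) (majorant L es z) z.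
Proof.
elim: es => [|e es [C C1 IH]].
  exists 1 => // L z L0 _.
  by split; rewrite /lap /=; rewrite ?subrr ?normr1 ?normr0 ?mul0r ?mulr0 ?expr0n /= ?addr0 ?mul0r ?normr0 ?mul0r.
exists (4 * ((100 ^+ 2) ^+ 2 * C ^+ 2)) => [|L z L0 hz].
  have h1 : 1 <= C ^+ 2 by rewrite exprn_ege1.
  have h2 : (1 : R) <= (100 ^+ 2) ^+ 2 by rewrite !exprn_ege1// ler1n.
  have : 1 <= (100 ^+ 2) ^+ 2 * C ^+ 2 by apply: le_trans h1 _; rewrite ler_peMl// sqr_ge0.
  by move: (_ ^+ 2 * _) => x x1; lra.
apply: estimateM; [by rewrite exprn_ege1// ler1n|exact: C1|exact: ring_majorant_ge0|exact: majorant_ge0| |].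
- by apply: cut_estimate => //; apply: hz; rewrite mem_head.
- by apply: IH => // e' he'; apply: hz; rewrite inE he' orbT.
Qed.

(** As the majorant is at least [L^2] where it is not zero, a bound of order
    [m / L^2] on the squared gradient gives the same bound on the gradient. *)
Lemma estimate_partial (C : R) L y (m : R) z : 1 <= C -> (m = 0 \/ L%:R ^+ 2 <= m) -> estimate C L y m z ->
  `|jx y z| * L%:R ^+ 2 <= C * m /\ `|jy y z| * L%:R ^+ 2 <= C * m.
Proof.
move=> C1 gap [_ _ h _].
have L2 : 0 <= L%:R ^+ 2 :> R by exact: sqr_ge0.
have K (t : R) : t ^+ 2 * L%:R ^+ 2 <= C * m -> `|t| * L%:R ^+ 2 <= C * m.
  move=> ht; case: gap => [m0|mL].
    rewrite m0 mulr0 in ht *; have [->|Ln] := eqVneq (L%:R ^+ 2 : R) 0; first by rewrite mulr0.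
    have Lp : 0 < L%:R ^+ 2 :> R by rewrite lt_neqAle eq_sym Ln.
    rewrite pmulr_lle0// in ht; have /eqP : t ^+ 2 = 0 by apply/eqP; rewrite eq_le ht sqr_ge0.
    by rewrite sqrf_eq0 => /eqP ->; rewrite normr0 mul0r.
  have m0 : 0 <= m by apply: le_trans mL.
  have Cm : 0 <= C * m by rewrite mulr_ge0//; lra.
  rewrite -(@ler_pXn2r _ 2) ?nnegrE ?(mulr_ge0 (normr_ge0 _) L2)//.
  rewrite exprMn real_normK ?num_real// (expr2 (L%:R ^+ 2)) mulrA expr2.
  apply: ler_pM => //; first by rewrite mulr_ge0// sqr_ge0.
  by apply: le_trans mL _; rewrite ler_peMl.
split; apply: K; apply: le_trans h; apply: ler_wpM2r => //.
- by rewrite lerDl sqr_ge0.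
- by rewrite lerDr sqr_ge0.
Qed.

Lemma cut_product_null L es e z : (0 < L)%N -> e \in es -> z <> e ->
  modulus (offset e z) <= expR (- (4 * L%:R)) -> null_jet (cut_product L es) z.
Proof.
move=> L0 + ze h; elim: es => //= e' es IH; rewrite inE => /orP[/eqP <-|/IH n].
  by apply: null_jetM; left; exact: cut_null.
by apply: null_jetM; right.
Qed.

Lemma cut_product_flat L es z : (0 < L)%N ->
  (forall e, e \in es -> expR (- L%:R) <= modulus (offset e z)) -> flat_jet (cut_product L es) z.
Proof.
move=> L0; elim: es => [|e es IH] h.
  by split => //; rewrite /lap /= addr0.
apply: flat_jetM; first by apply: cut_flat => //; apply: h; rewrite mem_head.
by apply: IH => e' he'; apply: h; rewrite inE he' orbT.
Qed.

End Cutoffs.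

(** * Multipliers and exceptional points *)

Section Multipliers.
Context {R : realType}.
Implicit Types (e z : R * R) (L : nat) (f g y : @jet R) (S : set (R * R)).
Variables (p a b : R) (W : set (R * R)) (c : R -> R * R) (E : seq R).
Hypothesis SR : slit_region a b W c E.

Local Notation D := (W `\` pos_axis).

Definition bounded4 S f : Prop :=
  [/\ bounded_on S (jv f), bounded_on S (jx f), bounded_on S (jy f) & bounded_on S (lap f)].

Lemma bounded4M S f g : bounded4 S f -> bounded4 S g -> bounded4 S (jmul f g).
Proof.
move=> [f0 f1 f2 f3] [g0 g1 g2 g3].
have l : bounded_on S (lap (jmul f g)).
  rewrite (_ : lap (jmul f g) = fun z => jv f z * lap g z + jv g z * lap f z +
    2 * (jx f z * jx g z + jy f z * jy g z)); last by apply/funext => z; exact: lap_mul.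
  apply: bounded_onD; first by apply: bounded_onD; apply: bounded_onM.
  by apply: bounded_onM; [exact: bounded_on_cst|apply: bounded_onD; apply: bounded_onM].
by split => //; [apply: bounded_onM|apply: bounded_onD; apply: bounded_onM|
  apply: bounded_onD; apply: bounded_onM].
Qed.

Lemma bounded4S S S' f : S `<=` S' -> bounded4 S' f -> bounded4 S f.
Proof. by move=> h [? ? ? ?]; split; apply: bounded_onS h _. Qed.

Lemma jet_bounded4 S f : jet_bounded S f -> bounded4 S f.
Proof. by move=> [[? ? ?] [? ? ?]]; split => //; exact: bounded_onD. Qed.

(** Functions by which an adjoint solution may be multiplied without losing its
    boundary conditions on the slit. *)
Record multiplier y : Prop := {
  multiplier_jet : forall z, D z -> is_jet y z;
  multiplier_axis : forall x : R, 0 < x < b -> x != a -> is_jet y (x, 0) /\ jy y (x, 0) = 0;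
  multiplier_bounded : forall d : R, 0 < d -> bounded4 (D `&` [set z | d <= modulus z]) y }.

Lemma multiplierM f g : multiplier f -> multiplier g -> multiplier (jmul f g).
Proof.
move=> [f1 f2 f3] [g1 g2 g3]; split.
- by move=> z Dz; apply: is_jet_mul; [exact: f1|exact: g1].
- move=> x hx xa; have [jf f0] := f2 x hx xa; have [jg g0] := g2 x hx xa.
  by split; [exact: is_jet_mul|rewrite /= f0 g0 !mulr0 addr0].
- by move=> d d0; apply: bounded4M; [exact: f3|exact: g3].
Qed.

Lemma multiplier_one : multiplier (jcst 1).
Proof.
split; [by move=> z _; exact: is_jet_cst|by move=> x _ _; split; [exact: is_jet_cst|]|].
by move=> d _; apply: jet_bounded4; exact: jet_bounded_cst.
Qed.

Lemma region_modulus : exists2 M : R, 0 < M & forall z, W z -> modulus z <= M.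
Proof.
have [M M0 hM] := region_bound SR; exists (M + M); first by rewrite addr_gt0.
move=> z /hM[/ltW h1 /ltW h2]; apply: le_trans (modulus_le z) _; exact: lerD.
Qed.

(** The adjoint solution brings the conditions on the slit, the multiplier the
    zeros at the exceptional points and at the origin. *)
Lemma green_test_mul f y : adjoint p f -> multiplier y ->
  (forall P, exceptional a b c E P -> exists2 r : R, 0 < r & forall z,
    in_box P r z -> D z -> null_jet y z) ->
  (exists2 d : R, 0 < d & forall z, D z -> modulus z < d -> null_jet y z) ->
  green_test p a b W c E (jmul f y).
Proof.
move=> [f1 f2 f3 f4] [y1 y2 y3] nex n0; split.
- by move=> z Dz; apply: is_jet_mul; [apply: f1; case: Dz|exact: y1].
- move=> P /nex[r r0 h]; exists r => // z Pz Dz; apply: null_jetM; right; exact: h.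
- by have [d d0 h] := n0; exists d => // z Dz zd; apply: null_jetM; right; exact: h.
- move=> x hx xa; have [jyx y0] := y2 x hx xa.
  have x0 : 0 < x by case/andP: hx.
  have [l [lx [mx [my [[u1 u2 u3] [l1 l2 l3]]]]]] := f3 x x0.
  have [c1 c2 c3] := is_jet_continuous jyx.
  have T S (h : R * R -> R) : {for (x, 0), continuous h} -> trace h S (x, 0) (h (x, 0)).
    exact: continuous_trace.
  exists (l * jv y (x, 0)); do 3 eexists; split; split => /=.
  + exact: traceM u1 (T _ _ c1).
  + exact: traceD (traceM u1 (T _ _ c2)) (traceM (T _ _ c1) u2).
  + apply: (trace_eq (traceD (traceM u1 (T _ _ c3)) (traceM (T _ _ c1) u3))).
    by rewrite y0 !mulr0 addr0.
  + by apply: (trace_eq (traceM l1 (T _ _ c1))); rewrite mulrA.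
  + exact: traceD (traceM l1 (T _ _ c2)) (traceM (T _ _ c1) l2).
  + exact: traceD (traceM l1 (T _ _ c3)) (traceM (T _ _ c1) l3).
- have [d d0 h] := n0; have [M M0 hM] := region_modulus.
  have bf : bounded4 (D `&` [set z | d <= modulus z]) f.
    apply: (@bounded4S _ (~` pos_axis `&` annulus d M)); last exact: jet_bounded4 (f4 d M d0).
    by move=> z [[Wz nz] /= zd]; split => //; rewrite /annulus /= zd hM.
  have [b0 b1 b2 b3] := bounded4M bf (y3 d d0).
  have K (g : R * R -> R) : (forall z, null_jet (jmul f y) z -> g z = 0) ->
      bounded_on (D `&` [set z | d <= modulus z]) g -> bounded_on D g.
    move=> g0 [C hC]; exists `|C| => z Dz; have [zd|zd] := leP d (modulus z).
      by apply: le_trans (hC z (conj Dz zd)) (ler_norm C).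
    by rewrite g0 ?normr0//; apply: null_jetM; right; exact: h.
  by split; apply: K => // z [].
Qed.

Definition special_points : seq (R * R) :=
  (a, 0) :: (b, 0) :: [seq c t | t <- E & (0 < t < 1)].

Lemma exceptional_special P : exceptional a b c E P -> P \in special_points.
Proof.
rewrite /special_points !inE => -[->|[->|[t [ht tE] ->]]]; rewrite ?eqxx ?orbT//.
by apply/orP; right; apply/orP; right; apply/mapP; exists t => //; rewrite mem_filter ht.
Qed.

Lemma special_case e : e \in special_points -> ~ W e /\
  (e = (a, 0) \/ e = (b, 0) \/ ~ pos_axis e).
Proof.
have [a0 ab] : 0 < a /\ a < b by have /andP[] := region_slit SR.
rewrite /special_points !inE => /or3P[/eqP ->|/eqP ->|/mapP[t + ->]].
- by split; [apply: (segment_outside SR (x := a) _).2; lra|left].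
- by split; [apply: (segment_outside SR (x := b) _).2; lra|right; left].
- rewrite mem_filter => /andP[ht _]; split; first by apply: (curve_outside SR (t := t) _).2; lra.
  by right; right; exact: (curve_off_axis SR ht).
Qed.

Lemma domain_special z e : D z -> e \in (0, 0) :: special_points -> z <> e.
Proof.
move=> [Wz nz]; rewrite inE => /orP[/eqP ->|/special_case[We _]] ze; last by apply: We; rewrite -ze.
by apply: nz; rewrite ze; split => /=.
Qed.

Lemma axis_special (x : R) e : 0 < x < b -> x != a -> e \in (0, 0) :: special_points -> (x, 0) <> e.
Proof.
move=> hx xa; rewrite inE => /orP[/eqP -> [x0]|/special_case[_ [->|[->|na]]]].
- by move: hx; rewrite x0 ltxx.
- by case=> xE; rewrite xE eqxx in xa.
- by case=> xE; move: hx; rewrite xE ltxx andbF.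
- by move=> xe; apply: na; rewrite -xe; split => //=; case/andP: hx => /ltW.
Qed.

Lemma expR_small (r : R) : 0 < r -> exists L0 : nat, forall L, (L0 <= L)%N -> expR (- L%:R) <= r.
Proof.
move=> r0; exists (Num.truncn r^-1).+1 => L hL.
rewrite expRN -[leRHS]invrK lef_pV2 ?posrE ?expR_gt0 ?invr_gt0//.
have i0 : 0 <= r^-1 by rewrite invr_ge0 ltW.
have /andP[_ /ltW h] := truncn_itv i0; apply: (le_trans h).
apply: le_trans (_ : 1 + L%:R <= _); last exact: expR_ge1Dx.
by rewrite ler_wpDl// ler_nat.
Qed.

(** For a point on the axis a radial function has no vertical derivative along
    the slit; for the others the cutoff must be constant there. *)
Definition isolated (r : R) e : Prop := r <= modulus e / 2 /\
  (e.2 = 0 \/ forall x : R, 0 <= x -> r <= modulus (offset e (x, 0))).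

(** A common radius: the discs around the special points stay away from the
    origin, and from the slit unless they are centred on the axis. *)
Lemma special_isolated : exists2 r : R, 0 < r & forall e, e \in special_points -> isolated r e.
Proof.
have one e : e \in special_points -> exists2 r : R, 0 < r & isolated r e.
  move=> /special_case[We he].
  have e0 : e <> (0, 0) by move=> ee; apply: We; rewrite ee; exact: region_origin SR.
  have m0 := modulus_gt0 e0.
  case: he => [ea|[eb|na]].
  - exists (modulus e / 2); first by rewrite divr_gt0.
    by split => //; left; rewrite ea.
  - exists (modulus e / 2); first by rewrite divr_gt0.
    by split => //; left; rewrite eb.
  - have [r r0 h] := open_box slit_open na.
    exists (Num.min (modulus e / 2) r); first by rewrite lt_min divr_gt0.
    split; first by rewrite ge_min lexx.
    right => x x0; rewrite ge_min; apply/orP; right; rewrite leNgt; apply/negP => hr.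
    apply: (h (x, 0)); last by split.
    by split; apply: le_lt_trans hr; [exact: (modulus_ge1 (offset e (x, 0)))|exact: (modulus_ge2 (offset e (x, 0)))].
elim: special_points one => [|e es IH] one; first by exists 1.
have [r1 r10 h1] := one e (mem_head _ _).
have [r2 r20 h2] := IH (fun e' he' => one e' (mem_behead (s := e :: es) he')).
exists (Num.min r1 r2); first by rewrite lt_min r10.
have mono (r s : R) e' : r <= s -> isolated s e' -> isolated r e'.
  move=> rs [i1 i2]; split; first exact: le_trans i1.
  by case: i2 => [?|i2]; [left|right => x /i2; exact: le_trans].
move=> e'; rewrite inE => /orP[/eqP ->|/h2 h].
  by apply: (mono _ r1) => //; rewrite ge_min lexx.
by apply: (mono _ r2) => //; rewrite ge_min lexx orbT.
Qed.

Lemma estimate_bounded4 S (C M : R) L y (m : R * R -> R) : (0 < L)%N -> 1 <= C ->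
  (forall z, m z <= M) -> (forall z, m z = 0 \/ L%:R ^+ 2 <= m z) ->
  (forall z, S z -> estimate C L y (m z) z) -> bounded4 S y.
Proof.
move=> L0 C1 mM gap es.
have L2 : 1 <= L%:R ^+ 2 :> R by rewrite exprn_ege1// ler1n.
have K (t m' : R) : m' <= M -> `|t| * L%:R ^+ 2 <= C * m' -> `|t| <= C * M.
  move=> h1 h2; apply: le_trans (_ : `|t| * L%:R ^+ 2 <= _); first by rewrite ler_peMr.
  by apply: le_trans h2 _; apply: ler_wpM2l => //; lra.
split.
- by exists C => z /es[].
- by exists (C * M) => z /es h; apply: (K _ (m z)) => //; exact: (estimate_partial C1 (gap z) h).1.
- by exists (C * M) => z /es h; apply: (K _ (m z)) => //; exact: (estimate_partial C1 (gap z) h).2.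
- by exists (C * M) => z /es[_ _ _ h]; apply: (K _ (m z)).
Qed.

Lemma cut_multiplier L (r : R) e : (0 < L)%N -> expR (- L%:R) <= r ->
  e \in (0, 0) :: special_points -> (e \in special_points -> isolated r e) -> multiplier (cut L e).
Proof.
move=> L0 Lr he iso; split.
- by move=> z Dz; apply: cut_jet; exact: domain_special he.
- move=> x hx xa; have xe := axis_special hx xa he.
  split; first exact: cut_jet.
  have [e2|ne2] := eqVneq e.2 0.
    by have [_ _ -> _] := cut_valueE L e (x, 0); rewrite /= e2 subr0 !mul0r.
  have es : e \in special_points.
    by move: he; rewrite inE => /orP[/eqP ee|//]; rewrite ee eqxx in ne2.
  have [_ [e2|h]] := iso es; first by rewrite e2 eqxx in ne2.
  have x0 : 0 <= x by case/andP: hx => /ltW.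
  by have [_ _ -> _] := cut_flat L0 (le_trans Lr (h x x0)).
- move=> d d0; have [M hM] := majorant_bounded L [:: e].
  have C1 : (1 : R) <= 100 ^+ 2 by rewrite exprn_ege1// ler1n.
  apply: (@estimate_bounded4 _ (100 ^+ 2) M L _ (ring_majorant L e)) => //.
  + by move=> z; have := hM z; rewrite /= addr0.
  + by move=> z; exact: ring_majorant_gap.
  + by move=> z [Dz _]; apply: cut_estimate => //; exact: domain_special he.
Qed.

(** A cube of the logarithm of [|z|], starting at [|z| = e^(-5L)] and scaled so
    as to be bounded independently of [L]; its second logarithmic derivative is
    at least [6 / L^2] on the rings where the cutoffs at the origin vary. *)
Definition log_weight L : @jet R :=
  jcomp (fun u => ppart3 (L%:R^-1 * u + 5)) (fun u => L%:R^-1 * (3 * ppart2 (L%:R^-1 * u + 5)))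
    (fun u => L%:R^-1 * (L%:R^-1 * (6 * ppart (L%:R^-1 * u + 5)))) jln.

Lemma log_weight_jet L z : z <> (0, 0) -> is_jet (log_weight L) z.
Proof.
move=> z0; apply: is_jet_comp; first exact: is_jet_ln.
- by move=> u; exact: (@derive_rescale R _ (fun v => 3 * ppart2 v) L%:R^-1 5 u (@ppart3_derive R)).
- have h3 (v : R) : is_derive v 1 (fun v => 3 * ppart2 v) (6 * ppart v).
    by apply: (is_derive_to (derive_scale 3 (ppart2_derive v))); ring.
  by move=> u; exact: (derive_scale L%:R^-1 (@derive_rescale R _ _ L%:R^-1 5 u h3)).
- move=> u.
  have c1 : {for u, continuous (fun u : R => L%:R^-1 * u + 5 : R)}.
    apply: cvgD; last exact: cvg_cst.
    by apply: cvgM; [exact: cvg_cst|exact: cvg_id].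
  have c2 := @continuous_comp _ _ _ _ (@ppart R) u c1 (@ppart_continuous R _).
  by do 3 (apply: cvgM; [exact: cvg_cst|]); exact: c2.
Qed.

Lemma log_weight_null L z : (0 < L)%N -> z <> (0, 0) -> modulus z <= expR (- (5 * L%:R)) ->
  null_jet (log_weight L) z.
Proof.
move=> L0 z0 hr; have r0 := modulus_gt0 z0; have L0' : 0 < L%:R :> R by rewrite ltr0n.
have h : lnm z <= - (5 * L%:R) by rewrite /lnm -[leRHS]expRK ler_ln// posrE expR_gt0.
have p0 : ppart (L%:R^-1 * lnm z + 5) = 0.
  by apply: ppart_neg; rewrite -(ler_pM2l L0') mulr0 (mulrDr _ (L%:R^-1 * _)) mulrA divff ?gt_eqF// mul1r; lra.
by split; rewrite ?lap_comp /= /ppart3 ?/ppart2 p0 ?lap_ln; ring.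
Qed.

Definition bound4 (C : R) S f : Prop := forall z, S z ->
  [/\ `|jv f z| <= C, `|jx f z| <= C, `|jy f z| <= C & `|lap f z| <= C].

Lemma bound4_bounded4 C S f : bound4 C S f -> bounded4 S f.
Proof. by move=> h; split; exists C => z /h[]. Qed.

Lemma bounded4_bound4 S f : bounded4 S f -> exists2 C : R, 0 <= C & bound4 C S f.
Proof.
move=> [[C0 h0] [C1 h1] [C2 h2] [C3 h3]].
have n0 := normr_ge0 C0; have n1 := normr_ge0 C1; have n2 := normr_ge0 C2; have n3 := normr_ge0 C3.
have l0 := ler_norm C0; have l1 := ler_norm C1; have l2 := ler_norm C2; have l3 := ler_norm C3.
exists (`|C0| + `|C1| + `|C2| + `|C3|); first by lra.
move=> z Sz; have := h0 z Sz; have := h1 z Sz; have := h2 z Sz; have := h3 z Sz.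
by move=> *; split; lra.
Qed.

Lemma bound4M (C1 C2 : R) S f g : 0 <= C1 -> 0 <= C2 -> bound4 C1 S f -> bound4 C2 S g ->
  bound4 (6 * (C1 * C2)) S (jmul f g).
Proof.
move=> C10 C20 hf hg z Sz; have [f0 f1 f2 f3] := hf z Sz; have [g0 g1 g2 g3] := hg z Sz.
have C12 : 0 <= C1 * C2 by exact: mulr_ge0.
have M (x y : R) : `|x| <= C1 -> `|y| <= C2 -> - (C1 * C2) <= x * y <= C1 * C2.
  by move=> h1 h2; rewrite -ler_norml normrM; exact: ler_pM.
have M' (x y : R) : `|x| <= C2 -> `|y| <= C1 -> - (C1 * C2) <= x * y <= C1 * C2.
  by move=> h1 h2; rewrite (mulrC x); exact: M.
rewrite lap_mul /=.
have := M _ _ f0 g0; have := M _ _ f0 g1; have := M' _ _ g0 f1; have := M _ _ f0 g2; have := M' _ _ g0 f2.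
have := M _ _ f0 g3; have := M' _ _ g0 f3; have := M _ _ f1 g1; have := M _ _ f2 g2.
move: (jv f z * _) (jx f z * _) (jy f z * _) (jv f z * _) (jv g z * _) (jv f z * _) (jv g z * _) (jv f z * _) (jv g z * _).
move: (C1 * C2) C12 => K K0 x1 x2 x3 x4 x5 x6 x7 x8 x9 h1 h2 h3 h4 h5 h6 h7 h8 h9; clear -K0 h1 h2 h3 h4 h5 h6 h7 h8 h9.
split; rewrite ler_norml; apply/andP; split; lra.
Qed.

Lemma log_weight_bound (d : R) : 0 < d -> exists2 C : R, 0 <= C & forall L, (0 < L)%N ->
  bound4 C (D `&` [set z | d <= modulus z]) (log_weight L).
Proof.
move=> d0; have [M M0 hM] := region_modulus.
have [C hC] := bounded_lnm M d0.
pose T := `|C| + 5; have T0 : 0 <= T by have := normr_ge0 C; rewrite /T; lra.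
have i0 : 0 <= d^-1 by rewrite invr_ge0 ltW.
exists (T ^+ 3 + 3 * T ^+ 2 * d^-1 + 6 * T * d^-1 ^+ 2).
  by rewrite !addr_ge0 ?mulr_ge0 ?exprn_ge0// ?exprn_ge0.
move=> L L0 z [[Wz nz] /= zd].
have L1 : L%:R^-1 <= 1 :> R by rewrite invf_le1 ?ltr0n// ler1n.
have L00 : 0 <= L%:R^-1 :> R by rewrite invr_ge0.
have z0 := slit_neq0 nz; have r0 := modulus_gt0 z0; have q0 := nsq_gt0 z0.
have hl := hC z (conj nz (introT andP (conj zd (hM z Wz)))).
set u := L%:R^-1 * lnm z + 5.
have uT : ppart u <= T.
  rewrite /ppart ge_max T0 /= /u /T lerD2r; apply: le_trans (ler_norm _) _.
  rewrite normrM (ger0_norm L00); apply: le_trans (_ : `|lnm z| <= _); first by rewrite ler_piMl.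
  exact: le_trans hl (ler_norm C).
have u0 := ppart_ge0 u.
have p2 : 0 <= ppart2 u <= T ^+ 2 by rewrite /ppart2 -expr2 sqr_ge0 ler_pXn2r ?nnegrE.
have p3 : 0 <= ppart3 u <= T ^+ 3.
  have /andP[h1 h2] := p2.
  have -> : ppart3 u = ppart2 u * ppart u.
    by rewrite /ppart3 /ppart2; have [h|/ltW h] := lerP 0 u; rewrite ?(ppart_pos h) ?(ppart_neg h) ?mul0r.
  apply/andP; split; first exact: mulr_ge0.
  by rewrite (_ : T ^+ 3 = T ^+ 2 * T); [exact: ler_pM|ring].
have ri : (modulus z)^-1 <= d^-1 by rewrite lef_pV2.
have ri0 : 0 <= (modulus z)^-1 by rewrite invr_ge0 ltW.
have J (t : R) : `|t| <= modulus z -> `|t * (nsq z)^-1| <= d^-1.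
  move=> ht; rewrite normrM (ger0_norm (x := (nsq z)^-1)) ?invr_ge0 ?nsq_ge0// -modulus_sq.
  apply: le_trans ri; rewrite expr2 invfM mulrA -[leRHS]mul1r; apply: ler_wpM2r => //.
  by rewrite ler_pdivrMr// mul1r.
have g1 := J _ (modulus_ge1 z); have g2 := J _ (modulus_ge2 z).
have P1 : 0 <= 3 * T ^+ 2 * d^-1 by rewrite !mulr_ge0 ?exprn_ge0.
have P2 : 0 <= 6 * T * d^-1 ^+ 2 by rewrite !mulr_ge0 ?exprn_ge0.
have P3 : 0 <= T ^+ 3 by rewrite exprn_ge0.
have K (t : R) : `|t| <= d^-1 -> `|t * (L%:R^-1 * (3 * ppart2 u))| <= 3 * T ^+ 2 * d^-1.
  move=> ht; have /andP[h1 h2] := p2.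
  rewrite normrM mulrC; apply: ler_pM => //.
  rewrite ger0_norm ?mulr_ge0//; apply: le_trans (_ : 3 * ppart2 u <= _).
    by rewrite ler_piMl// mulr_ge0.
  by rewrite ler_pM2l.
split.
- by rewrite /= -/u ger0_norm; case/andP: p3 => // h1 h2; lra.
- by rewrite /= -/u; have := K _ g1; lra.
- by rewrite /= -/u; have := K _ g2; lra.
- rewrite lap_comp lap_ln mulr0 add0r (grad_ln z0) -/u.
  rewrite ger0_norm; last by rewrite !mulr_ge0 ?invr_ge0 ?nsq_ge0.
  apply: le_trans (_ : 6 * T * d^-1 ^+ 2 <= _); last by lra.
  rewrite -modulus_sq -exprVn; apply: ler_pM => //.
  + by rewrite !mulr_ge0.
  + by rewrite exprn_ge0.
  + apply: le_trans (_ : 6 * ppart u <= _); last by rewrite ler_pM2l.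
    rewrite mulrA ler_piMl ?mulr_ge0//; rewrite -[leRHS]mulr1; exact: ler_pM.
  + by rewrite ler_pXn2r ?nnegrE.
Qed.

Lemma log_weight_multiplier L : (0 < L)%N -> multiplier (log_weight L).
Proof.
move=> L0; split.
- by move=> z [_ /slit_neq0]; exact: log_weight_jet.
- move=> x /andP[x0 _] _; split; last by rewrite /= mul0r mul0r.
  by apply: log_weight_jet => -[xE]; rewrite xE ltxx in x0.
- by move=> d d0; have [C _ h] := log_weight_bound d0; exact: bound4_bounded4 (h L L0).
Qed.

End Multipliers.

(** * Concentration of the potential at the origin *)

Section Orthogonality.
Context {R : realType}.
Local Notation mR := (measurableTypeR R).
Local Notation mR2 := (measurableTypeR R * measurableTypeR R)%type.
Implicit Types (e z : R * R) (L : nat) (f g y : @jet R) (S : set (R * R)).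

Lemma modulus_triangle z e : modulus (z.1 + e.1, z.2 + e.2) <= modulus z + modulus e.
Proof.
have cs : z.1 * e.1 + z.2 * e.2 <= modulus z * modulus e.
  apply: le_trans (ler_norm _) _.
  rewrite -(@ler_pXn2r _ 2) ?nnegrE ?mulr_ge0 ?modulus_ge0// real_normK ?num_real//.
  rewrite exprMn !modulus_sq /nsq; have := sqr_ge0 (z.1 * e.2 - z.2 * e.1).
  set x := (_ - _) ^+ 2; move=> x0.
  have -> : (z.1 ^+ 2 + z.2 ^+ 2) * (e.1 ^+ 2 + e.2 ^+ 2) = (z.1 * e.1 + z.2 * e.2) ^+ 2 + x by rewrite /x; ring.
  by rewrite lerDl.
rewrite -(@ler_pXn2r _ 2) ?nnegrE ?addr_ge0 ?modulus_ge0//.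
rewrite sqrrD !modulus_sq /nsq /=; rewrite !sqrrD; lra.
Qed.

Lemma modulus_continuous z : {for z, continuous modulus}.
Proof.
exact: (@continuous_comp _ _ _ nsq Num.sqrt z (is_grad_continuous (is_grad_nsq z)) (@sqrt_continuous R _)).
Qed.

Lemma lap_radial (h h1 h2 : R -> R) f z : lap f z = 0 -> z <> (0, 0) ->
  lap (jmul f (jcomp h h1 h2 jln)) z =
  (jv f z * h2 (lnm z) + 2 * (h1 (lnm z) * euler f z)) * (nsq z)^-1.
Proof.
move=> hf z0; rewrite lap_mul lap_comp lap_ln hf (grad_ln z0) /euler /=; ring.
Qed.

Lemma euler_radial (h h1 h2 : R -> R) f z : z <> (0, 0) ->
  euler (jmul f (jcomp h h1 h2 jln)) z = jv f z * h1 (lnm z) + h (lnm z) * euler f z.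
Proof.
move=> z0; rewrite euler_mul; congr (_ * _ + _).
have -> : euler (jcomp h h1 h2 jln) z = h1 (lnm z) * euler jln z by rewrite /euler /=; ring.
by rewrite euler_ln// mulr1.
Qed.

Definition same_jet f g z : Prop := [/\ jv f z = jv g z, jx f z = jx g z, jy f z = jy g z & lap f z = lap g z].

Lemma same_jetM f g y z : same_jet g y z -> same_jet (jmul f g) (jmul f y) z.
Proof. by rewrite /same_jet !lap_mul /= => -[-> -> -> ->]. Qed.

Lemma flat_jetMr f g z : flat_jet g z -> same_jet (jmul f g) f z.
Proof.
by rewrite /same_jet lap_mul /= => -[-> -> -> ->]; rewrite !(mul0r, mulr0, addr0, add0r, mulr1, mul1r).
Qed.

Lemma same_euler f g z : same_jet f g z -> euler f z = euler g z.
Proof. by rewrite /euler => -[_ -> -> _]. Qed.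

Variables (p a b : R) (W : set (R * R)) (c : R -> R * R) (E : seq R) (Phi : R * R -> R) (k alpha : R).
Hypothesis SR : slit_region a b W c E.
Hypothesis SP : source_potential p a b W c Phi.
Hypothesis k_gt0 : 0 < k.
Hypothesis flow : forall t : R, 0 < t < 1 -> t \notin E ->
  exists2 g : R * R, trace (grad Phi) (W `\` pos_axis) (c t) g &
    - dot g (unit_normal c t) = dot (k *: c t) (unit_normal c t).
Hypothesis alpha_itv : 0 <= alpha <= 1 / 4.
Hypothesis cos_alpha : cos (alpha * (2 * pi)) = p.

Local Notation D := (W `\` pos_axis).
Local Notation special := (special_points a b c E).

(** From the scale [L1] on, the cutoffs at the special points are multipliers
    and equal 1 in the disc of radius [rho] around the origin. *)
Record scale (rho : R) (L1 : nat) : Prop := {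
  scale_pos : 0 < rho <= 1;
  scale_L : (0 < L1)%N;
  scale_product : forall L, (L1 <= L)%N -> multiplier a b W (cut_product L special);
  scale_flat : forall L z, (L1 <= L)%N -> modulus z < rho -> flat_jet (cut_product L special) z }.

Lemma scale_exists : exists rho L1, scale rho L1.
Proof.
have [r r0 iso] := special_isolated SR; have [L0 hL] := expR_small r0.
exists (Num.min r 1), (maxn 1 L0).
split.
- by rewrite lt_min r0 ltr01 ge_min lexx orbT.
- by rewrite leq_max.
- move=> L; rewrite geq_max => /andP[L0' LL].
  have H es : {subset es <= special} -> multiplier a b W (cut_product L es).
    elim: es => [|e es IH] sub; first exact: multiplier_one.
    have esp : e \in special by apply: sub; rewrite mem_head.
    apply: multiplierM.
      by apply: (cut_multiplier SR L0' (hL L LL)) => [|_]; [rewrite inE esp orbT|exact: iso].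
    by apply: IH => e' he'; apply: sub; rewrite inE he' orbT.
  exact: H.
- move=> L z; rewrite geq_max lt_min => /andP[L0' LL] /andP[zr _].
  apply: cut_product_flat => // e /iso[h _]; apply: le_trans (hL L LL) _.
  have := modulus_triangle z (e.1 - z.1, e.2 - z.2).
  have -> : (z.1 + (e.1 - z.1, e.2 - z.2).1, z.2 + (e.1 - z.1, e.2 - z.2).2) = e.
    by rewrite [RHS]surjective_pairing /=; congr pair; ring.
  have -> : modulus (e.1 - z.1, e.2 - z.2) = modulus (offset e z).
    by rewrite /modulus /=; congr Num.sqrt; ring.
  lra.
Qed.

Lemma product_null L P : (0 < L)%N -> exceptional a b c E P -> exists2 r : R, 0 < r & forall z,
  in_box P r z -> D z -> null_jet (cut_product L special) z.
Proof.
move=> L0 eP; have Ps := exceptional_special eP.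
have e0 : 0 < expR (- (4 * L%:R)) :> R by exact: expR_gt0.
exists (expR (- (4 * L%:R)) / 2); first by rewrite divr_gt0.
move=> z [z1 z2] Dz; apply: (@cut_product_null R L special P z) => //.
  by apply: (domain_special SR Dz); rewrite inE Ps orbT.
by apply: le_trans (modulus_le _) _; rewrite /offset /=; lra.
Qed.

Lemma weight_ge0 z : ~ pos_axis z -> 0 <= pc alpha z.
Proof.
move=> /slit_neq0/arg_itv h; rewrite mulr_ge0 ?expR_ge0// cos_ge0_pihalf//.
have pi0 := pi_ge0 R; case/andP: alpha_itv => a1 a2; case/andP: h => h1 h2.
have : 0 <= alpha * arg z by exact: mulr_ge0.
have : alpha * arg z <= (1 / 4) * (2 * pi) by apply: ler_pM.
by move=> *; apply/andP; split; lra.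
Qed.

Lemma alpha_le1 : 0 <= alpha <= 1.
Proof. by case/andP: alpha_itv => a1 a2; apply/andP; split => //; lra. Qed.

Lemma lnm_le0 z : z <> (0, 0) -> modulus z <= 1 -> lnm z <= 0.
Proof. by move=> z0 h; rewrite /lnm ln_le0. Qed.

Lemma weight_le1 z : z <> (0, 0) -> modulus z <= 1 -> pc alpha z <= 1.
Proof.
move=> z0 h; have l0 := lnm_le0 z0 h; case/andP: alpha_itv => a1 _.
apply: le_trans (_ : expR (alpha * lnm z) * 1 <= _); first by rewrite ler_pM2l ?expR_gt0 ?cos_le1.
by rewrite mulr1 -expR0 ler_expR mulr_ge0_le0.
Qed.

(** [Re (z^alpha)] and its radial derivative are nonnegative because
    [alpha arg z <= pi / 2], so only the second derivative of the weight needs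
    to be kept. *)
Lemma weight_lap L z : ~ pos_axis z ->
  0 <= pc alpha z * (L%:R^-1 * (L%:R^-1 * (6 * ppart (L%:R^-1 * lnm z + 5)))) * (nsq z)^-1
    <= lap (jmul (jpow alpha) (log_weight L)) z.
Proof.
move=> nz; have z0 := slit_neq0 nz; have w0 := weight_ge0 nz.
have i0 : 0 <= (nsq z)^-1 by rewrite invr_ge0 nsq_ge0.
have L0 : 0 <= L%:R^-1 :> R by rewrite invr_ge0.
have pp := ppart_ge0 (L%:R^-1 * lnm z + 5).
apply/andP; split; first by do !apply: mulr_ge0 => //.
rewrite lap_radial//; last exact: lap_of.
apply: ler_wpM2r => //; rewrite lerDl euler_pow//.
have p2 : 0 <= ppart2 (L%:R^-1 * lnm z + 5) by rewrite /ppart2 mulr_ge0.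
by case/andP: alpha_itv => a1 _; do !apply: mulr_ge0 => //.
Qed.

Lemma domain_adjoint_bounded f (d : R) : 0 < d -> adjoint p f -> bounded4 (D `&` [set z | d <= modulus z]) f.
Proof.
move=> d0 adj; have [M M0 hM] := region_modulus SR.
apply: (@bounded4S _ _ (~` pos_axis `&` annulus d M)); last exact: jet_bounded4 (adjoint_bounded adj M d0).
by move=> z [[Wz nz] /= zd]; split => //; rewrite /annulus /= zd hM.
Qed.

Lemma domain_continuous S (f : R * R -> R) : open S -> (forall z, S z -> {for z, continuous f}) ->
  measurable_fun setT (f \_ S : mR2 -> mR).
Proof.
move=> oS cf; apply/(measurable_restrictT _ (open_measurable_plane oS)).
exact: continuous_measurable_plane.
Qed.

Lemma near_open (rho : R) : open (D `&` [set z | modulus z < rho]).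
Proof.
apply: openI; first exact: (slit_domain_open SR).
exact: (open_comp (fun z _ => @modulus_continuous z) (@open_lt R rho)).
Qed.

Lemma summable_domain (f : R * R -> R) (C : R) : measurable_fun setT (f : mR2 -> mR) ->
  (forall z, ~ D z -> f z = 0) -> (forall z, D z -> `|f z| <= C) -> 0 <= C -> summable f.
Proof.
move=> mf f0 fC C0; have [M M0 hM] := region_bound SR.
apply: (@integrable_bounded_support R f C M) => //.
- move=> z; have [Dz|nD] := EM (D z); first exact: fC.
  by rewrite f0 ?normr0.
- move=> z fz; have [Wz _] : D z by apply: contrapT => nD; rewrite f0 ?eqxx in fz.
  by have [/ltW ? /ltW ?] := hM z Wz.
Qed.

Lemma total_domain (C : R) : 0 <= C -> exists2 B : R, 0 <= B & forall f : R * R -> R, summable f ->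
  (forall z, ~ D z -> f z = 0) -> (forall z, D z -> `|f z| <= C) -> total f <= B.
Proof.
move=> C0; have [M M0 hM] := region_bound SR.
have [s t] := box_summable (0, 0) (ltW M0).
exists (C * (2 * M) ^+ 2); first by rewrite mulr_ge0// sqr_ge0.
move=> f sf f0 fC; rewrite -t -totalZ//; apply: total_le => //; first exact: summableZ.
move=> z; have [Dz|nD] := EM (D z); last first.
  by rewrite f0// mulr_ge0//; case/andP: (box_indicator_itv (0, 0) M z).
have [/ltW z1 /ltW z2] := hM z Dz.1.
rewrite boxE ?subr0// mulr1; exact: le_trans (ler_norm _) (fC z Dz).
Qed.

(** Apply the Green identity to [Re (z^alpha)] times the logarithmic weight.
    Near the origin [Phi lap] is nonnegative; everything else in the identity is
    bounded uniformly in [L], hence so is the integral of that term. *)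
Lemma moment rho L1 : scale rho L1 -> exists2 B : R, 0 <= B & forall L, (0 < L)%N ->
  let Q := (fun z => Phi z * lap (jmul (jpow alpha) (log_weight L)) z) \_ (D `&` [set z | modulus z < rho]) in
  summable Q /\ total Q <= B.
Proof.
move=> sc; have [rho0 rho1] := andP (scale_pos sc).
have adj := adjoint_pow cos_alpha.
have [M M0 hM] := region_modulus SR.
have [CP hP] := potential_bounded SP rho0.
have [Cf Cf0 hf] := bounded4_bound4 (domain_adjoint_bounded rho0 adj).
have [Cy Cy0 hy] := bounded4_bound4 (multiplier_bounded (scale_product sc (leqnn L1)) rho0).
have [CX CX0 hX] := log_weight_bound SR rho0.
set K := 6 * (Cf * (6 * (Cy * CX))).
have K0 : 0 <= K by rewrite !mulr_ge0.
(* The first three terms bound the density away from the origin; near it the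
   weight is at most [5^3] and its logarithmic derivative at most [3 5^2]. *)
pose C := 2 * k * K + k * (M * K + M * K) + `|CP| * K + 450 * k.
have kk : 0 <= k by exact: ltW.
have t1 : 0 <= 2 * k * K by do !apply: mulr_ge0 => //.
have t2 : 0 <= k * (M * K + M * K) by apply: mulr_ge0 => //; apply: addr_ge0; apply: mulr_ge0 => //; exact: ltW.
have t3 : 0 <= `|CP| * K by exact: mulr_ge0.
have t4 : 0 <= 450 * k := mulr_ge0 (ler0n R 450) kk.
have C0 : 0 <= C by exact: (addr_ge0 (addr_ge0 (addr_ge0 t1 t2) t3) t4).
have [B B0 hB] := total_domain C0.
exists B => // L L0 Q.
pose v := jmul (jpow alpha) (jmul (cut_product L1 special) (log_weight L)).
have mX := log_weight_multiplier SR L0.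
have gt : green_test p a b W c E v.
  apply: (green_test_mul SR adj).
  - exact: (multiplierM (scale_product sc (leqnn L1)) mX).
  - move=> P /(product_null (scale_L sc))[r r0 h]; exists r => // z Pz Dz.
    by apply: null_jetM; left; exact: h.
  - exists (expR (- (5 * L%:R))); first exact: expR_gt0.
    move=> z [_ /slit_neq0 z0] /ltW zd; apply: null_jetM; right; exact: log_weight_null.
have [sd td] := green_identity SR SP flow gt.
set d := green_density Phi k v \_ D in sd td.
have QE z : (D `&` [set z | modulus z < rho]) z -> Q z = Phi z * lap (jmul (jpow alpha) (log_weight L)) z.
  by move=> h; rewrite /Q patchE mem_set.
have Q0 z : ~ (D `&` [set z | modulus z < rho]) z -> Q z = 0.
  by move=> h; rewrite /Q patchE memNset.
have dE z : D z -> d z = green_density Phi k v z by move=> h; rewrite /d patchE mem_set.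
have d0 z : ~ D z -> d z = 0 by move=> h; rewrite /d patchE memNset.
have mQ : measurable_fun setT (Q : mR2 -> mR).
  apply: domain_continuous; first exact: near_open.
  move=> z [Dz _]; have [[dP _ _] _ _] := potential_harmonic SP Dz.
  have jw : is_jet (jmul (jpow alpha) (log_weight L)) z.
    by case: (Dz) => _ nz; apply: is_jet_mul; [exact: is_jet_pow|apply: log_weight_jet; exact: slit_neq0].
  have [_ [cxx _ cyy]] := jw.
  by apply: cvgM; [exact: (is_grad_continuous (differentiable_is_grad dP))|exact: (cvgD cxx cyy)].
have md : measurable_fun setT (d : mR2 -> mR).
  by apply/measurable_EFinP; exact: measurable_int sd.
have bound z : D z -> `|Q z + d z| <= C.
  move=> Dz; have [Wz nz] := Dz; have z0 := slit_neq0 nz.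
  have Phi0 := potential_gt0 SP Dz.
  have [near|far] := ltP (modulus z) rho; last first.
    rewrite Q0 ?add0r ?dE//; last by case => _ /=; rewrite ltNge far.
    have SDz : (D `&` [set z | rho <= modulus z]) z by [].
    have [v0 v1 v2 v3] := bound4M Cf0 (mulr_ge0 (ler0n R 6) (mulr_ge0 Cy0 CX0)) hf (bound4M Cy0 CX0 hy (hX L L0)) SDz.
    have m1 := le_trans (modulus_ge1 z) (hM z Wz).
    have m2 := le_trans (modulus_ge2 z) (hM z Wz).
    rewrite /green_density /euler -/v -/K in v0 v1 v2 v3 *.
    have w1 : `|2 * k * jv v z| <= 2 * k * K.
      have k2 : 0 <= 2 * k by exact: mulr_ge0.
      by rewrite normrM (ger0_norm k2); apply: ler_wpM2l.
    have w2 : `|k * (z.1 * jx v z + z.2 * jy v z)| <= k * (M * K + M * K).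
      rewrite normrM (gtr0_norm k_gt0) ler_pM2l//; apply: le_trans (ler_normD _ _) _.
      by rewrite !normrM; apply: lerD; apply: ler_pM.
    have w3 : `|Phi z * lap v z| <= `|CP| * K.
      rewrite normrM; apply: ler_pM => //; rewrite gtr0_norm//.
      exact: le_trans (hP z Dz far) (ler_norm _).
    rewrite /C; apply: le_trans (ler_normB _ _) _; apply: le_trans (lerD (ler_normD _ _) (lexx _)) _.
    by apply: le_trans (lerD (lerD w1 w2) w3) _; rewrite lerDl.
  rewrite QE// dE// /green_density.
  have fl := scale_flat sc (leqnn L1) near.
  have sm : same_jet v (jmul (jpow alpha) (log_weight L)) z by apply: same_jetM; exact: flat_jetMl.
  have [-> _ _ ->] := sm; rewrite (same_euler sm) euler_radial// euler_pow//.
  have zl1 : modulus z <= 1 by apply: le_trans rho1; exact: ltW.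
  have l0 := lnm_le0 z0 zl1.
  have w0 := weight_ge0 nz; have w1 := weight_le1 z0 zl1.
  have Li0 : 0 <= L%:R^-1 :> R by rewrite invr_ge0.
  have Li1 : L%:R^-1 <= 1 :> R by rewrite invf_le1 ?ltr0n// ler1n.
  move: (lap (jmul _ _) z) => l; rewrite /=; set t := L%:R^-1 * lnm z + 5.
  have t5 : t <= 5 by rewrite /t gerDr mulr_ge0_le0.
  have p0 : 0 <= ppart t <= 5 by rewrite ppart_ge0 /ppart ge_max t5 ler0n.
  have [p1 p2] := andP p0.
  have p2E : 0 <= ppart2 t <= 25.
    rewrite /ppart2 mulr_ge0//=; apply: le_trans (_ : 5 * 5 <= _); [exact: ler_pM|lra].
  have [q1 q2] := andP p2E.
  have p3E : ppart3 t = ppart2 t * ppart t.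
    by rewrite /ppart3 /ppart2; have [h|/ltW h] := lerP 0 t; rewrite ?(ppart_pos h) ?(ppart_neg h) ?mul0r.
  have p3 : 0 <= ppart3 t <= 125.
    by rewrite p3E mulr_ge0//=; apply: le_trans (_ : 25 * 5 <= _); [exact: ler_pM|lra].
  have [s1 s2] := andP p3.
  have unit (x y M' : R) : 0 <= x <= 1 -> 0 <= y <= M' -> 0 <= x * y <= M'.
    move=> /andP[x0 x1] /andP[y0 y1]; apply/andP; split; first exact: mulr_ge0.
    by rewrite -[leRHS]mul1r; exact: ler_pM.
  have w01 : 0 <= pc alpha z <= 1 by apply/andP; split.
  have f1 := unit _ _ _ w01 p3.
  have f2 : 0 <= pc alpha z * (L%:R^-1 * (3 * ppart2 t)) <= 75.
    apply: (unit _ _ 75 w01); apply: (unit _ _ 75); apply/andP; split => //; first exact: mulr_ge0.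
    by rewrite (_ : 75 = 3 * 25); [rewrite ler_pM2l|ring].
  have f3 : 0 <= ppart3 t * (alpha * pc alpha z) <= 125.
    have aw : 0 <= alpha * pc alpha z <= 1.
      by apply: (unit _ _ 1) w01; exact: alpha_le1.
    by rewrite mulrC; exact: (unit _ _ _ aw p3).
  have [f1a f1b] := andP f1; have [f2a f2b] := andP f2; have [f3a f3b] := andP f3.
  rewrite [X in `|X|](_ : _ = k * (2 * (pc alpha z * ppart3 t) +
     (pc alpha z * (L%:R^-1 * (3 * ppart2 t)) + ppart3 t * (alpha * pc alpha z)))); last by ring.
  move: f1a f1b f2a f2b f3a f3b; move: (pc alpha z * ppart3 t) (pc alpha z * (L%:R^-1 * _)) (ppart3 t * (alpha * _)).
  move=> x1 x2 x3 x10 x1b x20 x2b x30 x3b.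
  have n0 : 0 <= 2 * x1 + (x2 + x3) by apply: addr_ge0; [exact: mulr_ge0|exact: addr_ge0].
  have n1 : 2 * x1 + (x2 + x3) <= 450.
    by lra.
  rewrite normrM (gtr0_norm k_gt0) (ger0_norm n0).
  apply: le_trans (_ : k * 450 <= _); first by rewrite ler_pM2l.
  by rewrite /C (mulrC k) lerDr; exact: (addr_ge0 (addr_ge0 t1 t2) t3).
have off z : ~ D z -> Q z + d z = 0.
  by move=> nD; rewrite d0// Q0 ?addr0// => -[].
have sg : summable (fun z => Q z + d z).
  by apply: (@summable_domain _ C) => //; exact: measurable_funD.
have QB : Q = fun z => (Q z + d z) - d z by apply/funext => z; rewrite addrK.
have sQ : summable Q by rewrite QB; exact: summableB.
split => //; rewrite QB totalB// (total_eq0 td) subr0.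
exact: hB.
Qed.

End Orthogonality.

(** * Removing the cutoffs *)

Section Orthogonality2.
Context {R : realType}.
Local Notation mR := (measurableTypeR R).
Local Notation mR2 := (measurableTypeR R * measurableTypeR R)%type.
Implicit Types (e z : R * R) (L : nat) (f g y : @jet R) (S : set (R * R)).

Lemma square_expR (kappa : R) : 0 < kappa ->
  exists2 A : R, 0 <= A & forall L, L%:R ^+ 2 * expR (- (kappa * L%:R)) <= A.
Proof.
move=> k0; exists (4 / kappa ^+ 2); first by rewrite divr_ge0// sqr_ge0.
move=> L; rewrite expRN ler_pdivrMr ?expR_gt0//.
have h : kappa * L%:R / 2 <= expR (kappa * L%:R / 2).
  by apply: le_trans (expR_ge1Dx _); rewrite lerDr.
have h0 : 0 <= kappa * L%:R / 2 by rewrite divr_ge0// mulr_ge0// ltW.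
have -> : expR (kappa * L%:R) = expR (kappa * L%:R / 2) ^+ 2.
  by rewrite expr2 -expRD; congr expR; field.
apply: le_trans (_ : 4 / kappa ^+ 2 * (kappa * L%:R / 2) ^+ 2 <= _).
  rewrite [leRHS](_ : _ = L%:R ^+ 2)//; field; exact: lt0r_neq0.
apply: ler_wpM2l; first by rewrite divr_ge0// sqr_ge0.
by rewrite ler_pXn2r ?nnegrE ?expR_ge0.
Qed.

Lemma eq0_le_inv (t A : R) (L1 : nat) : (forall L, (L1 <= L)%N -> `|t| * L%:R <= A) -> t = 0.
Proof.
move=> h; apply/eqP; rewrite -normr_eq0; apply/negPn/negP => t0.
have tp : 0 < `|t| by rewrite lt_neqAle eq_sym t0 normr_ge0.
pose n := (Num.truncn (`|A| / `|t|)).+1.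
have A0 : 0 <= `|A| / `|t| by rewrite divr_ge0.
have /andP[_ hn] := truncn_itv A0.
have := h (maxn L1 n) (leq_maxl _ _); apply/negP; rewrite -ltNge.
apply: le_lt_trans (ler_norm A) _.
rewrite -ltr_pdivrMl// mulrC; apply: (lt_le_trans hn); rewrite ler_nat; exact: leq_maxr.
Qed.

Variables (p a b : R) (W : set (R * R)) (c : R -> R * R) (E : seq R) (Phi : R * R -> R) (k alpha : R).
Hypothesis SR : slit_region a b W c E.
Hypothesis SP : source_potential p a b W c Phi.
Hypothesis k_gt0 : 0 < k.
Hypothesis flow : forall t : R, 0 < t < 1 -> t \notin E ->
  exists2 g : R * R, trace (grad Phi) (W `\` pos_axis) (c t) g &
    - dot g (unit_normal c t) = dot (k *: c t) (unit_normal c t).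
Hypothesis alpha_itv : 0 <= alpha <= 1 / 4.
Hypothesis cos_alpha : cos (alpha * (2 * pi)) = p.

Local Notation D := (W `\` pos_axis).
Local Notation special := (special_points a b c E).

(** The gain of a positive power of [|z|] over the positive adjoint solution is
    what defeats the unknown singularity of the potential. *)
Definition dominated f : Prop := exists kappa C : R, [/\ 0 < kappa, 0 <= C &
  forall z, ~ pos_axis z -> modulus z <= 1 ->
    `|jv f z| <= C * (expR (kappa * lnm z) * pc alpha z) /\
    `|euler f z| <= C * (expR (kappa * lnm z) * pc alpha z)].

Lemma euler_bound (C M : R) f z : `|jx f z| <= C -> `|jy f z| <= C -> modulus z <= M ->
  `|euler f z| <= 2 * (M * C).
Proof.
move=> h1 h2 hM; rewrite /euler; apply: le_trans (ler_normD _ _) _; rewrite !normrM mulr_natl mulr2n.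
by apply: lerD; apply: ler_pM => //; [exact: le_trans (modulus_ge1 z) hM|exact: le_trans (modulus_ge2 z) hM].
Qed.

(** Away from the origin all the factors are bounded, so the error is of the
    order of the derivatives of the cutoff. *)
Lemma error_far (C Cf CP M m N : R) f y z : 0 <= C -> 0 <= Cf -> 0 <= CP -> 0 <= M -> 0 <= m -> 0 < N ->
  bound4 Cf [set z] f -> lap f z = 0 -> modulus z <= M -> `|Phi z| <= CP ->
  `|1 - jv y z| * N <= C * m -> `|jx y z| * N <= C * m -> `|jy y z| * N <= C * m -> `|lap y z| * N <= C * m ->
  `|k * (2 * jv f z + euler f z) - green_density Phi k (jmul f y) z| <=
    (k * (2 * Cf + 2 * (M * Cf)) + k * (2 * (M * Cf)) + CP * (5 * Cf)) * C * (m / N).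
Proof.
move=> C0 Cf0 CP0 M0 m0 N0 /(_ z erefl)[f0 f1 f2 _] lf hM hP e0 e1 e2 e3.
have k0 := ltW k_gt0.
set q := C * m / N.
have Q (t : R) : `|t| * N <= C * m -> `|t| <= q by rewrite /q ler_pdivlMr.
have {e0 e1 e2 e3}[e0 e1 e2 e3] := And4 (Q _ e0) (Q _ e1) (Q _ e2) (Q _ e3).
have q0 : 0 <= q by apply: le_trans e0.
have ef := euler_bound f1 f2 hM; have ey := euler_bound e1 e2 hM.
have -> : k * (2 * jv f z + euler f z) - green_density Phi k (jmul f y) z =
    k * ((2 * jv f z + euler f z) * (1 - jv y z)) - k * (jv f z * euler y z) +
    Phi z * (jv f z * lap y z + 2 * (jx f z * jx y z + jy f z * jy y z)).
  by rewrite /green_density lap_mul lf euler_mul /=; ring.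
rewrite (_ : _ * C * (m / N) = k * ((2 * Cf + 2 * (M * Cf)) * q) + k * (Cf * (2 * (M * q))) +
   CP * (Cf * q + 2 * (Cf * q + Cf * q))); last by rewrite /q; ring.
apply: le_trans (ler_normD _ _) _; apply: lerD.
  apply: le_trans (ler_normB _ _) _; rewrite !normrM (ger0_norm k0); apply: lerD; apply: ler_wpM2l => //.
    apply: ler_pM => //; apply: le_trans (ler_normD _ _) _; apply: lerD => //.
    by rewrite normrM ger0_norm// ler_pM2l.
  exact: ler_pM.
rewrite normrM; apply: ler_pM => //.
apply: le_trans (ler_normD _ _) _; apply: lerD; first by rewrite normrM; exact: ler_pM.
rewrite normrM ger0_norm// ler_pM2l//; apply: le_trans (ler_normD _ _) _.
by rewrite !normrM; apply: lerD; exact: ler_pM.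
Qed.

Lemma cut_radial L z : [/\ jv (cut L (0, 0)) z = step (L%:R^-1 * lnm z + 4),
  jx (cut L (0, 0)) z = jx jln z * (L%:R^-1 * step1 (L%:R^-1 * lnm z + 4)),
  jy (cut L (0, 0)) z = jy jln z * (L%:R^-1 * step1 (L%:R^-1 * lnm z + 4))
  & lap (cut L (0, 0)) z = L%:R^-1 * (L%:R^-1 * step2 (L%:R^-1 * lnm z + 4)) *
      (jx jln z ^+ 2 + jy jln z ^+ 2)].
Proof.
have E0 : offset (0, 0) z = z by rewrite /offset /= !subr0 -surjective_pairing.
by have := cut_valueE L (0, 0) z; rewrite E0.
Qed.

(** Near the origin the cutoff costs a term supported in a ring where
    [|z| <= e^(-L)] and where the Laplacian of the weighted positive solution is
    at least [6 L^-2 |z|^-2 Re (z^alpha)]; the constant 50 is [300 / 6]. *)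
Lemma error_near (kappa C : R) L f z : (0 < L)%N -> 0 < kappa -> 0 <= C -> ~ pos_axis z -> modulus z <= 1 ->
  lap f z = 0 ->
  `|jv f z| <= C * (expR (kappa * lnm z) * pc alpha z) ->
  `|euler f z| <= C * (expR (kappa * lnm z) * pc alpha z) ->
  `|lap (jmul f (cut L (0, 0))) z| <=
    50 * C * (L%:R * expR (- (kappa * L%:R))) * lap (jmul (jpow alpha) (log_weight L)) z.
Proof.
move=> L0 kap0 C0 nz z1 lf hf he.
have z0 := slit_neq0 nz; have Lp : 0 < L%:R :> R by rewrite ltr0n.
have Ln : L%:R != 0 :> R by rewrite gt_eqF.
have w0 := weight_ge0 alpha_itv nz.
have /andP[lw0 lw1] := weight_lap alpha_itv L nz.
have c0 : 0 <= 50 * C * (L%:R * expR (- (kappa * L%:R))).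
  exact: (mulr_ge0 (mulr_ge0 (ler0n R 50) C0) (mulr_ge0 (ltW Lp) (expR_ge0 _))).
have rhs0 : 0 <= 50 * C * (L%:R * expR (- (kappa * L%:R))) * lap (jmul (jpow alpha) (log_weight L)) z.
  exact: mulr_ge0 c0 (le_trans lw0 lw1).
have o0 : offset (0, 0) z = z by rewrite /offset /= !subr0 -surjective_pairing.
have [far|near] := leP (expR (- L%:R)) (modulus z).
  have [_ _ _ ->] : same_jet (jmul f (cut L (0, 0))) f z.
    by apply: flat_jetMr; apply: cut_flat => //; rewrite o0.
  by rewrite lf normr0.
have [close|mid] := leP (modulus z) (expR (- (4 * L%:R))).
  have [_ _ _ ->] : null_jet (jmul f (cut L (0, 0))) z.
    by apply: null_jetM; right; apply: cut_null => //; rewrite o0.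
  by rewrite normr0.
have l1 : lnm z <= - L%:R by rewrite -ler_expR expR_lnm// ltW.
have l4 : - (4 * L%:R) <= lnm z by rewrite -ler_expR expR_lnm// ltW.
have [v0 v1 v2 vl] := cut_radial L z.
have [_ s1 s2] := step_bounded (L%:R^-1 * lnm z + 4).
move: s1 s2 v1 v2 vl; move: (step1 _) (step2 _) => u1 u2 s1 s2 v1 v2 vl.
have i0 : 0 <= (nsq z)^-1 by rewrite invr_ge0 nsq_ge0.
have Li : 0 < L%:R^-1 :> R by rewrite invr_gt0.
have -> : lap (jmul f (cut L (0, 0))) z =
    L%:R^-1 * (jv f z * (L%:R^-1 * u2) + 2 * (u1 * euler f z)) * (nsq z)^-1.
  rewrite lap_mul lf vl v1 v2 (grad_ln z0) /euler /=; ring.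
set X := expR (kappa * lnm z) * pc alpha z in hf he.
have X0 : 0 <= X by rewrite mulr_ge0// expR_ge0.
have Xle : X <= expR (- (kappa * L%:R)) * pc alpha z.
  apply: ler_wpM2r => //; rewrite ler_expR -mulrN; apply: ler_wpM2l => //; exact: ltW.
have b1 : `|jv f z * (L%:R^-1 * u2) + 2 * (u1 * euler f z)| <= 300 * (C * X).
  have CX : 0 <= C * X by exact: mulr_ge0.
  apply: le_trans (ler_normD _ _) _; rewrite !normrM (gtr0_norm Li) (@ger0_norm _ 2)//.
  have a1 : `|jv f z| * (L%:R^-1 * `|u2|) <= C * X * 99.
    apply: ler_pM; [exact: normr_ge0|exact: mulr_ge0 (ltW Li) (normr_ge0 _)|exact: hf|].
    apply: le_trans s2; rewrite ler_piMl// invf_le1// ler1n//.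
  have a2 : `|u1| * `|euler f z| <= 99 * (C * X) by exact: ler_pM.
  move: a1 a2 CX; move: (C * X) (`|_| * _) (`|_| * _) => x1 x2 x3; lra.
rewrite !normrM (gtr0_norm Li) (ger0_norm i0).
apply: le_trans (_ : L%:R^-1 * (300 * (C * (expR (- (kappa * L%:R)) * pc alpha z))) * (nsq z)^-1 <= _).
  apply: ler_wpM2r => //; apply: ler_wpM2l; first exact: ltW.
  by apply: le_trans b1 _; apply: (ler_wpM2l (ler0n R 300)); exact: ler_wpM2l.
have pp : 1 <= ppart (L%:R^-1 * lnm z + 5).
  rewrite /ppart le_max; apply/orP; right.
  by rewrite -(ler_pM2l Lp) (mulrDr _ (L%:R^-1 * _)) mulrA divff// mul1r mulr1; lra.
apply: le_trans (_ : 50 * C * (L%:R * expR (- (kappa * L%:R))) *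
   (pc alpha z * (L%:R^-1 * (L%:R^-1 * (6 * 1))) * (nsq z)^-1) <= _).
  rewrite [leRHS](_ : _ = L%:R^-1 * (300 * (C * (expR (- (kappa * L%:R)) * pc alpha z))) * (nsq z)^-1)//.
  have : nsq z != 0 by rewrite gt_eqF// nsq_gt0.
  move: (nsq z) (expR _) (pc alpha z) => n0 n1 n2 n3; field.
  by rewrite n3 Ln.
apply: (ler_wpM2l c0).
apply: le_trans lw1; apply: ler_wpM2r => //; apply: ler_wpM2l => //.
by do 2 (apply: ler_wpM2l; first exact: ltW); rewrite ler_pM2l.
Qed.

(** The Green identity for [f] times all the cutoffs, including one at the
    origin, has a right-hand side zero; the error with respect to the integral
    of [2 f + z . grad f] is at most [C / L] for every large [L]. *)
Theorem orthogonality f : adjoint p f -> dominated f ->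
  summable ((fun z => 2 * jv f z + euler f z) \_ D) /\
  total ((fun z => 2 * jv f z + euler f z) \_ D) = 0.
Proof.
move=> adj [kappa [C [kap0 C0 dom]]].
have [rho [L1 sc]] := scale_exists SR.
have [rho0 rho1] := andP (scale_pos sc).
have [M [M1 hM]] : exists M : R, 1 <= M /\ forall z, W z -> modulus z <= M.
  have [M M0 hM] := region_modulus SR; exists (M + 1); split; first by rewrite lerDr ltW.
  by move=> z /hM h; apply: le_trans h _; rewrite lerDl.
have M0 : 0 <= M by apply: le_trans M1.
have [CP hP] := potential_bounded SP rho0.
have [Cf Cf0 hf] := bounded4_bound4 (domain_adjoint_bounded SR rho0 adj).
have [B B0 hB] := moment SR SP k_gt0 flow alpha_itv cos_alpha sc.
have [K K0 hK] := majorant_total ((0, 0) :: special).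
have [Ce Ce1 hCe] := cut_product_estimate ((0, 0) :: special).
have [A A0 hA] := square_expR kap0.
have k0 : 0 <= k by exact: ltW.
have Ce0 : 0 <= Ce by apply: le_trans Ce1.
pose Cg := Cf + C; have Cg0 : 0 <= Cg by exact: addr_ge0.
have CfCg : Cf <= Cg by rewrite lerDl.
have CCg : C <= Cg by rewrite lerDr.
set F := fun z => 2 * jv f z + euler f z.
have near_bound z : ~ pos_axis z -> modulus z <= 1 -> `|jv f z| <= C /\ `|euler f z| <= C.
  move=> nz z1; have z0 := slit_neq0 nz; have [h1 h2] := dom z nz z1.
  have h : C * (expR (kappa * lnm z) * pc alpha z) <= C.
    rewrite -[leRHS]mulr1; apply: ler_wpM2l => //; rewrite -[leRHS]mulr1.
    apply: ler_pM; [exact: expR_ge0|exact: (weight_ge0 alpha_itv)| |exact: (weight_le1 alpha_itv)].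
    by rewrite -expR0 ler_expR; apply: mulr_ge0_le0; [exact: ltW|exact: lnm_le0].
  by split; [exact: le_trans h1 h|exact: le_trans h2 h].
have FB z : D z -> `|F z| <= 2 * Cg + 2 * (M * Cg).
  move=> [Wz nz]; apply: le_trans (ler_normD _ _) _; rewrite normrM (@ger0_norm _ 2)//.
  have [near|far] := ltP (modulus z) rho.
    have [h1 h2] := near_bound z nz ltac:(by apply: le_trans rho1; exact: ltW).
    apply: lerD; first by rewrite ler_pM2l//; exact: le_trans h1 CCg.
    apply: le_trans h2 _; apply: le_trans CCg _; rewrite mulrA ler_peMl//.
    by move: M1; lra.
  have [h0 h1 h2 _] := hf z (conj (conj Wz nz) far).
  apply: lerD; first by rewrite ler_pM2l//; exact: le_trans h0 CfCg.
  exact: (euler_bound (le_trans h1 CfCg) (le_trans h2 CfCg) (hM z Wz)).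
have mF : measurable_fun setT (F \_ D : mR2 -> mR).
  apply: domain_continuous; first exact: (slit_domain_open SR).
  move=> z [_ nz]; have [c0 c1 c2] := is_jet_continuous (adjoint_jet adj nz).
  have f1 : {for z, continuous (fst : R * R -> R)} by exact: cvg_fst.
  have f2 : {for z, continuous (snd : R * R -> R)} by exact: cvg_snd.
  have ct : {for z, continuous (fun=> 2 : R)} by exact: cvg_cst.
  exact: (cvgD (cvgM ct c0) (cvgD (cvgM f1 c1) (cvgM f2 c2))).
have FD z : D z -> (F \_ D) z = F z by move=> h; rewrite patchE mem_set.
have F0 z : ~ D z -> (F \_ D) z = 0 by move=> h; rewrite patchE memNset.
have sF : summable (F \_ D).
  apply: (@summable_domain _ _ _ _ _ _ SR _ (2 * Cg + 2 * (M * Cg))) => //.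
    by move=> z Dz; rewrite FD//; exact: FB.
  by apply: addr_ge0; apply: mulr_ge0 => //; exact: mulr_ge0.
split=> //.
suff kT : k * total (F \_ D) = 0 by apply: (mulfI (lt0r_neq0 k_gt0)); rewrite kT mulr0.
pose c1 := (k * (2 * Cg + 2 * (M * Cg)) + k * (2 * (M * Cg)) + `|CP| * (5 * Cg)) * Ce.
have c10 : 0 <= c1.
  apply: mulr_ge0 => //; apply: addr_ge0; last by apply: mulr_ge0 => //; exact: mulr_ge0.
  apply: addr_ge0; apply: mulr_ge0 => //; last by apply: mulr_ge0 => //; exact: mulr_ge0.
  by apply: addr_ge0; apply: mulr_ge0 => //; exact: mulr_ge0.
apply: (@eq0_le_inv _ (c1 * K + 50 * C * B * A) L1) => L LL.
have L0 : (0 < L)%N := leq_trans (scale_L sc) LL.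
have Lp : 0 < L%:R :> R by rewrite ltr0n.
have Lsq : 0 < L%:R ^+ 2 :> R by exact: exprn_gt0.
pose Y := jmul (cut L (0, 0)) (cut_product L special).
pose v := jmul f Y.
have c0 : multiplier a b W (cut L (0, 0)).
  apply: (@cut_multiplier _ a b W c E SR L (expR (- L%:R))) => //; first by rewrite mem_head.
  by move=> /(special_case SR)[nW _]; case: nW; exact: region_origin SR.
have gt : green_test p a b W c E v.
  apply: (green_test_mul SR adj).
  - exact: (multiplierM c0 (scale_product sc LL)).
  - move=> P /(product_null SR L0)[r r0 h]; exists r => // z Pz Dz.
    by apply: null_jetM; right; exact: h.
  - exists (expR (- (4 * L%:R))); first exact: expR_gt0.
    move=> z [_ /slit_neq0 z0] /ltW zd; apply: null_jetM; left; apply: cut_null => //.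
    by rewrite /offset /= !subr0 -surjective_pairing.
have [sd td] := green_identity SR SP flow gt.
set d := green_density Phi k v \_ D in sd td.
have dE z : D z -> d z = green_density Phi k v z by move=> h; rewrite /d patchE mem_set.
have d0 z : ~ D z -> d z = 0 by move=> h; rewrite /d patchE memNset.
have [] := hB L L0; set Q := _ \_ _; move=> sQ tQ.
have QE z : (D `&` [set z | modulus z < rho]) z -> Q z = Phi z * lap (jmul (jpow alpha) (log_weight L)) z.
  by move=> h; rewrite /Q patchE mem_set.
have Q0 z : ~ (D `&` [set z | modulus z < rho]) z -> Q z = 0.
  by move=> h; rewrite /Q patchE memNset.
have [sm tm] := hK L L0.
pose m := majorant L ((0, 0) :: special).
have m0 z : 0 <= m z := majorant_ge0 L _ z.
pose c2 := 50 * C * (L%:R * expR (- (kappa * L%:R))).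
have c20 : 0 <= c2.
  exact: (mulr_ge0 (mulr_ge0 (ler0n R 50) C0) (mulr_ge0 (ltW Lp) (expR_ge0 _))).
have bound z : `|k * (F \_ D) z - d z| <= c1 / L%:R ^+ 2 * m z + c2 * Q z.
  have [Dz|nD] := EM (D z); last first.
    rewrite F0// d0// mulr0 subr0 normr0 Q0 ?mulr0 ?addr0; last by case.
    by apply: mulr_ge0 => //; exact: divr_ge0 c10 (ltW Lsq).
  have [Wz nz] := Dz; have z0 := slit_neq0 nz.
  have est := hCe L z L0 (fun e he => domain_special SR Dz he).
  have [p1 p2] := estimate_partial Ce1 (majorant_gap L _ z) est.
  have [_ e1 _ e2] := est.
  have Phi0 := potential_gt0 SP Dz.
  have lf := adjoint_lap adj nz.
  rewrite FD// dE//.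
  have [near|far] := ltP (modulus z) rho; last first.
    rewrite Q0 ?mulr0 ?addr0; last by case => _ /=; rewrite ltNge far.
    have [h0 h1 h2 h3] := hf z (conj Dz far).
    have bf : bound4 Cg [set z] f by move=> _ ->; split; exact: le_trans CfCg.
    have PP : `|Phi z| <= `|CP| by rewrite gtr0_norm//; exact: le_trans (hP z Dz far) (ler_norm _).
    have := error_far Ce0 Cg0 (normr_ge0 CP) M0 (m0 z) Lsq bf lf (hM z Wz) PP e1 p1 p2 e2.
    by rewrite -/c1 mulrA mulrAC.
  have z1 : modulus z <= 1 by apply: le_trans rho1; exact: ltW.
  have [f1 f2] := near_bound z nz z1; have [dm1 dm2] := dom z nz z1.
  have sY : same_jet Y (cut L (0, 0)) z by apply: flat_jetMr; exact: (scale_flat sc LL near).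
  have sV : same_jet v (jmul f (cut L (0, 0))) z by exact: same_jetM.
  have eN := error_near L0 kap0 C0 nz z1 lf dm1 dm2.
  have [_ _ _ lv] := sV.
  have -> : k * F z - green_density Phi k v z =
      k * (F z * (1 - jv Y z)) - k * (jv f z * euler Y z) + Phi z * lap v z.
    by rewrite /F /green_density euler_mul /=; ring.
  rewrite QE// lv; apply: le_trans (ler_normD _ _) _; apply: lerD; last first.
    rewrite normrM (gtr0_norm Phi0) mulrCA; apply: ler_wpM2l => //; exact: ltW.
  set q := Ce * m z / L%:R ^+ 2.
  have qE (t : R) : `|t| * L%:R ^+ 2 <= Ce * m z -> `|t| <= q by rewrite /q ler_pdivlMr.
  have q1 := qE _ e1; have qx := qE _ p1; have qy := qE _ p2.
  have q0 : 0 <= q by exact: le_trans q1.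
  have ey := euler_bound qx qy (hM z Wz).
  rewrite (_ : c1 / _ * m z = k * ((2 * Cg + 2 * (M * Cg)) * q) + k * (Cg * (2 * (M * q))) +
     `|CP| * (5 * Cg) * q); last by rewrite /q /c1; field; rewrite gt_eqF.
  apply: le_trans (ler_normB _ _) _; rewrite -[leLHS]addr0; apply: lerD; last first.
    by apply: mulr_ge0 => //; apply: mulr_ge0 => //; exact: mulr_ge0.
  rewrite !normrM (ger0_norm k0); apply: lerD; apply: ler_wpM2l => //.
    by apply: ler_pM => //; exact: FB.
  by apply: ler_pM => //; exact: le_trans f1 CCg.
have skF := summableZ k sF.
have sc1 := summableZ (c1 / L%:R ^+ 2) sm.
have sc2 := summableZ c2 sQ.
have -> : k * total (F \_ D) = total (fun z => k * (F \_ D) z - d z).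
  by rewrite totalB// totalZ// (total_eq0 td) subr0.
have := total_norm_le (summableB skF sd) (summableD sc1 sc2) bound.
rewrite [leRHS](totalD sc1 sc2) (totalZ _ sm) (totalZ _ sQ) => h.
apply: le_trans (_ : (c1 / L%:R ^+ 2 * (K * L%:R) + c2 * B) * L%:R <= _).
  apply: ler_wpM2r; first exact: ltW.
  apply: le_trans h _; apply: lerD; apply: ler_wpM2l => //; exact: divr_ge0 c10 (ltW Lsq).
have -> : (c1 / L%:R ^+ 2 * (K * L%:R) + c2 * B) * L%:R =
    c1 * K + 50 * C * B * (L%:R ^+ 2 * expR (- (kappa * L%:R))).
  by rewrite /c2; field; rewrite gt_eqF.
rewrite lerD2l; apply: ler_wpM2l => //.
exact: (mulr_ge0 (mulr_ge0 (ler0n R 50) C0) B0).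
Qed.

End Orthogonality2.

(** * Domination of powers and logarithms *)

Section Domination.
Context {R : realType}.
Implicit Types (z : R * R) (n : nat).

Lemma cos_periodic n (x : R) : cos ((n%:R + x) * (2 * pi)) = cos (x * (2 * pi)).
Proof.
have -> : (n%:R + x) * (2 * pi) = x * (2 * pi) + (pi *+ 2) *+ n :> R.
  by rewrite -mulrnA -[pi *+ (2 * n)]mulr_natl natrM; ring.
by rewrite (periodicn (@cosD2pi R)).
Qed.

Lemma sin_nat_le n (x : R) : `|sin (n%:R * x)| <= n%:R * `|sin x|.
Proof.
elim: n => [|n IH]; first by rewrite !mul0r sin0 normr0.
rewrite -natr1 !mulrDl !mul1r sinD; apply: le_trans (ler_normD _ _) _.
rewrite !normrM; apply: lerD.
  apply: le_trans IH; rewrite ler_piMr//; rewrite ler_norml cos_geN1 cos_le1//.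
by rewrite ler_piMl//; rewrite ler_norml cos_geN1 cos_le1.
Qed.

Lemma norm_sin_le1 (x : R) : `|sin x| <= 1.
Proof. by rewrite ler_norml sin_geN1 sin_le1. Qed.

Lemma norm_cos_le1 (x : R) : `|cos x| <= 1.
Proof. by rewrite ler_norml cos_geN1 cos_le1. Qed.

Lemma sin_quarter (x : R) : `|sin x| <= 4 * `|cos (x / 4)|.
Proof.
have E1 : x = (x / 4 *+ 2) *+ 2 by rewrite !mulr2n; field.
have E2 : sin x = 4 * cos (x / 4) * (cos (x / 4 *+ 2) * sin (x / 4)).
  rewrite [in LHS]E1 !sin_mulr2n; move: (cos _) (cos _) (sin _) => c1 c2 s1.
  by rewrite !mulr2n; ring.
rewrite E2 !normrM (@ger0_norm _ 4)// ler_piMr ?mulr_ge0// -[leRHS]mulr1.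
by apply: ler_pM => //; [exact: norm_cos_le1|exact: norm_sin_le1].
Qed.

Variable alpha : R.
Hypothesis alpha_itv : 0 <= alpha <= 1 / 4.

(** The factor [cos (alpha x)] may vanish at [x = 2 pi], when [alpha = 1 / 4].
    There [sin (n x)] vanishes too:
    [|sin (n x)| <= n |sin x| <= 4 n cos (x / 4) <= 4 n cos (alpha x)]. *)
Lemma angular_bound n (b : bool) (x : R) : 0 <= x <= 2 * pi ->
  `|cos ((n%:R + (-1) ^+ b * alpha) * x)| <= (1 + 4 * n%:R) * cos (alpha * x).
Proof.
move=> /andP[x0 x1]; have pi0 := pi_gt0 R; case/andP: (alpha_itv) => a0 a1.
have ax : 0 <= alpha * x <= x / 4.
  apply/andP; split; first exact: mulr_ge0.
  by rewrite mulrC; apply: ler_wpM2l => //; move: a1; rewrite mul1r.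
have [ax0 ax1] := andP ax.
have q0 : 0 <= cos (x / 4) by apply: cos_ge0_pihalf; apply/andP; split; lra.
have qa : cos (x / 4) <= cos (alpha * x).
  have [->//|ne] := eqVneq (alpha * x) (x / 4).
  rewrite ltW// ltr_cos ?in_itv/=; [|by apply/andP; split; lra|by apply/andP; split; lra].
  by rewrite lt_neqAle ne.
have ca0 : 0 <= cos (alpha * x) := le_trans q0 qa.
have -> : `|cos ((n%:R + (-1) ^+ b * alpha) * x)| =
    `|cos (n%:R * x) * cos (alpha * x) - (-1) ^+ b * (sin (n%:R * x) * sin (alpha * x))|.
  rewrite mulrDl cosD; congr (`| _ |).
  by case: b; rewrite ?expr1 ?expr0 ?mulN1r ?mul1r ?mulNr ?cosN ?sinN; ring.
apply: le_trans (ler_normB _ _) _; rewrite !normrM normrX normrN1 expr1n mul1r (ger0_norm ca0) mulrDl mul1r.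
apply: lerD; first by rewrite ler_piMl// norm_cos_le1.
apply: le_trans (_ : `|sin (n%:R * x)| <= _); first by rewrite ler_piMr// norm_sin_le1.
apply: le_trans (sin_nat_le n x) _; rewrite (mulrC 4) -mulrA; apply: ler_wpM2l => //.
by apply: le_trans (sin_quarter x) _; rewrite ler_pM2l// ger0_norm.
Qed.

Lemma half_power (s l : R) : alpha + 1 / 2 <= s -> l <= 0 ->
  expR (s * l) <= expR (1 / 2 * l) * expR (alpha * l).
Proof.
move=> hs l0; rewrite -expRD -mulrDl ler_expR; apply: ler_wnM2r => //; lra.
Qed.

(** The exponent exceeds [alpha] by at least [1 / 2], since [n >= 1] and
    [alpha <= 1 / 4]. *)
Lemma dominated_pow n (b : bool) : (1 <= n)%N -> dominated alpha (jpow (n%:R + (-1) ^+ b * alpha)).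
Proof.
move=> n1; set s := _ + _; have [a0 a1] := andP alpha_itv.
have n1' : 1 <= n%:R :> R by rewrite ler1n.
have s0 : alpha + 1 / 2 <= s by rewrite /s; case: (b); rewrite ?expr1 ?expr0; lra.
have sp : 0 <= s by lra.
exists (1 / 2), ((1 + s) * (1 + 4 * n%:R)); split; [lra|by rewrite mulr_ge0//; lra|].
move=> z nz z1; have z0 := slit_neq0 nz; rewrite euler_pow//.
have key : `|pc s z| <= (1 + 4 * n%:R) * (expR (1 / 2 * lnm z) * pc alpha z).
  rewrite /pc normrM (ger0_norm (expR_ge0 _)).
  have -> : (1 + 4 * n%:R) * (expR (1 / 2 * lnm z) * (expR (alpha * lnm z) * cos (alpha * arg z))) =
    expR (1 / 2 * lnm z) * expR (alpha * lnm z) * ((1 + 4 * n%:R) * cos (alpha * arg z)) by ring.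
  apply: ler_pM; rewrite ?expR_ge0//; last exact: angular_bound (arg_itv z0).
  by apply: half_power => //; exact: lnm_le0.
set X := (1 + 4 * n%:R) * _ in key *; have X0 : 0 <= X by apply: le_trans key.
rewrite -[(1 + s) * _ * _]mulrA -/X; move: X key X0 => X key X0; split.
  by apply: le_trans key _; rewrite ler_peMl//; lra.
rewrite normrM (ger0_norm sp); apply: ler_pM => //; lra.
Qed.

Hypothesis alpha0 : alpha = 0.

(** For [alpha = 0] the weight is 1, and [|z| |ln |z|| <= 2 |z|^(1/2)]. *)
Lemma dominated_log n : (1 <= n)%N -> dominated alpha (jlog n%:R).
Proof.
move=> n1; have n1' : 1 <= n%:R :> R by rewrite ler1n.
have pi0 := pi_gt0 R.
exists (1 / 2), ((1 + n%:R) * (2 + 2 * pi)); split; [lra|by rewrite mulr_ge0//; lra|].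
move=> z nz z1; have z0 := slit_neq0 nz; rewrite euler_log//.
have l0 : lnm z <= 0 := lnm_le0 z0 z1.
have -> : pc alpha z = 1 by rewrite /pc alpha0 !mul0r expR0 cos0 mulr1.
rewrite mulr1; set l := lnm z in l0 *; set X := expR (1 / 2 * l).
have X0 : 0 <= X by exact: expR_ge0.
have e1 : expR (n%:R * l) <= X.
  by rewrite ler_expR; apply: ler_wnM2r => //; lra.
have e2 : expR (n%:R * l) * `|l| <= 2 * X.
  apply: le_trans (_ : expR l * `|l| <= _).
    by apply: ler_wpM2r => //; rewrite ler_expR -[leRHS]mul1r; exact: ler_wnM2r.
  have -> : expR l = X * X by rewrite -expRD; congr expR; field.
  rewrite -mulrA mulrC; apply: ler_wpM2r => //.
  have h := expR_ge1Dx (- (1 / 2 * l)).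
  rewrite expRN -/X in h.
  have Xp : 0 < X by exact: expR_gt0.
  have : X * `|l| <= X * (2 * X^-1).
    by apply: ler_wpM2l => //; rewrite ler0_norm//; lra.
  by rewrite mulrCA divff ?gt_eqF// mulr1.
have c1 : `|pc n%:R z| <= X.
  rewrite /pc normrM (ger0_norm (expR_ge0 _)); apply: le_trans e1.
  by rewrite ler_piMr ?expR_ge0// norm_cos_le1.
have lcB : `|lc n%:R z| <= (2 + 2 * pi) * X.
  rewrite /lc mulrDl; apply: le_trans (ler_normB _ _) _; rewrite (normrM (pc _ _)) (normrM (ps _ _)); apply: lerD.
    apply: le_trans e2; rewrite /pc normrM (ger0_norm (expR_ge0 _)) -mulrA.
    by apply: ler_wpM2l; [exact: expR_ge0|rewrite ler_piMl// norm_cos_le1].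
  rewrite /ps normrM (ger0_norm (expR_ge0 _)) mulrC.
  have /andP[t0 t1] := arg_itv z0; rewrite (ger0_norm t0).
  apply: ler_pM => //.
  by apply: le_trans e1; rewrite ler_piMr ?expR_ge0// norm_sin_le1.
have Y0 : 0 <= (2 + 2 * pi) * X by apply: le_trans lcB.
have XY : X <= (2 + 2 * pi) * X by rewrite ler_peMl//; lra.
rewrite -mulrA mulrDl mul1r; split.
  by apply: le_trans lcB _; rewrite lerDl mulr_ge0//; lra.
rewrite addrC; apply: le_trans (ler_normD _ _) _; apply: lerD; first exact: le_trans XY.
by rewrite normrM ger0_norm; [apply: ler_wpM2l|]; lra.
Qed.

End Domination.

Section AreaIntegral.
Context {R : realType}.
Local Notation leb := (@lebesgue_measure R).
Local Notation mR := (measurableTypeR R).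
Local Notation mR2 := (measurableTypeR R * measurableTypeR R)%type.
Implicit Types (z : R * R) (n : nat) (f g : R * R -> R).

Lemma arg_axis z : pos_axis z -> z <> (0, 0) -> arg z = 0.
Proof.
move=> [z1 z2] z0; rewrite /arg z2 lexx /modulus z2 expr0n /= addr0 sqrtr_sqr ger0_norm//.
rewrite divff ?acos1//; apply/eqP => z10; apply: z0.
by rewrite [z]surjective_pairing z10 z2.
Qed.

Lemma axis_measurable : measurable (@pos_axis R : set mR2).
Proof. by rewrite -[pos_axis]setCK; apply: measurableC; exact: open_measurable_plane slit_open. Qed.

Lemma axis_null : area (@pos_axis R) = 0%E.
Proof.
apply/eqP; rewrite -measure_le0.
have mS : measurable (setT `*` [set (0 : R)] : set mR2) by exact: measurableX.
apply: (@le_trans _ _ (area (setT `*` [set (0 : R)]))).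
  apply: le_measure; [by apply/mem_set; exact: axis_measurable|exact/mem_set|].
  by move=> z [_ h]; split.
have -> : area (setT `*` [set (0 : R)]) = (leb setT * leb [set 0%R])%E by exact: product_measure1E.
by rewrite lebesgue_measure_set1 mule0.
Qed.

(** On the slit itself, a null set, the integrands are given by the branch from
    above; measurability there must still be checked. *)
Lemma measurable_slit f g : (forall z, ~ pos_axis z -> {for z, continuous f}) ->
  (forall z, z <> (0, 0) -> {for z, continuous g}) ->
  (forall z, pos_axis z -> z <> (0, 0) -> g z = f z) -> measurable_fun setT (f : mR2 -> mR).
Proof.
move=> cf cg fg.
have oN0 : open (~` [set (0, 0)] : set (R * R)).
  by apply: closed_openC; apply: accessible_closed_set1; apply: hausdorff_accessible; exact: norm_hausdorff.
have mN0 : measurable (~` [set (0, 0)] : set mR2) by exact: open_measurable_plane oN0.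
have m0 : measurable ([set (0, 0)] : set mR2) by rewrite -[X in measurable X]setCK; exact: measurableC.
have mA := axis_measurable.
have -> : (setT : set mR2) = ~` pos_axis `|` ((pos_axis `&` ~` [set (0, 0)]) `|` [set (0, 0)]).
  apply/seteqP; split => // z _; have [h|h] := EM (pos_axis z); last by left.
  by right; have [h0|h0] := EM (z = (0, 0)); [right|left].
have mI : measurable (pos_axis `&` ~` [set (0, 0)] : set mR2) by exact: measurableI.
apply/measurable_funU; [exact: measurableC|exact: measurableU|split].
  exact: continuous_measurable_plane slit_open cf.
apply/measurable_funU => //; split; last exact: measurable_fun_set1.
apply: (@eq_measurable_fun _ _ _ _ _ g); first by move=> z /set_mem[h1 h2]; exact: fg.
apply: (measurable_funS mN0); first by move=> z [].
exact: continuous_measurable_plane oN0 cg.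
Qed.

Lemma area_integral_slit (W : set (R * R)) f : open W -> measurable_fun setT (f : mR2 -> mR) ->
  summable (f \_ (W `\` pos_axis)) -> total (f \_ (W `\` pos_axis)) = 0 -> area_integral W f = 0%E.
Proof.
move=> oW mf sf tf; have mW := open_measurable_plane oW.
have -> : area_integral W f = (\int[area]_(z in W) (f z)%:E)%E by [].
rewrite integral_mkcond.
transitivity (\int[area]_z ((f \_ (W `\` pos_axis)) z)%:E)%E.
  apply: ae_eq_integral => //.
  - by apply/(measurable_restrictT _ mW); apply/measurable_EFinP; exact: measurable_funS mf.
  - exact: measurable_int sf.
  - exists pos_axis; split; [exact: axis_measurable|exact: axis_null|].
    move=> z /= h; apply: contrapT => nz; apply: h => _; rewrite !patchE.
    have [zW|zW] := boolP (z \in W); first by rewrite mem_set//; split => //; exact: set_mem.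
    by rewrite memNset//= => -[Wz _]; rewrite mem_set in zW.
have h := integrable_fin_num measurableT sf.
by rewrite -[LHS](fineK h); congr EFin.
Qed.

End AreaIntegral.

(** * Moments of the region *)

Section HeleShaw.
Context {R : realType}.
Local Notation mR := (measurableTypeR R).
Local Notation mR2 := (measurableTypeR R * measurableTypeR R)%type.
Implicit Types (z : R * R) (n : nat) (W : set (R * R)).

Lemma Re_plane_pow z (s : R) : complex.Re (plane_pow z s) = pc s z.
Proof.
by rewrite /plane_pow /cexp /pc /lnm /= !mul0r !subr0 addr0.
Qed.

Lemma Re_plane_pow_log z (s : R) : complex.Re (plane_pow z s * plane_log z) = lc s z.
Proof.
by rewrite /plane_pow /cexp /lc /pc /ps /lnm /= !mul0r !subr0 !addr0.
Qed.

Lemma solution_orthogonal (p alpha : R) W (f : @jet R) : kpr_hele_shaw_solution p W ->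
  0 <= alpha <= 1 / 4 -> cos (alpha * (2 * pi)) = p -> adjoint p f -> dominated alpha f ->
  [/\ open W, summable ((fun z => 2 * jv f z + euler f z) \_ (W `\` pos_axis))
    & total ((fun z => 2 * jv f z + euler f z) \_ (W `\` pos_axis)) = 0].
Proof.
move=> [a [b [c [E [Phi [SR SP [k k0 flow]]]]]]] ha hc adj dom.
have [h1 h2] := orthogonality SR SP k0 flow ha hc adj dom.
by split => //; exact: region_open SR.
Qed.

Lemma measurable_pc (s : R) : measurable_fun setT (pc s : mR2 -> mR).
Proof.
apply: (@measurable_slit R (pc s) (fun z => expR (s * lnm z))).
- by move=> z nz; have [] := is_jet_continuous (is_jet_pow s nz).
- move=> z z0; have d := is_gradM (is_grad_cst s z) (is_grad_lnm z0).
  exact: is_grad_continuous (is_grad_comp d (is_derive_expR _)).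
- by move=> z zp z0; rewrite /pc (arg_axis zp z0) mulr0 cos0 mulr1.
Qed.

Lemma measurable_lc (s : R) : measurable_fun setT (lc s : mR2 -> mR).
Proof.
apply: (@measurable_slit R (lc s) (fun z => expR (s * lnm z) * lnm z)).
- by move=> z nz; have [] := is_jet_continuous (is_jet_log s nz).
- move=> z z0; have dl := is_grad_lnm z0; have d := is_gradM (is_grad_cst s z) dl.
  exact: is_grad_continuous (is_gradM (is_grad_comp d (is_derive_expR _)) dl).
- by move=> z zp z0; rewrite /lc /pc (arg_axis zp z0) mulr0 cos0 mulr1 mulr0 subr0.
Qed.

Lemma patch_scale (D : set (R * R)) (k : R) (f g : R * R -> R) : k != 0 ->
  (forall z, D z -> g z = k * f z) -> f \_ D = fun z => k^-1 * (g \_ D) z.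
Proof.
move=> k0 h; apply/funext => z; rewrite !patchE; case: ifPn => [/set_mem zD|_]; last by rewrite mulr0.
by rewrite h// mulKf.
Qed.

Section Moments.
Variables (p alpha : R) (W : set (R * R)).
Hypothesis sol : kpr_hele_shaw_solution p W.
Hypothesis alpha_itv : 0 <= alpha <= 1 / 4.
Hypothesis cos_alpha : cos (alpha * (2 * pi)) = p.
Local Notation D := (W `\` pos_axis).

Lemma power_total n (b : bool) : (1 <= n)%N ->
  [/\ open W, summable (pc (n%:R + (-1) ^+ b * alpha) \_ D) & total (pc (n%:R + (-1) ^+ b * alpha) \_ D) = 0].
Proof.
move=> n1; set s := _ + _; have [a0 a1] := andP alpha_itv.
have n1' : 1 <= n%:R :> R by rewrite ler1n.
have s2 : 2 + s != 0 by rewrite /s; case: (b); rewrite ?expr1 ?expr0; apply/lt0r_neq0; lra.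
have adj : adjoint p (jpow s).
  apply: adjoint_pow; rewrite -cos_alpha /s cos_periodic.
  by case: (b); rewrite ?expr1 ?expr0 ?mul1r// mulN1r mulNr cosN.
have [oW sf tf] := solution_orthogonal sol alpha_itv cos_alpha adj (dominated_pow alpha_itv b n1).
have -> : pc s \_ D = fun z => (2 + s)^-1 * ((fun z => 2 * jv (jpow s) z + euler (jpow s) z) \_ D) z.
  apply: patch_scale => // z [_ /slit_neq0 z0]; rewrite euler_pow// /=; ring.
by split; [|exact: summableZ|rewrite totalZ// tf mulr0].
Qed.

Lemma power_integral n (b : bool) : (1 <= n)%N ->
  area_integral W (fun z => complex.Re (plane_pow z (n%:R + (-1) ^+ b * alpha))) = 0%E.
Proof.
move=> n1; have [oW sf tf] := power_total b n1.
rewrite (_ : (fun z => _) = pc (n%:R + (-1) ^+ b * alpha)); last by apply/funext => z; exact: Re_plane_pow.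
by apply: area_integral_slit => //; exact: measurable_pc.
Qed.

Lemma log_integral n : p = 1 -> alpha = 0 -> (1 <= n)%N ->
  area_integral W (fun z => complex.Re (plane_pow z n%:R * plane_log z)) = 0%E.
Proof.
move=> p1 al0 n1; have [oW sf tf] := power_total false n1.
rewrite expr0 mul1r al0 addr0 in sf tf.
have n2 : 2 + n%:R != 0 :> R by rewrite lt0r_neq0// ltr_wpDr.
have adj : adjoint p (jlog n%:R) by rewrite p1; exact: adjoint_log.
have [_ sg tg] := solution_orthogonal sol alpha_itv cos_alpha adj (dominated_log al0 n1).
rewrite (_ : (fun z => _) = lc n%:R); last by apply/funext => z; exact: Re_plane_pow_log.
have E : lc n%:R \_ D = fun z => (2 + n%:R)^-1 *
    (((fun z => 2 * jv (jlog n%:R) z + euler (jlog n%:R) z) \_ D) z - (pc n%:R \_ D) z).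
  apply/funext => z; rewrite !patchE; case: ifPn => [/set_mem[_ /slit_neq0 nz]|_]; last by rewrite subr0 mulr0.
  rewrite euler_log//= (_ : _ - _ = (2 + n%:R) * lc n%:R z); last by ring.
  by rewrite mulKf.
apply: area_integral_slit => //; first exact: measurable_lc.
  by rewrite E; apply: summableZ; exact: summableB.
by rewrite E totalZ ?totalB ?tf ?tg ?subrr ?mulr0//; exact: summableB.
Qed.

End Moments.

Lemma acos_le_pihalf (p : R) : 0 <= p <= 1 -> 0 <= acos p <= pi / 2.
Proof.
move=> /andP[p0 p1]; have hp : -1 <= p <= 1 by rewrite p1 andbT; apply: le_trans p0; rewrite lerN10.
rewrite acos_ge0//= leNgt; apply/negP => h.
have K : cos (acos p) = p by apply: acosK; rewrite in_itv.
have l := acos_lepi hp; have pi0 := pi_gt0 R.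
have s0 : 0 < sin (acos p - pi / 2) by apply: sin_gt0_pi; apply/andP; split; lra.
have : p = - sin (acos p - pi / 2) by rewrite -cosDpihalf subrK K.
by move=> E; move: p0; rewrite E oppr_ge0 leNgt s0.
Qed.

End HeleShaw.

Theorem proposition3p3 (R : realType) (p : R) (hp : 0 <= p <= 1) :
  let alpha := acos p / (2 * pi) in
  [/\ (* (i) *)
      forall W : set (R * R), kpr_hele_shaw_solution p W ->
        forall n : nat, (1 <= n)%N ->
          area_integral W (fun z => complex.Re (plane_pow z (n%:R + alpha)))
            = 0%E /\
          area_integral W (fun z => complex.Re (plane_pow z (n%:R - alpha)))
            = 0%E,
      0 <= alpha <= 1 / 4
    & (* (ii) *)
      p = 1 -> alpha = 0 /\
        forall W : set (R * R), kpr_hele_shaw_solution p W ->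
          forall n : nat, (1 <= n)%N ->
            area_integral W (fun z => complex.Re (plane_pow z n%:R))
              = 0%E /\
            area_integral W
              (fun z => complex.Re (plane_pow z n%:R * plane_log z)) = 0%E].
Proof.
move=> alpha; have pi0 := pi_gt0 R; have pp : 0 < 2 * pi :> R by rewrite mulr_gt0.
have /andP[c0 c1] := acos_le_pihalf hp.
have itv : 0 <= alpha <= 1 / 4.
  rewrite /alpha divr_ge0 ?(ltW pp)//= ler_pdivrMr//.
  by have -> : 1 / 4 * (2 * pi) = pi / 2 :> R by field.
have cosa : cos (alpha * (2 * pi)) = p.
  rewrite /alpha divfK ?gt_eqF//; apply: acosK; rewrite in_itv/=.
  by case/andP: hp => p0 ->; rewrite andbT (le_trans _ p0)// lerN10.
have pw (W : set (R * R)) (n : nat) (b : bool) : kpr_hele_shaw_solution p W -> (1 <= n)%N ->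
    area_integral W (fun z => complex.Re (plane_pow z (n%:R + (-1) ^+ b * alpha))) = 0%E.
  by move=> sol n1; exact: (power_integral sol itv cosa b n1).
split => //.
- move=> W sol n n1; split.
    by have := pw W n false sol n1; rewrite expr0 mul1r.
  by have := pw W n true sol n1; rewrite expr1 mulN1r.
- move=> p1; have al0 : alpha = 0 by rewrite /alpha p1 acos1 mul0r.
  split => // W sol n n1; split.
    by have := pw W n false sol n1; rewrite expr0 mul1r al0 addr0.
  exact: (log_integral sol itv cosa p1 al0 n1).
Qed.
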